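(* Let $n\ge 1$, let $\alpha,\beta>0$, and assume that $h:\mathbb R^n\longrightarrow\mathbb R$ verifies $$\|e^{|x|^2/\beta^2}h\|_{L^\infty(\mathbb R^n)}+\|e^{4|\xi|^2/\alpha^2}\,\widehat h\|_{L^\infty(\mathbb R^n)}<+\infty .$$ If $\frac1{\alpha\beta}>\frac14$, then $h\equiv 0$. Also, if $\frac1{\alpha\beta}=\frac14$, then $h$ is a constant multiple of $e^{-|x|^2/\beta^2}$.
   Context: The Fourier transform is normalized as $\widehat h(\xi)=(2\pi)^{-n/2}\int_{\mathbb R^n}e^{-i\xi\cdot x}h(x)\,dx$, $\xi\in\mathbb R^n$. Functions are measurable, and equalities of functions are understood almost everywhere. *)

(* Defs.v *)
From HB Require Import structures.
From mathcomp Require Import all_boot all_order all_algebra.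
From mathcomp Require Import all_classical all_reals all_analysis.
From mathcomp Require Import complex.

Set Implicit Arguments.
Unset Strict Implicit.
Unset Printing Implicit Defensive.

Import Order.TTheory GRing.Theory Num.Theory.
Import numFieldNormedType.Exports.

Local Open Scope classical_set_scope.
Local Open Scope ring_scope.
Local Open Scope complex_scope.

(* Tuples over the Borel line carry the sigma-algebra generated by the
   coordinates, i.e. the Borel sigma-algebra of R^n. *)
Notation Rspace R n := (n.-tuple (measurableTypeR R)).

Section lebesgue_measure_Rspace.
Context {R : realType}.

Definition Rcons n (p : measurableTypeR R * Rspace R n) : Rspace R n.+1 :=
  [tuple of p.1 :: p.2].

Definition Runcons n (x : Rspace R n.+1) : measurableTypeR R * Rspace R n :=
  (tnth x ord0, [tuple of behead x]).

Lemma measurable_Rcons n : measurable_fun setT (@Rcons n).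
Proof. exact: measurable_cons. Qed.

Lemma measurable_Runcons n : measurable_fun setT (@Runcons n).
Proof.
apply/measurable_fun_pair; [exact: measurable_tnth|exact: measurable_behead].
Qed.

Lemma RconsK n : cancel (@Rcons n) (@Runcons n).
Proof. by move=> [a x]; congr pair; apply/val_inj. Qed.

Lemma RunconsK n : cancel (@Runcons n) (@Rcons n).
Proof. by move=> x; apply/val_inj; rewrite [in RHS](tuple_eta x). Qed.

Section step.
Variables (n : nat) (mu : {sigma_finite_measure set (Rspace R n) -> \bar R}).

Definition lebesgue_step : set (Rspace R n.+1) -> \bar R :=
  pushforward (lebesgue_measure \x mu)%E (@Rcons n).

Let preimage_Rcons (A : set (Rspace R n.+1)) :
  measurable A -> measurable (@Rcons n @^-1` A).
Proof. by move=> mA; rewrite -[X in measurable X]setTI; exact: measurable_Rcons. Qed.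

Let lebesgue_step0 : lebesgue_step set0 = 0%E.
Proof. by rewrite /lebesgue_step /pushforward preimage_set0 measure0. Qed.

Let lebesgue_step_ge0 A : (0 <= lebesgue_step A)%E.
Proof. exact: (measure_ge0 (lebesgue_measure \x mu)%E). Qed.

Let lebesgue_step_sigma_additive : semi_sigma_additive lebesgue_step.
Proof.
move=> F mF tF mUF; rewrite /lebesgue_step /pushforward preimage_bigcup.
apply: measure_semi_sigma_additive => [i||].
- exact: preimage_Rcons.
- apply/trivIsetP => i j _ _ ij; rewrite -preimage_setI.
  by move/trivIsetP : tF => /(_ _ _ _ _ ij) ->//; rewrite preimage_set0.
- by rewrite -preimage_bigcup; exact: preimage_Rcons.
Qed.

HB.instance Definition _ := isMeasure.Build _ _ _ lebesgue_step
  lebesgue_step0 lebesgue_step_ge0 lebesgue_step_sigma_additive.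

Let lebesgue_step_sigma_finite : sigma_finite setT lebesgue_step.
Proof.
have /sigma_finiteP[F [FT Fnd Foo]] :=
  sigma_finiteT (@lebesgue_measure R).
have /sigma_finiteP[G [GT Gnd Goo]] := sigma_finiteT mu.
exists (fun i => @Runcons n @^-1` (F i `*` G i)).
  apply/esym; rewrite -subTset => x _.
  have : setT (Runcons x).1 by []. have : setT (Runcons x).2 by [].
  rewrite {1}GT {1}FT => -[j _ Gj] [i _ Fi]; exists (maxn i j) => //; split.
  - by move: Fi; exact/subsetPset/Fnd/leq_maxl.
  - by move: Gj; exact/subsetPset/Gnd/leq_maxr.
move=> i; have [mF Fioo] := Foo i; have [mG Gioo] := Goo i; split.
  rewrite -[X in measurable X]setTI; apply: measurable_Runcons => //.
  exact: measurableX.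
rewrite /lebesgue_step /pushforward -comp_preimage.
rewrite (_ : _ \o _ = id); last by apply/funext => p /=; rewrite RconsK.
by rewrite preimage_id product_measure1E// lte_mul_pinfty// ge0_fin_numE.
Qed.

HB.instance Definition _ := Measure_isSigmaFinite.Build _ _ _ lebesgue_step
  lebesgue_step_sigma_finite.

End step.

(* n-fold product of the one-dimensional Lebesgue measure; see [lebesgue_box]. *)
Fixpoint lebesgue n : {sigma_finite_measure set (Rspace R n) -> \bar R} :=
  match n with
  | 0 => \d_[tuple]
  | m.+1 => lebesgue_step (lebesgue m)
  end.

Lemma lebesgue_box n (A : 'I_n -> set (measurableTypeR R)) :
  (forall i, measurable (A i)) ->
  lebesgue n [set x | forall i, A i (tnth x i)] =
  (\prod_(i < n) lebesgue_measure (A i))%E.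
Proof.
elim: n => [|n IH] in A *; move=> mA.
  rewrite big_ord0 /= diracE mem_set// => -[].
  by [].
rewrite big_ord_recl -(IH (fun i => A (lift ord0 i)))//.
rewrite -product_measure1E//; last first.
  rewrite (_ : mkset _ =
    \bigcap_(i in [set: 'I_n]) ((@tnth n _)^~ i @^-1` A (lift ord0 i))).
    apply: fin_bigcap_measurable => // i _.
    by rewrite -[X in measurable X]setTI; exact: measurable_tnth.
  by apply/seteqP; split => x /= h i => [_|]; apply: h.
rewrite /= /lebesgue_step /pushforward; congr product_measure1.
apply/seteqP; split => [[a x] /= h|[a x] /= [h0 h] i].
  split; first exact: (h ord0).
  by move=> i; have := h (lift ord0 i); rewrite tnthS.
by case: (unliftP ord0 i) => [j ->|->//]; rewrite tnthS; exact: h.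
Qed.

(* [measurable] on [Rspace R n] means Borel; Lebesgue-measurable sets are the
   Borel sets modulo subsets of Borel null sets.  The integral of a nonnegative
   function is a supremum over Borel simple functions below it, so integrals of
   Lebesgue-measurable functions have their usual value. *)
Definition lebesgue_measurable_set n (A : set (Rspace R n)) :=
  exists2 B, measurable B &
    (lebesgue n).-negligible ((A `\` B) `|` (B `\` A)).

Definition lebesgue_measurable_fun n (f : Rspace R n -> R) :=
  forall Y : set R, measurable Y -> lebesgue_measurable_set (f @^-1` Y).

End lebesgue_measure_Rspace.

Section fourier.
Context {R : realType} {n : nat}.
Implicit Types (x xi : Rspace R n).

Definition dot x xi : R := \sum_(i < n) (tnth x i : R) * (tnth xi i : R).

Definition enorm x : R := Num.sqrt (dot x x).

Definition expi (t : R) : R[i] := cos t +i* sin t.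

(* A component that is not integrable contributes 0. *)
Definition Cintegral (f : Rspace R n -> R[i]) : R[i] :=
  (\int[lebesgue n]_x complex.Re (f x)) +i* (\int[lebesgue n]_x complex.Im (f x)).

Definition fourier (f : Rspace R n -> R[i]) xi : R[i] :=
  ((2 * pi) `^ (- (n%:R / 2)))%:C *
  Cintegral (fun x => expi (- dot xi x) * f x).

Definition Linfty_norm (f : Rspace R n -> R[i]) : \bar R :=
  'N[lebesgue n]_(+oo)[EFin \o @ComplexField.Normc.normc R \o f]%E.

End fourier.

(* Main.v *)
From HB Require Import structures.
Require Import Defs.
From mathcomp Require Import all_boot all_order all_algebra.
From mathcomp Require Import all_classical all_reals all_analysis.
From mathcomp Require Import complex ring lra measurable_realfun ess_sup_inf.

(** Put a = 1/beta^2 and b = 4/alpha^2, so that h is O(e^{-a|x|^2}) and its Fourier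
    transform Fh is O(e^{-b|xi|^2}); the critical case is 4ab = 1 and the first claim
    is the case 4ab > 1.

    _Reductions._ Changing h on a null set makes it a Borel function satisfying its
    Gaussian bound everywhere ([borel_representative]); its transform is continuous,
    so the second bound holds everywhere as well ([trig_bound_everywhere]).  If
    4ab > 1, weakening the first bound to the critical exponent 1/(4b) < a shows that
    h is a multiple of e^{-|x|^2/(4b)}, and only the multiple 0 is O(e^{-a|x|^2})
    ([hardy_borel_supercritical]).

    _From R^n to a line._ In the critical case subtract the multiple of e^{-a|x|^2}
    with the same integral; it remains to show that h = 0 if moreover h has integral 0.
    For a direction c, the function psi(y) = |Fh(yc)|^2, up to a constant, is the
    integral of H(x,x') cos(y t), where H(x,x') = h(x)h(x') and t = c.x - c.x'.  With
    |c|^2 = 2a, psi is O(e^{-y^2}), while the integral of |H| e^{(1-k)t^2/4} grows at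
    most like a power of 1/k as k tends to 0.  Moreover psi(0) = 0.

    _The line_ ([hardy_line]).  Consider the two functions
      f1(s) = s^{-1} (integral of psi(y) e^{y^2} e^{-y^2/s} dy)^2,
      f2(s) = pi s^{-1} (integral of H e^{t^2/4} e^{-t^2/(4s)})^2,
    holomorphic for Re s > 0 and of polynomial growth on each half-plane
    Re s >= delta.  Parseval's formula against the Gaussian e^{-(1/s-1)y^2} says that
    f1(s) = f2(1-s) for 0 < s < 1; the squares are there because the transform of a
    Gaussian introduces a square root.  Hence f1(s) and f2(1-s) patch together to an
    entire function of polynomial growth, a polynomial by Liouville's theorem
    ([half_planes_liouville]).  It is bounded on [1, +oo), because
    psi(y) e^{y^2} is bounded, so it is constant, equal to f2(1), which is pi times
    the square of the integral of H, that is, 0.  So psi is orthogonal to e^{-p y^2}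
    whenever Re p > 0, and being even it is 0.  Passing to the variable s takes the
    place of the usual Phragmen-Lindelof argument.

    Then Fh = 0, and h = 0 because the Fourier transform is injective
    ([fourier_injective]).  Injectivity, also in the variable y^2 on the line, is
    obtained from the algebra of the bounded functions by which the relation
    of orthogonality to all trigonometric functions may be multiplied.

    The complex analysis is built on differentiability with a uniform quadratic
    remainder ([hol]); Cauchy's formula then follows by contracting a circle to a
    point ([cauchy_contraction]), and Taylor expansions with Cauchy's estimates give
    the identity theorem and Liouville's theorem. *)

Set Implicit Arguments.
Unset Strict Implicit.
Unset Printing Implicit Defensive.

Import Order.TTheory GRing.Theory Num.Theory.
Import numFieldNormedType.Exports.

Local Open Scope classical_set_scope.
Local Open Scope ring_scope.
Local Open Scope complex_scope.

(** * Complex numbers and complex-valued integrals *)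

Definition cnorm {R : realType} (z : R[i]) : R := ComplexField.Normc.normc z.

Section complex_norm.
Context {R : realType}.
Implicit Types z w : R[i].

Lemma cnorm_ge0 z : 0 <= cnorm z.
Proof. by case: z => a b; rewrite /cnorm /= sqrtr_ge0. Qed.

Lemma cnormM z w : cnorm (z * w) = cnorm z * cnorm w.
Proof. exact: ComplexField.Normc.normcM. Qed.

Lemma cnormV z : cnorm z^-1 = (cnorm z)^-1.
Proof. exact: ComplexField.Normc.normcV. Qed.

Lemma cnorm0 : cnorm (0 : R[i]) = 0.
Proof. exact: ComplexField.Normc.normc0. Qed.

Lemma cnorm1 : cnorm (1 : R[i]) = 1.
Proof. exact: ComplexField.Normc.normc1. Qed.

Lemma cnorm_eq0 z : cnorm z = 0 -> z = 0.
Proof. exact: ComplexField.Normc.eq0_normc. Qed.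

Lemma cnorm_gt0 z : z != 0 -> 0 < cnorm z.
Proof.
by move=> z0; rewrite lt_def cnorm_ge0 andbT; apply: contra z0 => /eqP/cnorm_eq0 ->.
Qed.

Lemma cnormN z : cnorm (- z) = cnorm z.
Proof. exact: (@normcN R z). Qed.

Lemma cnormD z w : cnorm (z + w) <= cnorm z + cnorm w.
Proof. exact: (@le_normcD R z w). Qed.

Lemma cnormB z w : cnorm (z - w) <= cnorm z + cnorm w.
Proof. by rewrite -(cnormN w) cnormD. Qed.

Lemma cnormBC z w : cnorm (z - w) = cnorm (w - z).
Proof. by rewrite -cnormN opprB. Qed.

Lemma cnormX z n : cnorm (z ^+ n) = cnorm z ^+ n.
Proof. by elim: n => [|n IH]; rewrite ?expr0 ?cnorm1// !exprS cnormM IH. Qed.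

Lemma cnormR (x : R) : cnorm x%:C = `|x|.
Proof. by rewrite /cnorm /= expr0n /= addr0 sqrtr_sqr. Qed.

Lemma cnormi : cnorm ('i%C : R[i]) = 1.
Proof. by rewrite /cnorm /= expr0n expr1n add0r sqrtr1. Qed.

Lemma Re_le_cnorm z : `|complex.Re z| <= cnorm z.
Proof.
case: z => a b; rewrite /cnorm /= -sqrtr_sqr ler_sqrt ?addr_ge0 ?sqr_ge0//.
by rewrite lerDl sqr_ge0.
Qed.

Lemma Im_le_cnorm z : `|complex.Im z| <= cnorm z.
Proof.
case: z => a b; rewrite /cnorm /= -sqrtr_sqr ler_sqrt ?addr_ge0 ?sqr_ge0//.
by rewrite lerDr sqr_ge0.
Qed.

Lemma cnorm_le_ReIm z : cnorm z <= `|complex.Re z| + `|complex.Im z|.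
Proof.
have -> : z = (complex.Re z)%:C + 'i%C * (complex.Im z)%:C.
  by case: z => a b; simpc.
apply: (le_trans (cnormD _ _)); rewrite cnormM !cnormR.
by rewrite cnormi mul1r; case: z => a b /=; simpc.
Qed.

Lemma cnorm_sqr z : cnorm z ^+ 2 = complex.Re z ^+ 2 + complex.Im z ^+ 2.
Proof. by case: z => a b; rewrite /cnorm /= sqr_sqrtr// addr_ge0 ?sqr_ge0. Qed.

Lemma ReD z w : complex.Re (z + w) = complex.Re z + complex.Re w.
Proof. by case: z; case: w. Qed.
Lemma ImD z w : complex.Im (z + w) = complex.Im z + complex.Im w.
Proof. by case: z; case: w. Qed.
Lemma ReN z : complex.Re (- z) = - complex.Re z. Proof. by case: z. Qed.
Lemma ImN z : complex.Im (- z) = - complex.Im z. Proof. by case: z. Qed.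
Lemma ReM z w : complex.Re (z * w) =
  complex.Re z * complex.Re w - complex.Im z * complex.Im w.
Proof. by case: z; case: w. Qed.
Lemma ImM z w : complex.Im (z * w) =
  complex.Re z * complex.Im w + complex.Im z * complex.Re w.
Proof. by case: z => a b; case: w => c d /=; simpc. Qed.

Lemma complex_eq z w : complex.Re z = complex.Re w ->
  complex.Im z = complex.Im w -> z = w.
Proof. by case: z => a b; case: w => c d /= -> ->. Qed.

End complex_norm.

Definition ReImE {R : realType} := (@ReM R, @ImM R, @ReD R, @ImD R, @ReN R, @ImN R).

Section complex_integral.
Context d {T : measurableType d} {R : realType} (mu : {measure set T -> \bar R}).
Variable D : set T.
Hypothesis mD : measurable D.
Implicit Types (u v : T -> R[i]) (g : T -> R).

Definition Cint u : R[i] :=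
  (\int[mu]_(x in D) complex.Re (u x)) +i* (\int[mu]_(x in D) complex.Im (u x)).

Definition Cintegrable u :=
  mu.-integrable D (fun x => (complex.Re (u x))%:E) /\
  mu.-integrable D (fun x => (complex.Im (u x))%:E).

Lemma CintegrableD u v : Cintegrable u -> Cintegrable v ->
  Cintegrable (fun x => u x + v x).
Proof.
move=> [u1 u2] [v1 v2]; split.
  by under eq_fun do rewrite ReD EFinD; exact: integrableD.
by under eq_fun do rewrite ImD EFinD; exact: integrableD.
Qed.

Lemma CintegrableZ (c : R[i]) u : Cintegrable u -> Cintegrable (fun x => c * u x).
Proof.
move=> [u1 u2]; split.
  under eq_fun do rewrite ReM EFinB !EFinM.
  by apply: integrableB => //; exact: integrableZl.
under eq_fun do rewrite ImM EFinD !EFinM.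
by apply: integrableD => //; exact: integrableZl.
Qed.

Lemma CintD u v : Cintegrable u -> Cintegrable v ->
  Cint (fun x => u x + v x) = Cint u + Cint v.
Proof.
move=> [u1 u2] [v1 v2]; rewrite /Cint; apply: complex_eq; rewrite !ReImE /=.
  by under eq_Rintegral do rewrite ReD; rewrite RintegralD.
by under eq_Rintegral do rewrite ImD; rewrite RintegralD.
Qed.

Lemma CintZ (c : R[i]) u : Cintegrable u -> Cint (fun x => c * u x) = c * Cint u.
Proof.
move=> [u1 u2]; rewrite /Cint.
have intZ a f : mu.-integrable D (EFin \o f) ->
    mu.-integrable D (EFin \o (fun x => a * f x)).
  by move=> fi; rewrite /comp; under eq_fun do rewrite EFinM; exact: integrableZl.
apply: complex_eq; rewrite !ReImE /=.
  under eq_Rintegral do rewrite ReM.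
  by rewrite (RintegralB mD (intZ _ (fun x => complex.Re (u x)) u1) (intZ _ (fun x => complex.Im (u x)) u2)) !RintegralZl.
under eq_Rintegral do rewrite ImM.
by rewrite (RintegralD mD (intZ _ (fun x => complex.Im (u x)) u2) (intZ _ (fun x => complex.Re (u x)) u1)) !RintegralZl.
Qed.

Lemma CintegrableB u v : Cintegrable u -> Cintegrable v ->
  Cintegrable (fun x => u x - v x).
Proof.
move=> iu iv; under eq_fun do rewrite -mulN1r.
by apply: CintegrableD => //; exact: CintegrableZ.
Qed.

Lemma CintB u v : Cintegrable u -> Cintegrable v ->
  Cint (fun x => u x - v x) = Cint u - Cint v.
Proof.
move=> iu iv; rewrite -mulN1r -CintZ// -CintD//; last exact: CintegrableZ.
by congr Cint; apply/funext => x; rewrite mulN1r.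
Qed.

Lemma le_cnorm_Cint u g : Cintegrable u -> mu.-integrable D (EFin \o g) ->
  (forall x, D x -> cnorm (u x) <= g x) ->
  cnorm (Cint u) <= 2 * \int[mu]_(x in D) g x.
Proof.
move=> [u1 u2] ig ug; apply: (le_trans (cnorm_le_ReIm _)).
rewrite mulr_natl mulr2n /=; apply: lerD.
  apply: (le_trans (le_normr_Rintegral mD u1)); apply: le_Rintegral => //.
    exact: (integrable_norm u1).
  by move=> x Dx; rewrite (le_trans (Re_le_cnorm _))// ug.
apply: (le_trans (le_normr_Rintegral mD u2)); apply: le_Rintegral => //.
  exact: (integrable_norm u2).
by move=> x Dx; rewrite (le_trans (Im_le_cnorm _))// ug.
Qed.

End complex_integral.

Section complex_exp.
Context {R : realType}.
Implicit Types z w : R[i].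

Definition cexp z : R[i] := (expR (complex.Re z))%:C * expi (complex.Im z).

Lemma cnorm_expi (t : R) : cnorm (expi t) = 1.
Proof. by rewrite /cnorm /expi /= cos2Dsin2 sqrtr1. Qed.

Lemma expiD (s t : R) : expi (s + t) = expi s * expi t.
Proof. by rewrite /expi cosD sinD; simpc; congr (_ +i* _); ring. Qed.

Lemma expi0 : expi (0 : R) = 1.
Proof. by rewrite /expi cos0 sin0. Qed.

Lemma expi_neq0 (t : R) : expi t != 0.
Proof.
by apply/eqP => /(congr1 cnorm); rewrite cnorm_expi cnorm0 => /eqP; rewrite oner_eq0.
Qed.

Lemma expiN (t : R) : expi (- t) = (expi t)^-1.
Proof.
by apply: (mulfI (expi_neq0 t)); rewrite mulfV ?expi_neq0// -expiD subrr expi0.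
Qed.

Lemma cexpD z w : cexp (z + w) = cexp z * cexp w.
Proof. by rewrite /cexp ReD ImD expRD expiD rmorphM /=; ring. Qed.

Lemma cnorm_cexp z : cnorm (cexp z) = expR (complex.Re z).
Proof. by rewrite /cexp cnormM cnorm_expi mulr1 cnormR ger0_norm ?expR_ge0. Qed.

Lemma cexpR (x : R) : cexp x%:C = (expR x)%:C.
Proof. by rewrite /cexp /= expi0 mulr1. Qed.

Lemma cos_ge1B (t : R) : 1 - t ^+ 2 / 2 <= cos t.
Proof.
wlog t0 : t / 0 <= t.
  move=> H; have [/H//|t0] := leP 0 t.
  by rewrite -cosN -sqrrN; apply: H; rewrite oppr_ge0 ltW.
have [->|tn0] := eqVneq t 0; first by rewrite cos0 expr0n /= mul0r subr0.
have tpos : 0 < t by rewrite lt_def tn0.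
pose f (x : R) := cos x + x ^+ 2 / 2.
have df (x : R) : is_derive x 1 f (- sin x + x).
  rewrite /f; apply: is_derive_eq; rewrite /GRing.scale /=; lra.
have sle (x : R) : 0 < x -> sin x <= x.
  move=> x0.
  have [y _] := @MVT R sin cos 0 x x0 (fun r _ => is_derive_sin r)
    (continuous_subspaceT (@continuous_sin R)).
  rewrite sin0 !subr0 => ->; by rewrite ler_piMl ?(ltW x0)// cos_le1.
have [|y yI] := @MVT R f (fun x => - sin x + x) 0 t tpos (fun x0 _ => df x0).
  apply: continuous_subspaceT => x; apply: differentiable_continuous.
  by apply/derivable1_diffP; case: (df x).
rewrite /f cos0 expr0n /= mul0r addr0 subr0 => e.
have : 0 <= cos t + t ^+ 2 / 2 - 1.
  rewrite e mulr_ge0// addrC subr_ge0 sle//.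
  by move: yI; rewrite in_itv /= => /andP[].
lra.
Qed.

Lemma sin_sub_le (t : R) : `|sin t - t| <= t ^+ 2.
Proof.
wlog t0 : t / 0 <= t.
  move=> H; have [/H//|t0] := leP 0 t.
  have -> : sin t - t = - (sin (- t) - - t) by rewrite sinN; ring.
  by rewrite normrN -sqrrN; apply: H; rewrite oppr_ge0 ltW.
have [->|tn0] := eqVneq t 0; first by rewrite sin0 subr0 normr0 expr0n.
have tpos : 0 < t by rewrite lt_def tn0.
pose f (x : R) := sin x - x.
have df (x : R) : is_derive x 1 f (cos x - 1) by rewrite /f; apply: is_derive_eq.
have [|y yI] := @MVT R f (fun x => cos x - 1) 0 t tpos (fun x0 _ => df x0).
  apply: continuous_subspaceT => x; apply: differentiable_continuous.
  by apply/derivable1_diffP; case: (df x).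
rewrite /f sin0 !subr0 => ->.
move: yI; rewrite in_itv /= => /andP[y0 yt].
rewrite normrM (gtr0_norm tpos) expr2 ler_pM2r// ler0_norm ?subr_le0 ?cos_le1//.
rewrite opprB.
have [y2|y2] := leP y 2.
  have := cos_ge1B y; have : y ^+ 2 / 2 <= y by nra.
  lra.
by have := cos_geN1 y; lra.
Qed.

Lemma cnorm_expi_sub (t : R) : cnorm (expi t - 1 - 'i%C * t%:C) <= 2 * t ^+ 2.
Proof.
apply: (le_trans (cnorm_le_ReIm _)).
have -> : complex.Re (expi t - 1 - 'i%C * t%:C) = cos t - 1.
  by rewrite !ReImE /=; ring.
have -> : complex.Im (expi t - 1 - 'i%C * t%:C) = sin t - t.
  by rewrite !ReImE /=; ring.
rewrite mulr2n mulrDl mul1r; apply: lerD; last exact: sin_sub_le.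
rewrite ler0_norm; last by rewrite subr_le0 cos_le1.
have := cos_ge1B t; have := sqr_ge0 t; lra.
Qed.

Lemma expR_sub_le (x : R) : `|expR x - 1 - x| <= x ^+ 2 * (1 + expR x).
Proof.
have [->|x0] := eqVneq x 0; first by rewrite expR0 subrr subr0 normr0 expr0n /= mul0r.
have [x1 | x1] := leP 0 x.
  have xp : 0 < x by rewrite lt_def x0.
  have e1 : 1 + x <= expR x by exact: expR_ge1Dx.
  have e2 : 1 - x <= expR (- x) by exact: expR_ge1Dx.
  have e3 : expR x * expR (- x) = 1 by rewrite -expRD subrr expR0.
  rewrite ger0_norm; last lra.
  have e0 := expR_gt0 x.
  have : expR x * (1 - x) <= 1 by rewrite -[leRHS]e3 ler_pM2l.
  nra.
have e1 : 1 + x <= expR x by exact: expR_ge1Dx.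
have e2 : 1 - x <= expR (- x) by exact: expR_ge1Dx.
have e3 : expR x * expR (- x) = 1 by rewrite -expRD subrr expR0.
rewrite ger0_norm; last lra.
have e0 := expR_gt0 x.
have : expR x * (1 - x) <= 1 by rewrite -[leRHS]e3 ler_pM2l.
nra.
Qed.

Lemma expR_sub1_le (x : R) : `|expR x - 1| <= `|x| * (1 + expR x).
Proof.
have e1 : 1 + x <= expR x by exact: expR_ge1Dx.
have e2 : 1 - x <= expR (- x) by exact: expR_ge1Dx.
have e3 : expR x * expR (- x) = 1 by rewrite -expRD subrr expR0.
have e0 := expR_gt0 x.
have e4 : expR x * (1 - x) <= 1 by rewrite -[leRHS]e3 ler_pM2l.
have [x1 | x1] := leP 0 x.
  by rewrite (ger0_norm x1) ger0_norm; nra.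
have E1 : expR x <= 1 by rewrite expR_le1 ltW.
by rewrite (ltr0_norm x1) ler0_norm; nra.
Qed.

(** Second-order Taylor remainder of the exponential, obtained by treating the
    real and the imaginary part of the exponent one after the other. *)
Lemma cnorm_cexp_sub z :
  cnorm (cexp z - 1 - z) <= 4 * cnorm z ^+ 2 * (1 + expR (complex.Re z)).
Proof.
set x := complex.Re z; set y := complex.Im z.
have -> : cexp z - 1 - z = (expR x - 1 - x)%:C +
    (expR x)%:C * (expi y - 1 - 'i%C * y%:C) + 'i%C * (y * (expR x - 1))%:C.
  have {2}-> : z = x%:C + 'i%C * y%:C by rewrite /x /y; case: (z) => a b; simpc.
  by rewrite /cexp -/x -/y !(rmorphB, rmorphM, rmorph1) /=; ring.

apply: (le_trans (cnormD _ _)); apply: (le_trans (lerD (cnormD _ _) (lexx _))).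
rewrite !cnormM cnormi mul1r !cnormR normrM.
have h1 := expR_sub_le x; have h2 := cnorm_expi_sub y; have h3 := expR_sub1_le x.
have e0 := expR_gt0 x.
rewrite (gtr0_norm e0) cnorm_sqr -/x -/y.
have h4 : `|y| * `|expR x - 1| <= `|y| * (`|x| * (1 + expR x)) by rewrite ler_wpM2l.
have h5 : expR x * cnorm (expi y - 1 - 'i%C * y%:C) <= expR x * (2 * y ^+ 2).
  by rewrite ler_wpM2l// ltW.
have h6 : `|y| * `|x| <= x ^+ 2 + y ^+ 2.
  rewrite -(real_normK (num_real x)) -(real_normK (num_real y)).
  have := sqr_ge0 (`|x| - `|y|); have := sqr_ge0 (`|x| + `|y|); nra.
have h7 : `|y| * (`|x| * (1 + expR x)) <= (x ^+ 2 + y ^+ 2) * (1 + expR x).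
  by rewrite mulrA ler_wpM2r// addr_ge0// ltW.
have := sqr_ge0 x; have := sqr_ge0 y; nra.
Qed.

End complex_exp.

(** * Holomorphic functions *)

Section holomorphic.
Context {R : realType}.
Implicit Types (z w : R[i]) (f g : R[i] -> R[i]) (K : set R[i]).

Definition hol_with K f f' (M : R) := [/\ 0 <= M,
  forall z, K z -> cnorm (f z) <= M,
  forall z, K z -> cnorm (f' z) <= M &
  forall z w, K z -> K w ->
    cnorm (f w - f z - f' z * (w - z)) <= M * cnorm (w - z) ^+ 2].

(** Complex differentiability on K with a uniform quadratic remainder.  Every
    function met here satisfies this stronger form on the sets where it is
    needed, and it makes Cauchy's theorem a matter of adding up small errors,
    with no compactness and no differentiation under the integral sign. *)
Definition hol K f := exists f' M, hol_with K f f' M.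

Lemma holS K K' f : K `<=` K' -> hol K' f -> hol K f.
Proof.
move=> KK' [f' [M [M0 h1 h2 h3]]]; exists f', M; split => // z; first by move/KK'/h1.
  by move/KK'/h2.
by move=> w /KK' Kz /KK'; exact: h3.
Qed.

Lemma eq_hol K f g : (forall z, K z -> f z = g z) -> hol K f -> hol K g.
Proof.
move=> fg [f' [M [M0 h1 h2 h3]]]; exists f', M; split => // z.
  by move=> Kz; rewrite -fg ?h1.
by move=> w Kz Kw; rewrite -!fg// h3.
Qed.

Lemma hol_lipschitz K f f' M : hol_with K f f' M ->
  forall z w, K z -> K w -> cnorm (f w - f z) <= 2 * M * cnorm (w - z).
Proof.
move=> [M0 h1 h2 h3] z w Kz Kw; set d := cnorm (w - z).
have d0 : 0 <= d by exact: cnorm_ge0.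
have [d1|d1] := leP d 1.
  have -> : f w - f z = (f w - f z - f' z * (w - z)) + f' z * (w - z) by ring.
  apply: (le_trans (cnormD _ _)); rewrite cnormM -/d.
  have := h3 z w Kz Kw; rewrite -/d.
  have : cnorm (f' z) * d <= M * d by rewrite ler_wpM2r// h2.
  have : M * d ^+ 2 <= M * d by rewrite expr2 ler_wpM2l// ler_piMl.
  lra.
apply: (le_trans (cnormB _ _)); have := h1 _ Kw; have := h1 _ Kz; nra.
Qed.

(** The derivative inherits a Lipschitz bound: write the remainder estimate at
    both end points and subtract. *)
Lemma hol_deriv_lipschitz K f f' M : hol_with K f f' M ->
  forall z w, K z -> K w -> cnorm (f' w - f' z) <= 2 * M * cnorm (w - z).
Proof.
move=> [M0 h1 h2 h3] z w Kz Kw.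
have [->|zw] := eqVneq z w; first by rewrite !subrr cnorm0 mulr0.
have d0 : 0 < cnorm (w - z) by apply: cnorm_gt0; rewrite subr_eq0 eq_sym.
rewrite -(ler_pM2r d0) -cnormM.
have -> : (f' w - f' z) * (w - z) =
  (f w - f z - f' z * (w - z)) + (f z - f w - f' w * (z - w)) by ring.
apply: (le_trans (cnormD _ _)).
have h := h3 z w Kz Kw; have := h3 w z Kw Kz.
rewrite (cnormBC z w) expr2 in h * => h'.
by lra.
Qed.

Lemma hol_cst K (c : R[i]) : hol K (fun=> c).
Proof.
exists (fun=> 0), (cnorm c); split=> //; first exact: cnorm_ge0.
  by move=> z _; rewrite cnorm0 cnorm_ge0.
by move=> z w _ _; rewrite subrr mul0r subr0 cnorm0 mulr_ge0 ?cnorm_ge0 ?sqr_ge0.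
Qed.

Lemma hol_id K B : (forall z, K z -> cnorm z <= B) -> hol K id.
Proof.
move=> KB; exists (fun=> 1), (1 + `|B|); split.
- by rewrite addr_ge0.
- by move=> z /KB zB; rewrite (le_trans zB)// (le_trans (ler_norm _))// lerDr.
- by move=> z _; rewrite cnorm1 lerDl.
- move=> z w _ _; rewrite mul1r subrr cnorm0 mulr_ge0 ?sqr_ge0// addr_ge0//.
Qed.

Lemma holD K f g : hol K f -> hol K g -> hol K (fun z => f z + g z).
Proof.
move=> [f' [M [M0 f1 f2 f3]]] [g' [N [N0 g1 g2 g3]]].
exists (fun z => f' z + g' z), (M + N); split; first exact: addr_ge0.
- by move=> z Kz; rewrite (le_trans (cnormD _ _))// lerD// ?f1// g1.
- by move=> z Kz; rewrite (le_trans (cnormD _ _))// lerD// ?f2// g2.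
move=> z w Kz Kw.
have -> : f w + g w - (f z + g z) - (f' z + g' z) * (w - z) =
  (f w - f z - f' z * (w - z)) + (g w - g z - g' z * (w - z)) by ring.
by rewrite (le_trans (cnormD _ _))// mulrDl lerD// ?f3// g3.
Qed.

Lemma holM K f g : hol K f -> hol K g -> hol K (fun z => f z * g z).
Proof.
move=> [f' [M hf]] [g' [N hg]].
have [M0 f1 f2 f3] := hf; have [N0 g1 g2 g3] := hg.
have MN0 : 0 <= M * N by rewrite mulr_ge0.
exists (fun z => f' z * g z + f z * g' z), (4 * M * N); split.
- by rewrite -mulrA mulr_ge0.
- move=> z Kz; rewrite cnormM.
  have : cnorm (f z) * cnorm (g z) <= M * N by rewrite ler_pM ?cnorm_ge0 ?f1 ?g1.
  lra.
- move=> z Kz; rewrite (le_trans (cnormD _ _))// !cnormM.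
  have : cnorm (f' z) * cnorm (g z) <= M * N by rewrite ler_pM ?cnorm_ge0 ?f2 ?g1.
  have : cnorm (f z) * cnorm (g' z) <= M * N by rewrite ler_pM ?cnorm_ge0 ?f1 ?g2.
  lra.
move=> z w Kz Kw.
have -> : f w * g w - f z * g z - (f' z * g z + f z * g' z) * (w - z) =
  (f w - f z - f' z * (w - z)) * g w + f z * (g w - g z - g' z * (w - z))
  + f' z * (w - z) * (g w - g z) by ring.
apply: (le_trans (cnormD _ _)); apply: (le_trans (lerD (cnormD _ _) (lexx _))).
rewrite !cnormM; set d := cnorm (w - z).
have d0 : 0 <= d by exact: cnorm_ge0.
have h1 : cnorm (f w - f z - f' z * (w - z)) * cnorm (g w) <= M * d ^+ 2 * N.
  by rewrite ler_pM ?cnorm_ge0 ?f3 ?g1.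
have h2 : cnorm (f z) * cnorm (g w - g z - g' z * (w - z)) <= M * (N * d ^+ 2).
  by rewrite ler_pM ?cnorm_ge0 ?f1 ?g3.
have h3 : cnorm (f' z) * d * cnorm (g w - g z) <= M * d * (2 * N * d).
  by rewrite ler_pM ?mulr_ge0 ?cnorm_ge0 ?(hol_lipschitz hg)// ler_wpM2r// f2.
rewrite expr2 in h1 h2 *; lra.
Qed.

Lemma holB K f g : hol K f -> hol K g -> hol K (fun z => f z - g z).
Proof.
move=> hf hg; apply: (@eq_hol _ (fun z => f z + (-1) * g z)).
  by move=> z _; rewrite mulN1r.
by apply: holD => //; apply: holM => //; exact: hol_cst.
Qed.

Lemma hol_comp K K' f g : hol K' f -> hol K g -> (forall z, K z -> K' (g z)) ->
  hol K (fun z => f (g z)).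
Proof.
move=> [f' [M [M0 f1 f2 f3]]] [g' [N hg]] gK.
have [N0 g1 g2 g3] := hg.
exists (fun z => f' (g z) * g' z), (M + M * N + M * (2 * N) ^+ 2).
have MN0 : 0 <= M * N by rewrite mulr_ge0.
have MN2 : 0 <= M * (2 * N) ^+ 2 by rewrite mulr_ge0 ?sqr_ge0.
split.
- by rewrite !addr_ge0.
- by move=> z Kz; have := f1 _ (gK _ Kz); lra.
- move=> z Kz; rewrite cnormM.
  have : cnorm (f' (g z)) * cnorm (g' z) <= M * N.
    by rewrite ler_pM ?cnorm_ge0 ?f2 ?g2 ?gK//; exact: gK.
  lra.
move=> z w Kz Kw.
have -> : f (g w) - f (g z) - f' (g z) * g' z * (w - z) =
  (f (g w) - f (g z) - f' (g z) * (g w - g z)) +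
  f' (g z) * (g w - g z - g' z * (w - z)) by ring.
apply: (le_trans (cnormD _ _)); rewrite cnormM; set d := cnorm (w - z).
have h1 := f3 _ _ (gK _ Kz) (gK _ Kw).
have h2 : cnorm (g w - g z) ^+ 2 <= (2 * N * d) ^+ 2.
  by rewrite lerXn2r ?nnegrE ?cnorm_ge0 ?mulr_ge0 ?cnorm_ge0// (hol_lipschitz hg).
have h3 : cnorm (f' (g z)) * cnorm (g w - g z - g' z * (w - z)) <= M * (N * d ^+ 2).
  by rewrite ler_pM ?cnorm_ge0 ?f2 ?g3//; exact: gK.
have h4 : M * cnorm (g w - g z) ^+ 2 <= M * (2 * N * d) ^+ 2 by rewrite ler_wpM2l.
have h5 : 0 <= M * d ^+ 2 by rewrite mulr_ge0 ?sqr_ge0.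
rewrite !exprMn in h4 MN2 *; lra.
Qed.

Lemma hol_inv K (r : R) : 0 < r -> (forall z, K z -> r <= cnorm z) -> hol K GRing.inv.
Proof.
move=> r0 Kr.
have Kn0 z : K z -> z != 0.
  by move=> /Kr; apply: contraTneq => ->; rewrite cnorm0 -ltNge.
have Vr z : K z -> (cnorm z)^-1 <= r^-1.
  by move=> Kz; rewrite lef_pV2 ?posrE ?Kr ?cnorm_gt0 ?Kn0.
have ri : 0 < r^-1 by rewrite invr_gt0.
pose M := r^-1 + r^-1 ^+ 2 + r^-1 ^+ 3.
have Mge k : (0 < k < 4)%N -> r^-1 ^+ k <= M.
  rewrite /M; have := exprn_ge0 2 (ltW ri); have := exprn_ge0 3 (ltW ri).
  by case: k => [|[|[|[|]]]]// => *; rewrite ?expr1; lra.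
exists (fun z => - (z^-1 ^+ 2)), M; split.
- by apply: (le_trans _ (Mge 1%N isT)); rewrite expr1; exact: ltW.
- by move=> z Kz; rewrite cnormV (le_trans (Vr _ Kz))//; exact: (Mge 1%N isT).
- move=> z Kz; rewrite cnormN cnormX cnormV; apply: (le_trans _ (Mge 2%N isT)).
  by rewrite lerXn2r ?nnegrE ?invr_ge0 ?cnorm_ge0 ?Vr//; exact: ltW.
move=> z w Kz Kw.
have zn := Kn0 _ Kz; have wn := Kn0 _ Kw.
have -> : w^-1 - z^-1 - - z^-1 ^+ 2 * (w - z) = z^-1 ^+ 2 * w^-1 * (w - z) ^+ 2.
  by field; rewrite zn wn.
rewrite cnormM (cnormX (w - z)) ler_wpM2r ?sqr_ge0//.
apply: (le_trans _ (Mge 3%N isT)).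
rewrite cnormM cnormX !cnormV [r^-1 ^+ 3]exprSr ler_pM ?exprn_ge0 ?invr_ge0 ?cnorm_ge0 ?Vr//.
by rewrite lerXn2r ?nnegrE ?invr_ge0 ?cnorm_ge0 ?Vr//; exact: ltW.
Qed.

Lemma hol_cexp K (B : R) : (forall z, K z -> complex.Re z <= B) -> hol K cexp.
Proof.
move=> KB.
have EB z : K z -> expR (complex.Re z) <= expR B by move=> /KB; rewrite ler_expR.
have e0 := expR_gt0 B.
exists cexp, (8 * expR B); split; first lra.
- by move=> z Kz; rewrite cnorm_cexp; have := EB _ Kz; lra.
- by move=> z Kz; rewrite cnorm_cexp; have := EB _ Kz; lra.
move=> z w Kz Kw.
have -> : cexp w - cexp z - cexp z * (w - z) = cexp z * (cexp (w - z) - 1 - (w - z)).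
  have {1}-> : w = z + (w - z) by ring.
  by rewrite cexpD; ring.
rewrite cnormM cnorm_cexp.
have h := cnorm_cexp_sub (w - z).
have d0 := sqr_ge0 (cnorm (w - z)).
have E0 := expR_gt0 (complex.Re z).
have : expR (complex.Re z) * cnorm (cexp (w - z) - 1 - (w - z)) <=
  expR (complex.Re z) * (4 * cnorm (w - z) ^+ 2 * (1 + expR (complex.Re (w - z)))).
  by rewrite ler_wpM2l// ltW.
move/le_trans; apply.
have -> : expR (complex.Re z) *
   (4 * cnorm (w - z) ^+ 2 * (1 + expR (complex.Re (w - z)))) =
   4 * cnorm (w - z) ^+ 2 * (expR (complex.Re z) + expR (complex.Re w)).
  have -> : complex.Re w = complex.Re z + complex.Re (w - z) by rewrite ReD ReN; ring.
  by rewrite expRD; ring.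
rewrite [8 * _ * _]mulrC -[8]/(4 * 2)%:R natrM.
have := EB _ Kz; have := EB _ Kw; nra.
Qed.

End holomorphic.

(** * Cauchy's formula and Taylor expansions *)

Section circle_integral.
Context {R : realType}.
Implicit Types (u v : R -> R[i]).
Local Notation mu := (@lebesgue_measure R).

(** Bounded Lipschitz functions of a real parameter: stable under products, inverses
    and composition with holomorphic functions, and integrable on the circle. *)
Definition blip u := exists2 M : R, 0 <= M &
  (forall t, cnorm (u t) <= M) /\ forall s t, cnorm (u s - u t) <= M * `|s - t|.

Lemma blip_cst (c : R[i]) : blip (fun=> c).
Proof.
exists (cnorm c); first exact: cnorm_ge0.
by split => // s t; rewrite subrr cnorm0 mulr_ge0 ?cnorm_ge0.
Qed.

Lemma blipM u v : blip u -> blip v -> blip (fun t => u t * v t).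
Proof.
move=> [M M0 [u1 u2]] [N N0 [v1 v2]]; have MN0 : 0 <= M * N by rewrite mulr_ge0.
exists (2 * M * N); first by rewrite -mulrA mulr_ge0.
split=> [t|s t].
  rewrite cnormM; have : cnorm (u t) * cnorm (v t) <= M * N.
    by rewrite ler_pM ?cnorm_ge0.
  lra.
have -> : u s * v s - u t * v t = (u s - u t) * v s + u t * (v s - v t) by ring.
rewrite (le_trans (cnormD _ _))// !cnormM.
have : cnorm (u s - u t) * cnorm (v s) <= M * `|s - t| * N.
  by rewrite ler_pM ?cnorm_ge0.
have : cnorm (u t) * cnorm (v s - v t) <= M * (N * `|s - t|).
  by rewrite ler_pM ?cnorm_ge0.
lra.
Qed.

Lemma blipD u v : blip u -> blip v -> blip (fun t => u t + v t).
Proof.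
move=> [M M0 [u1 u2]] [N N0 [v1 v2]].
exists (M + N); first by rewrite addr_ge0.
split=> [t|s t]; first by rewrite (le_trans (cnormD _ _))// lerD.
have -> : u s + v s - (u t + v t) = (u s - u t) + (v s - v t) by ring.
by rewrite (le_trans (cnormD _ _))// mulrDl lerD.
Qed.

Lemma blip_comp (K : set R[i]) (f : R[i] -> R[i]) (M : R) u :
  0 <= M -> (forall z, K z -> cnorm (f z) <= M) ->
  (forall z w, K z -> K w -> cnorm (f w - f z) <= 2 * M * cnorm (w - z)) ->
  blip u -> (forall t, K (u t)) -> blip (fun t => f (u t)).
Proof.
move=> M0 f1 f2 [N N0 [u1 u2]] uK.
have MN0 : 0 <= 2 * M * N by rewrite !mulr_ge0.
exists (M + 2 * M * N); first by rewrite addr_ge0.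
split=> [t|s t]; first by rewrite (le_trans (f1 _ (uK _)))// lerDl.
rewrite (le_trans (f2 _ _ (uK _) (uK _)))//.
have : 2 * M * cnorm (u s - u t) <= 2 * M * (N * `|s - t|).
  by rewrite ler_wpM2l// mulr_ge0.
have : 0 <= M * `|s - t| by rewrite mulr_ge0.
lra.
Qed.

Lemma blip_hol (K : set R[i]) f u : hol K f -> blip u -> (forall t, K (u t)) ->
  blip (fun t => f (u t)).
Proof.
move=> [f' [M hf]]; have [M0 f1 _ _] := hf; apply: (blip_comp M0 f1).
exact: hol_lipschitz hf.
Qed.

Lemma blip_inv (r : R) u : 0 < r -> (forall t, r <= cnorm (u t)) -> blip u ->
  blip (fun t => (u t)^-1).
Proof.
by move=> r0 ur bu; apply: (blip_hol (hol_inv r0 (fun z h => h)) bu).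
Qed.

Lemma cnorm_expi_sub1 (t : R) : cnorm (expi t - 1) <= 3 * `|t|.
Proof.
have [t1|t1] := leP `|t| 1.
  have -> : expi t - 1 = (expi t - 1 - 'i%C * t%:C) + 'i%C * t%:C by ring.
  rewrite (le_trans (cnormD _ _))// cnormM cnormR cnormi.
  have := cnorm_expi_sub t; rewrite -real_normK ?num_real//.
  have := normr_ge0 t; nra.
by rewrite (le_trans (cnormB _ _))// cnorm_expi cnorm1; lra.
Qed.

Lemma blip_expi : blip (@expi R).
Proof.
exists 3 => //; split=> [t|s t]; first by rewrite cnorm_expi; lra.
have -> : expi s - expi t = expi t * (expi (s - t) - 1).
  by rewrite mulrBr mulr1 -expiD; congr (expi _ - _); ring.
by rewrite cnormM cnorm_expi mul1r cnorm_expi_sub1.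
Qed.

Lemma lipschitz_continuous (f : R -> R) (M : R) : 0 <= M ->
  (forall s t, `|f s - f t| <= M * `|s - t|) -> continuous f.
Proof.
move=> M0 fM x; apply/cvgrPdist_le => e e0.
have M1 : 0 < M + 1 by lra.
near=> y; rewrite (le_trans (fM _ _))//.
have : `|x - y| <= e / (M + 1).
  near: y; apply: (@cvgr_dist_le R R R (nbhs x) _ id x); first exact: cvg_id.
  exact: divr_gt0.
rewrite ler_pdivlMr//; have := normr_ge0 (x - y); nra.
Unshelve. all: by end_near. Qed.

Lemma blip_continuous u : blip u ->
  continuous (fun t => complex.Re (u t)) /\ continuous (fun t => complex.Im (u t)).
Proof.
move=> [M M0 [u1 u2]]; split; apply: (lipschitz_continuous M0) => s t.
  by rewrite -ReN -ReD (le_trans (Re_le_cnorm _)).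
by rewrite -ImN -ImD (le_trans (Im_le_cnorm _)).
Qed.

Local Notation circ := (`[0, 2 * pi]%classic : set R).

Lemma blip_Cintegrable u : blip u -> Cintegrable mu circ u.
Proof.
move=> /blip_continuous[c1 c2]; split; apply: continuous_compact_integrable;
  by [exact: segment_compact|exact: continuous_subspaceT].
Qed.

Lemma derive_of_quadratic_remainder (F : R -> R) (t l M : R) :
  (forall h, `|F (t + h) - F t - l * h| <= M * h ^+ 2) -> is_derive t 1 F l.
Proof.
move=> FM.
have H : (fun h => h^-1 *: ((F \o shift t) (h *: 1) - F t)) @ 0^' --> l.
  apply/cvgrPdist_le => e e0; near=> h.
  have h0 : h != 0 by near: h; exact: nbhs_dnbhs_neq.
  have hs : `|h| <= e / (`|M| + 1).
    by near: h; apply: dnbhs0_le; rewrite divr_gt0// ltr_wpDl.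
  rewrite /= /GRing.scale /= mulr1.
  have -> : l - h^-1 * (F (h + t) - F t) = - (h^-1 * (F (t + h) - F t - l * h)).
    by rewrite (addrC h); field.
  rewrite normrN normrM normfV ler_pdivrMl ?normr_gt0//.
  rewrite (le_trans (FM h))// (le_trans (ler_wpM2r (sqr_ge0 h) (ler_norm M)))//.
  rewrite -real_normK ?num_real// expr2 mulrCA ler_wpM2l//.
  move: hs; rewrite ler_pdivlMr ?ltr_wpDl//; have := normr_ge0 h; lra.
by apply: DeriveDef; [apply/cvg_ex; exists l|exact: cvg_lim H].
Unshelve. all: by end_near. Qed.

Lemma Rintegral_FTC (F f : R -> R) (a b M : R) : a < b -> continuous f ->
  (forall t h, `|F (t + h) - F t - f t * h| <= M * h ^+ 2) ->
  \int[mu]_(t in `[a, b]) f t = F b - F a.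
Proof.
move=> ab cf FM.
have dF (t : R) : is_derive t 1 F (f t) by apply: derive_of_quadratic_remainder (FM t).
have cF : continuous F.
  move=> t; apply: differentiable_continuous; apply/derivable1_diffP.
  by case: (dF t).
rewrite /Rintegral (@continuous_FTC2 _ f F)//.
- exact: continuous_subspaceT.
- split => [t _| |].
  + by case: (dF t).
  + by apply: cvg_at_right_filter; exact: cF.
  + by apply: cvg_at_left_filter; exact: cF.
- by move=> t _; rewrite derive1E; exact: derive_val.
Qed.

Lemma twopi_gt0 : 0 < 2 * pi :> R. Proof. by rewrite mulr_gt0 ?pi_gt0. Qed.

Lemma expi2pi : expi (2 * pi : R) = 1.
Proof.
have -> : (2 * pi : R) = pi *+ 2 by rewrite mulr_natl.
by rewrite /expi cos2pi sin2pi.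
Qed.

(** The fundamental theorem of calculus for a function of period 2 pi. *)
Lemma Cint_derivative u u' (M : R) : blip u' -> u 0 = u (2 * pi) ->
  (forall t h, cnorm (u (t + h) - u t - u' t * h%:C) <= M * h ^+ 2) ->
  Cint mu circ u' = 0.
Proof.
move=> /blip_continuous[c1 c2] u0 uM; apply: complex_eq => /=.
  rewrite (Rintegral_FTC (F := fun t => complex.Re (u t)) (M := M)) ?twopi_gt0//.
    by rewrite u0 subrr.
  move=> t h; apply: le_trans (uM t h); apply: le_trans (Re_le_cnorm _).
  by rewrite !ReImE /= mulr0 subr0.
rewrite (Rintegral_FTC (F := fun t => complex.Im (u t)) (M := M)) ?twopi_gt0//.
  by rewrite u0 subrr.
move=> t h; apply: le_trans (uM t h); apply: le_trans (Im_le_cnorm _).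
by rewrite !ReImE /= mulr0 add0r.
Qed.

Lemma le_cnorm_circ u (M : R) : blip u ->
  (forall t, cnorm (u t) <= M) -> cnorm (Cint mu circ u) <= 4 * pi * M.
Proof.
move=> bu uM.
have mc : measurable (circ : set (measurableTypeR R)) by exact: measurable_itv.
have iM : mu.-integrable circ (EFin \o (fun=> M)).
  apply: continuous_compact_integrable; first exact: segment_compact.
  by apply: continuous_subspaceT => x; exact: cvg_cst.
have := le_cnorm_Cint mc (blip_Cintegrable bu) iM (fun t _ => uM t).
move/le_trans; apply; rewrite Rintegral_cst//= lebesgue_measure_itv /= lte_fin twopi_gt0 /=.
by rewrite subr0; lra.
Qed.

Lemma Cint_cst (c : R[i]) : Cint mu circ (fun=> c) = c * (2 * pi)%:C.
Proof.
have mc : measurable (circ : set (measurableTypeR R)) by exact: measurable_itv.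
rewrite /Cint !Rintegral_cst//= lebesgue_measure_itv /= lte_fin twopi_gt0 /=.
by case: c => a b; rewrite subr0; simpc.
Qed.

End circle_integral.

Section archimedean_limits.
Context {R : realType}.

Lemma le0_of_natmul_le (x C : R) : (forall n : nat, x * n%:R <= C) -> x <= 0.
Proof.
move=> h; rewrite leNgt; apply/negP => x0.
have c0 : 0 <= (`|C| + 1) / x by rewrite divr_ge0 ?addr_ge0// ltW.
have := archi_boundP c0; rewrite ltr_pdivrMr// mulrC => /lt_le_trans/(_ (h _)).
by have := ler_norm C; lra.
Qed.

Lemma natr_le_expr2 (n : nat) : n%:R <= 2 ^+ n :> R.
Proof. by rewrite -natrX ler_nat ltnW// ltn_expl. Qed.

Lemma le0_of_geometric_le (x C q : R) : 0 <= C -> 0 <= q <= 1 / 2 ->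
  (forall n : nat, x <= C * q ^+ n) -> x <= 0.
Proof.
move=> C0 /andP[q0 q1] h; apply: (@le0_of_natmul_le _ C) => n.
have [x0|x0] := leP x 0; first by rewrite (le_trans _ C0)// mulr_le0_ge0.
have e : (1 / 2) ^+ n * 2 ^+ n = 1 :> R by rewrite -exprMn div1r mulVf ?expr1n.
rewrite -[leRHS]mulr1 -[X in C * X]e mulrA ler_pM ?(ltW x0)// ?natr_le_expr2//.
by rewrite (le_trans (h n))// ler_wpM2l// lerXn2r ?nnegrE.
Qed.

(** Cut [0, 1] into n steps: the n increments of order n^-2 add up to O(1/n). *)
Lemma quadratic_increments_cst (J : R -> R[i]) (C : R) :
  (forall s t, 0 <= s <= 1 -> 0 < t <= 1 -> cnorm (J s - J t) <= C * (s - t) ^+ 2) ->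
  J 1 = J 0.
Proof.
move=> JC; suff : cnorm (J 1 - J 0) <= 0.
  move=> h; apply/eqP; rewrite -subr_eq0; apply/eqP/cnorm_eq0/le_anti.
  by rewrite h cnorm_ge0.
apply: (@le0_of_natmul_le _ `|C|) => -[|n]; first by rewrite mulr0.
have N0 : 0 < n.+1%:R :> R by rewrite ltr0n.
have H (k : nat) : (k <= n.+1)%N ->
    cnorm (J (k%:R / n.+1%:R) - J 0) <= k%:R * (C / n.+1%:R ^+ 2).
  elim: k => [_|k IH kn]; first by rewrite !mul0r subrr cnorm0.
  have -> : J (k.+1%:R / n.+1%:R) - J 0 = (J (k.+1%:R / n.+1%:R) - J (k%:R / n.+1%:R))
     + (J (k%:R / n.+1%:R) - J 0) by ring.
  have -> : k.+1%:R * (C / n.+1%:R ^+ 2) =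
      C / n.+1%:R ^+ 2 + k%:R * (C / n.+1%:R ^+ 2) by rewrite -natr1; ring.
  rewrite (le_trans (cnormD _ _))// lerD//.
    rewrite cnormBC (le_trans (JC _ _ _ _))//.
    - rewrite divr_ge0 ?ler0n//= ler_pdivrMr// mul1r ler_nat; exact: ltnW.
    - by rewrite divr_gt0 ?ltr0n//= ler_pdivrMr// mul1r ler_nat.
    have -> : k%:R / n.+1%:R - k.+1%:R / n.+1%:R = - n.+1%:R^-1 :> R.
      by rewrite -(natr1 k) mulrDl mul1r opprD addrA subrr add0r.
    by rewrite sqrrN exprVn.
  by apply: IH; exact: ltnW.
have := H n.+1 (leqnn _); rewrite divff ?gt_eqF// => h.
rewrite -ler_pdivlMr// (le_trans h)//.
have -> : n.+1%:R * (C / n.+1%:R ^+ 2) = C / n.+1%:R.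
  by field; rewrite addrC natr1 gt_eqF.
by rewrite ler_pM2r ?invr_gt0// ler_norm.
Qed.

End archimedean_limits.

(** Locked, so that norm computations treat it as a single point. *)
Definition circle_point {R : realType} (r t : R) : R[i] := locked (r%:C * expi t).

Lemma circle_pointE {R : realType} (r t : R) : circle_point r t = r%:C * expi t.
Proof. by rewrite /circle_point -lock. Qed.

Lemma cnorm_circle_point {R : realType} (r t : R) : 0 < r ->
  cnorm (circle_point r t) = r.
Proof.
by move=> r0; rewrite circle_pointE cnormM cnorm_expi mulr1 cnormR gtr0_norm.
Qed.

Lemma blip_circle_point {R : realType} (r : R) : blip (circle_point r).
Proof.
have -> : circle_point r = (fun t => r%:C * expi t).
  by apply/funext => t; rewrite circle_pointE.
by apply: blipM; [exact: blip_cst|exact: blip_expi].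
Qed.

Section cauchy.
Context {R : realType}.
Variable r : R.
Hypothesis r0 : 0 < r.
Implicit Types (z w : R[i]) (f : R[i] -> R[i]) (v : R -> R[i]).
Local Notation circ := (`[0, 2 * pi]%classic : set R).
Local Notation oint := (Cint (@lebesgue_measure R) circ).
Local Notation zeta := (circle_point r).

Let blip_zeta : blip zeta.
Proof. exact: blip_circle_point. Qed.

Let cnorm_zeta t : cnorm (zeta t) = r.
Proof. exact: cnorm_circle_point. Qed.

Let zeta_sub_ge w t : r - cnorm w <= cnorm (zeta t - w).
Proof.
by rewrite lerBlDr -[leLHS](cnorm_zeta t); have := cnormD (zeta t - w) w; rewrite subrK.
Qed.

Let zeta_neq w t : cnorm w < r -> zeta t - w != 0.
Proof.
move=> wr; apply/eqP => /(congr1 cnorm); rewrite cnorm0 => e.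
by have := zeta_sub_ge w t; rewrite e; lra.
Qed.

Let blip_zetaV n : blip (fun t => (zeta t)^-1 ^+ n).
Proof.
elim: n => [|n IH]; first exact: (blip_cst 1).
under eq_fun do rewrite exprS; apply: blipM => //.
by apply: (blip_inv r0) => // t; rewrite cnorm_zeta.
Qed.

(** The Cauchy kernel dzeta / (zeta - w), written as a density with respect to dt
    after division by i. *)
Let ker w t := zeta t / (zeta t - w).

Let blip_ker w : cnorm w < r -> blip (ker w).
Proof.
move=> wr; apply: blipM => //; apply: (@blip_inv _ (r - cnorm w)).
- by rewrite subr_gt0.
- by move=> t; exact: zeta_sub_ge.
- by apply: blipD => //; exact: blip_cst.
Qed.

Let cnorm_ker w t : cnorm w <= r / 2 -> cnorm (ker w t) <= 2.
Proof.
move=> wr; rewrite /ker cnormM cnormV cnorm_zeta.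
have h := zeta_sub_ge w t.
have d0 : 0 < cnorm (zeta t - w) by have rp := r0; lra.
by rewrite ler_pdivrMr//; lra.
Qed.

(** Cauchy's theorem for the contraction of the circle to the point w: between
    two times the integrals differ to second order only, since the first order
    term is the integral of the derivative of a periodic function. *)
Lemma cauchy_contraction f f' M w :
  hol_with (fun z => cnorm z <= r) f f' M -> cnorm w < r ->
  oint (fun t => f (zeta t) * ker w t) = oint (fun t => f w * ker w t).
Proof.
move=> hf wr; have [M0 f1 f2 f3] := hf; have rp := r0.
have mc : measurable (circ : set (measurableTypeR R)) by exact: measurable_itv.
have f'L := hol_deriv_lipschitz hf.
pose K := [set z : R[i] | cnorm z <= r].
have holf : hol K f by exists f', M.
pose ga (s : R) t := w + s%:C * (zeta t - w).
have gaK s t : 0 <= s <= 1 -> cnorm (ga s t) <= r.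
  move=> /andP[s0 s1].
  have -> : ga s t = (1 - s)%:C * w + s%:C * zeta t by rewrite /ga rmorphB /=; ring.
  rewrite (le_trans (cnormD _ _))// !cnormM cnorm_zeta !cnormR.
  rewrite (ger0_norm s0) ger0_norm ?subr_ge0//.
  have : (1 - s) * cnorm w <= (1 - s) * r by rewrite ler_wpM2l ?subr_ge0// ltW.
  lra.
have bga s : blip (ga s).
  apply: blipD; first exact: blip_cst.
  apply: blipM; first exact: blip_cst.
  by apply: blipD => //; exact: blip_cst.
have bzw : blip (fun t => zeta t - w) by apply: blipD => //; exact: blip_cst.
have bf s : 0 <= s <= 1 -> blip (fun t => f (ga s t) * ker w t).
  move=> s01; apply: blipM; last exact: blip_ker.
  by apply: (blip_hol holf (bga s)) => t; exact: gaK.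
have bf' s : 0 <= s <= 1 -> blip (fun t => f' (ga s t)).
  by move=> s01; apply: (blip_comp M0 f2 f'L (bga s)) => t; exact: gaK.
(* up to the factor 'i s, the integrand is the derivative of f (ga s t) in t *)
have der0 s : 0 < s <= 1 -> oint (fun t => f' (ga s t) * zeta t) = 0.
  move=> /andP[s0 s1]; have s01 : 0 <= s <= 1 by rewrite ltW.
  have si0 : 'i%C * s%:C != 0 :> R[i].
    by rewrite mulf_neq0// ?complexiE ?neq0Ci// eq_complex /= negb_and gt_eqF.
  apply: (mulfI si0); rewrite mulr0 -(CintZ mc); last first.
    by apply: blip_Cintegrable; apply: blipM => //; exact: bf'.
  apply: (@Cint_derivative _ (fun t => f (ga s t)) _ (9 * M * r ^+ 2 + 2 * M * r)).
  - by apply: blipM; [exact: blip_cst|apply: blipM => //; exact: bf'].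
  - by rewrite /ga !circle_pointE expi2pi expi0.
  move=> t h.
  have e1 : ga s (t + h) - ga s t = s%:C * (zeta t * (expi h - 1)).
    by rewrite /ga !circle_pointE expiD; ring.
  have -> : f (ga s (t + h)) - f (ga s t) -
      'i%C * s%:C * (f' (ga s t) * zeta t) * h%:C =
    (f (ga s (t + h)) - f (ga s t) - f' (ga s t) * (ga s (t + h) - ga s t)) +
    f' (ga s t) * (s%:C * (zeta t * (expi h - 1 - 'i%C * h%:C))).
    by rewrite e1; ring.
  rewrite (le_trans (cnormD _ _))// mulrDl lerD//.
    rewrite (le_trans (f3 _ _ (gaK _ _ s01) (gaK _ _ s01)))// e1.
    rewrite !cnormM cnorm_zeta cnormR (gtr0_norm s0).
    have q0 : 0 <= s * (r * cnorm (expi h - 1)).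
      by rewrite mulr_ge0 ?(ltW s0)// mulr_ge0 ?cnorm_ge0 ?ltW.
    have q : s * (r * cnorm (expi h - 1)) <= r * (3 * `|h|).
      have := cnorm_expi_sub1 h; have := cnorm_ge0 (expi h - 1).
      set x := cnorm _ => x0 xh.
      have : r * x <= r * (3 * `|h|) by rewrite ler_pM2l.
      have : s * (r * x) <= r * x by rewrite ler_piMl// mulr_ge0// ltW.
      lra.
    have := lerXn2r 2%N q0 (le_trans q0 q) q.
    rewrite !exprMn real_normK ?num_real// => q2.
    have : M * (s ^+ 2 * (r ^+ 2 * cnorm (expi h - 1) ^+ 2)) <=
           M * (r ^+ 2 * (3 ^+ 2 * h ^+ 2)) by rewrite ler_wpM2l.
    lra.
  rewrite !cnormM cnorm_zeta cnormR (gtr0_norm s0).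
  have h1 := cnorm_expi_sub h.
  have h2 := f2 _ (gaK s t s01).
  have h0 : 0 <= cnorm (expi h - 1 - 'i%C * h%:C) by exact: cnorm_ge0.
  have q1 : s * (r * cnorm (expi h - 1 - 'i%C * h%:C)) <= r * (2 * h ^+ 2).
    rewrite (le_trans (y := r * cnorm (expi h - 1 - 'i%C * h%:C)))//.
      by rewrite ler_piMl// mulr_ge0// ltW.
    by rewrite ler_pM2l.
  have : cnorm (f' (ga s t)) * (s * (r * cnorm (expi h - 1 - 'i%C * h%:C))) <=
    M * (r * (2 * h ^+ 2)).
    by rewrite ler_pM ?cnorm_ge0// mulr_ge0 ?(ltW s0)// mulr_ge0// ltW.
  lra.
pose J s := oint (fun t => f (ga s t) * ker w t).
have J1 : oint (fun t => f (zeta t) * ker w t) = J 1.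
  by congr Cint; apply/funext => t; rewrite /ga mul1r addrC subrK.
have J0 : oint (fun t => f w * ker w t) = J 0.
  by congr Cint; apply/funext => t; rewrite /ga mul0r addr0.
rewrite J1 J0.
apply: (@quadratic_increments_cst _ _ (4 * pi * (2 * M * r ^+ 2))) => s t s01 t01.
have t01' : 0 <= t <= 1 by case/andP: t01 => ? ->; rewrite ltW.
have -> : J s - J t =
  oint (fun x => (f (ga s x) - f (ga t x) - f' (ga t x) * (ga s x - ga t x)) * ker w x).
  have i1 := blip_Cintegrable (bf s s01); have i2 := blip_Cintegrable (bf t t01').
  have i3 : Cintegrable (@lebesgue_measure R) circ (fun x => f' (ga t x) * zeta x).
    by apply: blip_Cintegrable; apply: blipM => //; exact: bf'.
  have := der0 t t01 => /(congr1 (fun z => (s - t)%:C * z)).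
  rewrite mulr0 -CintZ// => e.
  rewrite /J -CintB// -[LHS]subr0 -e -CintB//; last 2 first.
  - exact: CintegrableB.
  - exact: CintegrableZ.
  congr Cint; apply/funext => x; rewrite /ker /ga rmorphB /=; field.
  exact: zeta_neq.
rewrite -[leRHS]mulrA; apply: le_cnorm_circ.
  have -> : (fun x => (f (ga s x) - f (ga t x) - f' (ga t x) * (ga s x - ga t x)) *
      ker w x) = (fun x => (f (ga s x) * ker w x + (-1) * (f (ga t x) * ker w x)) +
     (-1) * (f' (ga t x) * (ga s x + (-1) * ga t x) * ker w x)).
    by apply/funext => x; ring.
  do ?[exact: blip_ker | exact: bf | exact: bf' | exact: bga | exact: blip_cst |
       apply: blipD | apply: blipM].
move=> x; rewrite cnormM.
have h := f3 _ _ (gaK _ x t01') (gaK _ x s01).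
have e : ga s x - ga t x = (s - t)%:C * (zeta x - w).
  by rewrite /ga rmorphB /=; ring.
rewrite /ker cnormM cnormV cnorm_zeta.
move: h; rewrite {2}e cnormM cnormR exprMn real_normK ?num_real// => h.
have d0 : 0 < cnorm (zeta x - w) by apply: cnorm_gt0; exact: zeta_neq.
rewrite mulrA ler_pdivrMr//.
have d2 : cnorm (zeta x - w) <= 2 * r.
  by rewrite (le_trans (cnormB _ _))// cnorm_zeta; lra.
have := ler_wpM2r (ltW r0) h; move/le_trans; apply.
have : 0 <= M * (s - t) ^+ 2 * r * cnorm (zeta x - w) * (2 * r - cnorm (zeta x - w)).
  apply: mulr_ge0; last by rewrite subr_ge0.
  exact: (mulr_ge0 (mulr_ge0 (mulr_ge0 M0 (sqr_ge0 _)) (ltW r0)) (ltW d0)).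
lra.
Qed.

(** Since ker w = 1 + (w / zeta) ker w, each step produces one more term and
    multiplies the remainder by w / zeta. *)
Lemma geometric_kernel v S w (n : nat) :
  blip v -> (forall t, cnorm (v t) <= S) -> cnorm w <= r / 2 ->
  cnorm (oint (fun t => v t * ker w t) -
         \sum_(j < n) w ^+ j * oint (fun t => v t * (zeta t)^-1 ^+ j)) <=
  8 * pi * S * (cnorm w / r) ^+ n.
Proof.
move=> bv vS wr.
have rp := r0.
have wr' : cnorm w < r by have := cnorm_ge0 w; lra.
have S0 : 0 <= S by apply: le_trans (vS 0); exact: cnorm_ge0.
have mc : measurable (circ : set (measurableTypeR R)) by exact: measurable_itv.
have bk k : blip (fun t => v t * ker w t * (zeta t)^-1 ^+ k).
  by apply: blipM => //; apply: blipM => //; exact: blip_ker.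
have e k : oint (fun t => v t * ker w t) -
    \sum_(j < k) w ^+ j * oint (fun t => v t * (zeta t)^-1 ^+ j) =
    oint (fun t => w ^+ k * (v t * ker w t * (zeta t)^-1 ^+ k)).
  elim: k => [|k IH].
    rewrite big_ord0 subr0; congr Cint; apply/funext => t.
    by rewrite !expr0 mul1r mulr1.
  rewrite big_ord_recr /= opprD addrA IH -CintZ//; last first.
    by apply: blip_Cintegrable; apply: blipM.
  rewrite -CintB//; last 2 first.
  - by apply: CintegrableZ => //; apply: blip_Cintegrable.
  - by apply: CintegrableZ => //; apply: blip_Cintegrable; apply: blipM.
  congr Cint; apply/funext => t; rewrite /ker !exprS.
  have z0 : zeta t != 0 by have := @zeta_neq 0 t; rewrite subr0 cnorm0; exact.
  move: (zeta_neq t wr') z0; move: (zeta t) => z zw z0.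
  by field; rewrite z0 zw.
rewrite e -[leRHS]mulrA.
have -> : 8 * pi * (S * (cnorm w / r) ^+ n) =
  4 * pi * (2 * S * (cnorm w / r) ^+ n) by ring.
apply: le_cnorm_circ; first by apply: blipM; [exact: blip_cst|exact: bk].
move=> t; rewrite cnormM cnormX (cnormM _ (_ ^+ n)) cnormX cnormV cnorm_zeta.
rewrite (cnormM (v t)) exprMn.
have h1 := vS t; have h2 := cnorm_ker t wr.
have h3 : cnorm (v t) * cnorm (ker w t) <= S * 2 by rewrite ler_pM ?cnorm_ge0.
have p : 0 <= cnorm w ^+ n * r^-1 ^+ n.
  by rewrite mulr_ge0// exprn_ge0 ?cnorm_ge0 ?invr_ge0 ?(ltW r0).
have := ler_wpM2l p h3; lra.
Qed.

(** The integrand is, up to a constant factor, the derivative of itself, a periodic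
    function. *)
Lemma oint_zetaV n : oint (fun t => (zeta t)^-1 ^+ n.+1) = 0.
Proof.
have mc : measurable (circ : set (measurableTypeR R)) by exact: measurable_itv.
pose m : R := n.+1%:R.
have m0 : 0 < m by rewrite ltr0n.
have ezV k t : (zeta t)^-1 ^+ k = (r^-1 ^+ k)%:C * expi (- (k%:R * t)).
  elim: k => [|k IH]; first by rewrite !expr0 mul0r oppr0 expi0 mulr1.
  rewrite exprS IH exprS -natr1 mulrDl mul1r opprD expiD (expiN t) circle_pointE invfM.
  by rewrite rmorphM fmorphV /=; ring.
have mi0 : - 'i%C * m%:C != 0 :> R[i].
  by rewrite mulf_neq0// ?oppr_eq0 ?complexiE ?neq0Ci// eq_complex /= negb_and gt_eqF.
apply: (mulfI mi0); rewrite mulr0 -CintZ//; last first.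
  by apply: blip_Cintegrable; exact: blip_zetaV.
apply: (@Cint_derivative _ (fun t => (zeta t)^-1 ^+ n.+1) _
   (r^-1 ^+ n.+1 * 2 * m ^+ 2)).
- by apply: blipM; [exact: blip_cst|exact: blip_zetaV].
- by rewrite !circle_pointE expi2pi expi0.
move=> t h; rewrite !ezV -/m.
have -> : (r^-1 ^+ n.+1)%:C * expi (- (m * (t + h))) - (r^-1 ^+ n.+1)%:C *
   expi (- (m * t)) - - 'i%C * m%:C * ((r^-1 ^+ n.+1)%:C * expi (- (m * t))) * h%:C
 = (r^-1 ^+ n.+1)%:C * (expi (- (m * t)) *
   (expi (- (m * h)) - 1 - 'i%C * (- (m * h))%:C)).
  by rewrite mulrDr opprD expiD rmorphN rmorphM /=; ring.
rewrite !cnormM cnorm_expi mul1r cnormR ger0_norm ?exprn_ge0 ?invr_ge0 ?(ltW r0)//.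
rewrite -!mulrA ler_wpM2l ?exprn_ge0 ?invr_ge0 ?(ltW r0)//.
have := cnorm_expi_sub (- (m * h)); rewrite sqrrN exprMn (expr2 m); lra.
Qed.

(** In the geometric expansion all terms but the first integrate to 0, and the
    remainder tends to 0. *)
Lemma oint_ker w : cnorm w <= r / 2 -> oint (ker w) = (2 * pi)%:C.
Proof.
move=> wr; have rp := r0.
have q2 : cnorm w / r <= 1 / 2 by rewrite ler_pdivrMr//; lra.
have q1 : cnorm w / r <= 1 by lra.
have n1 (t : R) : cnorm (1 : R[i]) <= 1 by rewrite cnorm1.
have H n := @geometric_kernel (fun=> 1) 1 w n (blip_cst 1) n1 wr.
apply/eqP; rewrite -subr_eq0; apply/eqP/cnorm_eq0/le_anti; rewrite cnorm_ge0 andbT.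
apply: (@le0_of_geometric_le _ _ (8 * pi) (cnorm w / r)).
- by rewrite mulr_ge0 ?pi_ge0.
- by rewrite divr_ge0 ?cnorm_ge0 ?(ltW r0).
move=> n; have := H n.+1; rewrite mulr1 big_ord_recl big1 ?addr0; last first.
  move=> i _; have -> : (fun t => 1 * (zeta t)^-1 ^+ lift ord0 i) =
    (fun t => (zeta t)^-1 ^+ i.+1) by apply/funext => t; rewrite mul1r.
  by rewrite oint_zetaV mulr0.
have -> : (fun t => 1 * ker w t) = ker w by apply/funext => t; rewrite mul1r.
have -> : (fun t => 1 * (zeta t)^-1 ^+ (@ord0 n)) = (fun=> 1) :> (R -> R[i]).
  by apply/funext => t; rewrite mul1r expr0.
rewrite Cint_cst expr0 !mul1r => /le_trans; apply.
rewrite exprS ler_wpM2l ?mulr_ge0 ?pi_ge0//.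
by rewrite ler_piMl ?exprn_ge0 ?divr_ge0 ?cnorm_ge0 ?(ltW r0).
Qed.

(** By the contraction of the circle, the integral of f against the Cauchy kernel is
    f w; expand the kernel. *)
Lemma hol_taylor0 f S : hol (fun z => cnorm z <= r) f ->
  (forall z, cnorm z <= r -> cnorm (f z) <= S) ->
  exists a : nat -> R[i], forall n w, cnorm w <= r / 2 ->
    cnorm (f w - \sum_(j < n) a j * w ^+ j) <= 4 * S * (cnorm w / r) ^+ n.
Proof.
move=> holf fS; have [f' [M hf]] := holf; have rp := r0.
have p0 : 0 < 2 * pi :> R by exact: twopi_gt0.
exists (fun j => ((2 * pi)^-1)%:C * oint (fun t => f (zeta t) * (zeta t)^-1 ^+ j)).
move=> n w wr.
have wr' : cnorm w < r by have := cnorm_ge0 w; lra.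
have bfz : blip (fun t => f (zeta t)).
  by apply: (blip_hol holf blip_zeta) => t; rewrite cnorm_zeta.
have fzS t : cnorm (f (zeta t)) <= S by rewrite fS// cnorm_zeta.
have := geometric_kernel n bfz fzS wr.
rewrite (cauchy_contraction hf wr').
have mc : measurable (circ : set (measurableTypeR R)) by exact: measurable_itv.
rewrite CintZ//; last by apply: blip_Cintegrable; exact: blip_ker.
rewrite oint_ker// => H.
have -> : f w - \sum_(j < n) ((2 * pi)^-1)%:C *
     oint (fun t => f (zeta t) * (zeta t)^-1 ^+ j) * w ^+ j =
   ((2 * pi)^-1)%:C * (f w * (2 * pi)%:C -
   \sum_(j < n) w ^+ j * oint (fun t => f (zeta t) * (zeta t)^-1 ^+ j)).
  rewrite mulrBr mulr_sumr; congr (_ - _).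
    by rewrite mulrCA -rmorphM mulVf ?gt_eqF// mulr1.
  by apply: eq_bigr => j _; rewrite -mulrA; congr (_ * _); rewrite mulrC.
rewrite cnormM cnormR gtr0_norm ?invr_gt0// ler_pdivrMl//.
by rewrite (le_trans H)// le_eqVlt; apply/orP; left; apply/eqP; ring.
Qed.

End cauchy.

(** Cauchy's estimates in the form of a Taylor expansion whose remainder is
    controlled by the maximum S of f alone. *)
Theorem hol_taylor {R : realType} (f : R[i] -> R[i]) (c : R[i]) (r S : R) : 0 < r ->
  hol (fun z => cnorm (z - c) <= r) f ->
  (forall z, cnorm (z - c) <= r -> cnorm (f z) <= S) ->
  exists a : nat -> R[i], forall n w, cnorm w <= r / 2 ->
    cnorm (f (c + w) - \sum_(j < n) a j * w ^+ j) <= 4 * S * (cnorm w / r) ^+ n.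
Proof.
move=> r0 hf fS; apply: (@hol_taylor0 R r r0 (fun z => f (c + z)) S).
  apply: (hol_comp hf) => [|z zr].
    by apply: holD; [exact: hol_cst|exact: (@hol_id _ _ r)].
  by rewrite addrC addKr.
by move=> z zr; apply: fS; rewrite addrC addKr.
Qed.

(** * Uniqueness theorems *)

Section uniqueness.
Context {R : realType}.

(** A finite expansion is determined by its values near 0 on a single ray, because
    its first nonzero term dominates there; below, holomorphic functions are compared
    on segments parallel to the real or to the imaginary axis. *)
Lemma expansion_coef0 (a : nat -> R[i]) (u : R[i]) (n : nat) (C e : R) : 0 < e -> u != 0 ->
  (forall x : R, 0 < x <= e ->
    cnorm (\sum_(j < n) a j * (x%:C * u) ^+ j) <= C * x ^+ n) ->
  forall j, (j < n)%N -> a j = 0.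
Proof.
move=> e0 u0 H.
have up : 0 < cnorm u by exact: cnorm_gt0.
suff K (k : nat) : (k <= n)%N -> forall j, (j < k)%N -> a j = 0 by exact: K.
elim: k => [//|k IH] kn j; rewrite ltnS leq_eqVlt => /predU1P[->|jk]; last first.
  by apply: IH => //; exact: ltnW.
have {}IH : forall j, (j < k)%N -> a j = 0 by apply: IH; exact: ltnW.
pose B := \sum_(j < n) cnorm (a j) * cnorm u ^+ j.
(* the a k term dominates, all the others being smaller by a factor x *)
have H2 x : 0 < x <= Num.min e 1 -> cnorm (a k) * cnorm u ^+ k <= (B + `|C|) * x.
  move=> /andP[x0]; rewrite le_min => /andP[xe x1].
  have xk : 0 < x ^+ k by rewrite exprn_gt0.
  rewrite -(ler_pM2r xk).
  have -> : cnorm (a k) * cnorm u ^+ k * x ^+ k = cnorm (a k * (x%:C * u) ^+ k).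
    by rewrite cnormM cnormX cnormM cnormR gtr0_norm// exprMn; ring.
  pose kk : 'I_n := Ordinal kn.
  have -> : a k * (x%:C * u) ^+ k = \sum_(j < n) a j * (x%:C * u) ^+ j -
     \sum_(j < n | j != kk) a j * (x%:C * u) ^+ j.
    by rewrite (bigD1 kk)//= addrK.
  rewrite (le_trans (cnormB _ _))// addrC 2!mulrDl lerD//; last first.
    rewrite (le_trans (H x _)) ?x0//.
    rewrite -mulrA -exprS (le_trans (ler_wpM2r _ (ler_norm C))) ?exprn_ge0 ?(ltW x0)//.
    by rewrite ler_wpM2l// ler_wiXn2l// ltW.
  apply: (@le_trans _ _ (\sum_(j < n | j != kk) cnorm (a j * (x%:C * u) ^+ j))).
    elim/big_rec2: _ => [|j' y1 y2 _ h]; first by rewrite cnorm0.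
    by rewrite (le_trans (cnormD _ _))// lerD.
  rewrite -mulrA -exprS mulr_suml big_mkcond /=; apply: ler_sum => j' _.
  have p0 : 0 <= cnorm (a j') * cnorm u ^+ j' * x ^+ k.+1.
    by rewrite !mulr_ge0 ?exprn_ge0 ?cnorm_ge0// ltW.
  case: ifPn => // jk'; have [jk2|jk2] := ltnP j' k.
    by rewrite IH// mul0r cnorm0 mul0r mul0r.
  rewrite cnormM cnormX cnormM cnormR (gtr0_norm x0) exprMn.
  have -> : cnorm (a j') * (x ^+ j' * cnorm u ^+ j') =
    cnorm (a j') * cnorm u ^+ j' * x ^+ j' by ring.
  rewrite ler_wpM2l ?mulr_ge0 ?exprn_ge0 ?cnorm_ge0// ler_wiXn2l ?(ltW x0)//.
  by rewrite ltn_neqAle jk2 andbT eq_sym; apply: contra jk' => /eqP jk'; apply/eqP/val_inj.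
have m0 : 0 < Num.min e 1 by rewrite lt_min e0 ltr01.
have : cnorm (a k) * cnorm u ^+ k <= 0.
  apply: (@le0_of_natmul_le _ _ ((B + `|C|) * Num.min e 1)) => -[|m].
    rewrite mulr0 mulr_ge0 ?(ltW m0)// addr_ge0// sumr_ge0// => j' _.
    by rewrite mulr_ge0 ?exprn_ge0 ?cnorm_ge0.
  have n0 : 0 < m.+1%:R :> R by rewrite ltr0n.
  rewrite -ler_pdivlMr// -mulrA; apply: H2; rewrite divr_gt0//=.
  by rewrite ler_pdivrMr// ler_peMr ?(ltW m0)// ler1n.
rewrite pmulr_lle0 ?exprn_gt0// => ak.
by apply: cnorm_eq0; apply/le_anti; rewrite ak cnorm_ge0.
Qed.

(** The segment forces all Taylor coefficients at c to vanish, and the remainder tends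
    to 0 on the disc of half the radius; the length of the segment does not matter,
    which allows analytic continuation by steps of fixed size. *)
Lemma hol_eq0_disc (f : R[i] -> R[i]) (c u : R[i]) (r e : R) : 0 < r -> 0 < e ->
  u != 0 -> hol (fun z => cnorm (z - c) <= r) f ->
  (forall x : R, 0 < x <= e -> f (c + x%:C * u) = 0) ->
  forall z, cnorm (z - c) <= r / 2 -> f z = 0.
Proof.
move=> r0 e0 u0 hf f0 z zc.
have [f' [S [S0 f1 _ _]]] := hf.
have [a ha] := hol_taylor r0 hf f1.
have up : 0 < cnorm u by exact: cnorm_gt0.
have a0 n j : (j < n)%N -> a j = 0.
  move=> jn; apply: (@expansion_coef0 a u n (4 * S * (cnorm u / r) ^+ n)
    (Num.min e (r / 2 / cnorm u)) _ _ _ j) => //.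
    by rewrite lt_min e0 !divr_gt0.
  move=> x /andP[x0]; rewrite le_min => /andP[xe xu].
  have nx : cnorm (x%:C * u) = x * cnorm u by rewrite cnormM cnormR gtr0_norm.
  have := ha n (x%:C * u); rewrite f0 ?x0// sub0r cnormN nx -ler_pdivlMr// => /(_ xu).
  move/le_trans; apply; have -> : x * cnorm u / r = cnorm u / r * x by ring.
  by rewrite exprMn mulrA.
have -> : z = c + (z - c) by ring.
apply/cnorm_eq0/le_anti; rewrite cnorm_ge0 andbT.
apply: (@le0_of_geometric_le _ _ (4 * S) (cnorm (z - c) / r)); first by rewrite mulr_ge0.
  by rewrite divr_ge0 ?cnorm_ge0 ?(ltW r0)//= ler_pdivrMr//; lra.
move=> n; have := ha n _ zc; rewrite big1 ?subr0// => i _.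
by rewrite (a0 n)// mul0r.
Qed.

End uniqueness.

(** * A Liouville theorem for two overlapping half-planes *)

Section gluing.
Context {R : realType}.

(** Points closer than rho lie in a common piece, and points further apart satisfy
    the remainder estimate for free, the functions being bounded. *)
Lemma hol_glue (K K1 K2 : set R[i]) (f : R[i] -> R[i]) (rho : R) : 0 < rho ->
  hol K1 f -> hol K2 f ->
  (forall z, K z -> (forall w, K w -> cnorm (w - z) < rho -> K1 z /\ K1 w) \/
                    (forall w, K w -> cnorm (w - z) < rho -> K2 z /\ K2 w)) ->
  hol K f.
Proof.
move=> rho0 [f1 [M1 [M10 a1 b1 c1]]] [f2 [M2 [M20 a2 b2 c2]]] KK.
pose Q z := forall w, K w -> cnorm (w - z) < rho -> K1 z /\ K1 w.
pose M := M1 + M2.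
have aM z : K z -> cnorm (f z) <= M.
  move=> Kz; have zz : cnorm (z - z) < rho by rewrite subrr cnorm0.
  by case: (KK z Kz) => /(_ z Kz zz)[h _]; [have := a1 _ h|have := a2 _ h];
    rewrite /M; lra.
pose g z := if pselect (Q z) then f1 z else f2 z.
have bM z : K z -> cnorm (g z) <= M.
  move=> Kz; have zz : cnorm (z - z) < rho by rewrite subrr cnorm0.
  rewrite /g; case: pselect => [q|nq].
    by have [h _] := q z Kz zz; have := b1 _ h; rewrite /M; lra.
  by case: (KK z Kz) => // /(_ z Kz zz)[h _]; have := b2 _ h; rewrite /M; lra.
exists g, (M + 2 * M * rho^-1 ^+ 2 + M * rho^-1).
have M0 : 0 <= M by rewrite addr_ge0.
have p1 : 0 <= 2 * M * rho^-1 ^+ 2 by rewrite !mulr_ge0 ?exprn_ge0 ?invr_ge0 ?(ltW rho0).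
have p2 : 0 <= M * rho^-1 by rewrite mulr_ge0 ?invr_ge0 ?(ltW rho0).
split.
- lra.
- by move=> z Kz; have := aM _ Kz; lra.
- by move=> z Kz; have := bM _ Kz; lra.
move=> z w Kz Kw; set d := cnorm (w - z).
have d0 : 0 <= d by exact: cnorm_ge0.
have dd : 0 <= d ^+ 2 by exact: sqr_ge0.
have [dr|dr] := ltP d rho.
  have near1 N : 0 <= N <= M -> N * d ^+ 2 <= (M + 2 * M * rho^-1 ^+ 2 + M * rho^-1) * d ^+ 2.
    by move=> /andP[N0 NM]; rewrite ler_wpM2r//; lra.
  rewrite /g; case: pselect => [q|nq].
    have [h h'] := q w Kw dr; apply: (le_trans (c1 _ _ h h')).
    by apply: near1; rewrite M10 /M lerDl.
  case: (KK z Kz) => // /(_ w Kw dr)[h h']; apply: (le_trans (c2 _ _ h h')).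
  by apply: near1; rewrite M20 /M lerDr.
apply: (le_trans (cnormB _ _)); apply: (le_trans (lerD (cnormB _ _) (lexx _))).
rewrite cnormM -/d; have := aM _ Kz; have := aM _ Kw.
have := ler_wpM2r d0 (bM _ Kz).
have x1 : 1 <= d / rho by rewrite ler_pdivlMr// mul1r.
have : 1 <= rho^-1 ^+ 2 * d ^+ 2.
  by rewrite -exprMn mulrC expr2 (le_trans x1)// ler_peMl// (le_trans _ x1).
move=> /(ler_wpM2l M0); have : M * d * 1 <= M * d * (d / rho).
  by rewrite ler_wpM2l// mulr_ge0.
have : 0 <= M * d ^+ 2 by rewrite mulr_ge0.
rewrite expr2; lra.
Qed.

End gluing.

Section half_planes.
Context {R : realType}.
Implicit Types (z w : R[i]) (f : R[i] -> R[i]).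

Definition half_disc (delta B : R) : set R[i] :=
  [set z | delta <= complex.Re z /\ cnorm z <= B].

Definition poly_growth (D : set R[i]) f :=
  exists m : nat, exists2 C : R, 0 <= C &
    forall z, D z -> cnorm (f z) <= C * (1 + cnorm z) ^+ m.

(** Liouville's theorem: compare the Taylor expansions on discs of radius 1 and
    of radius r, and let r go to infinity. *)
Lemma entire_poly_growth f : (forall B, hol [set z | cnorm z <= B] f) ->
  poly_growth setT f ->
  exists m (a : nat -> R[i]), forall w, f w = \sum_(j < m.+1) a j * w ^+ j.
Proof.
move=> hf [m [C C0 fC]].
have T (r : R) : 1 <= r -> exists a : nat -> R[i], forall n w, cnorm w <= r / 2 ->
    cnorm (f w - \sum_(j < n) a j * w ^+ j) <=
    4 * (C * (1 + r) ^+ m) * (cnorm w / r) ^+ n.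
  move=> r1; have r0 : 0 < r by lra.
  have [||a ha] := @hol_taylor R f 0 r (C * (1 + r) ^+ m) r0.
  - by apply: holS (hf r) => z /=; rewrite subr0.
  - move=> z; rewrite subr0 => zr; apply: (le_trans (fC z I)).
    rewrite ler_wpM2l// lerXn2r ?nnegrE ?addr_ge0 ?cnorm_ge0 ?(ltW r0)//.
    by rewrite lerD2l.
  by exists a => n w wr; have := ha n w wr; rewrite add0r.
have [a ha] := T 1 (lexx _).
exists m, a => w; apply/eqP; rewrite -subr_eq0; apply/eqP/cnorm_eq0/le_anti.
rewrite cnorm_ge0 andbT.
apply: (@le0_of_natmul_le _ _ (4 * (C * 2 ^+ m) * cnorm w ^+ m.+1
   + cnorm (f w - \sum_(j < m.+1) a j * w ^+ j) * (2 * cnorm w + 1))) => n.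
have w0 := cnorm_ge0 w.
have F0 := cnorm_ge0 (f w - \sum_(j < m.+1) a j * w ^+ j).
have P0 : 0 <= 4 * (C * 2 ^+ m) * cnorm w ^+ m.+1 by rewrite !mulr_ge0 ?exprn_ge0.
have [rn|rn] := leP (n%:R : R) (2 * cnorm w + 1).
  by rewrite ler_wpDl// ler_wpM2l.
set r : R := n%:R in rn *.
have r1 : 1 <= r by lra.
have r0 : 0 < r by lra.
have [b hb] := T r r1.
have ab j : (j < m.+1)%N -> b j = a j.
  move=> jm; apply/eqP; rewrite -subr_eq0; apply/eqP.
  apply: (@expansion_coef0 R (fun j => b j - a j) 1 m.+1
    (4 * (C * (1 + 1) ^+ m) + 4 * (C * (1 + r) ^+ m)) (1 / 2)) => //.
  move=> x /andP[x0 x2]; rewrite mulr1.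
  have nx : cnorm x%:C = x by rewrite cnormR gtr0_norm.
  have := ha m.+1 x%:C; rewrite nx => /(_ x2) h1.
  have xr : x <= r / 2 by lra.
  have := hb m.+1 x%:C; rewrite nx => /(_ xr) h2.
  have -> : \sum_(j0 < m.+1) (b j0 - a j0) * x%:C ^+ j0 =
    (f x%:C - \sum_(j0 < m.+1) a j0 * x%:C ^+ j0) -
    (f x%:C - \sum_(j0 < m.+1) b j0 * x%:C ^+ j0).
    transitivity (\sum_(j0 < m.+1) b j0 * x%:C ^+ j0 - \sum_(j0 < m.+1) a j0 * x%:C ^+ j0).
      by rewrite -sumrB; apply: eq_bigr => i _; rewrite mulrBl.
    by ring.
  rewrite (le_trans (cnormB _ _))// mulrDl lerD//; first by rewrite divr1 in h1.
  apply: (le_trans h2); rewrite ler_wpM2l//.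
    by rewrite !mulr_ge0// exprn_ge0//; lra.
  by rewrite lerXn2r ?nnegrE ?divr_ge0 ?(ltW x0) ?(ltW r0)// ler_pdivrMr// ler_peMr ?(ltW x0).
have wr : cnorm w <= r / 2 by lra.
have := hb m.+1 w wr.
under eq_bigr do rewrite ab//.
move=> h.
have h2 : 4 * (C * (1 + r) ^+ m) * (cnorm w / r) ^+ m.+1 * r <=
   4 * (C * 2 ^+ m) * cnorm w ^+ m.+1.
  have -> : 4 * (C * (1 + r) ^+ m) * (cnorm w / r) ^+ m.+1 * r =
    4 * (C * ((1 + r) / r) ^+ m) * cnorm w ^+ m.+1.
    by rewrite !exprMn exprS (exprS r^-1); field; rewrite gt_eqF.
  rewrite ler_wpM2r ?exprn_ge0// ler_wpM2l// ler_wpM2l//.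
  rewrite lerXn2r ?nnegrE ?divr_ge0 ?(ltW r0)//; first lra.
  by rewrite ler_pdivrMr//; lra.
rewrite (le_trans (ler_wpM2r (ltW r0) h))// (le_trans h2)// lerDl mulr_ge0//.
lra.
Qed.

(** Substituting 1/x for x and multiplying by x^m, boundedness at infinity says that
    the reversed polynomial, without its last term, is O(x^m) at 0. *)
Lemma poly_bounded_cst (a : nat -> R[i]) m (C : R) :
  (forall x : R, 1 <= x -> cnorm (\sum_(j < m.+1) a j * x%:C ^+ j) <= C) ->
  forall w, \sum_(j < m.+1) a j * w ^+ j = a 0%N.
Proof.
move=> aC w.
have a0 j : (j < m)%N -> a (m - j)%N = 0.
  apply: (@expansion_coef0 R (fun j => a (m - j)%N) 1 m (C + cnorm (a 0%N)) 1) => //.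
  move=> x /andP[x0 x1]; rewrite mulr1.
  have xn0 : x%:C != 0 by rewrite eq_complex /= negb_and gt_eqF.
  have -> : \sum_(j0 < m) a (m - j0)%N * x%:C ^+ j0 =
    x%:C ^+ m * (\sum_(j0 < m.+1) a j0 * (x^-1)%:C ^+ j0) - x%:C ^+ m * a 0%N.
    rewrite -mulrBr big_ord_recl /= expr0 mulr1 addrC addKr mulr_sumr.
    rewrite (reindex_inj rev_ord_inj) /=; apply: eq_bigr => i _.
    rewrite subKn ?ltn_ord// /bump leq0n add1n fmorphV exprVn.
    rewrite mulrCA; congr (_ * _).
    have -> : x%:C ^+ m = x%:C ^+ (m - i.+1) * x%:C ^+ i.+1 by rewrite -exprD subnK.
    by rewrite mulfK// expf_neq0.
  rewrite (le_trans (cnormB _ _))// !cnormM !cnormX cnormR gtr0_norm// -mulrDr mulrC.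
  rewrite ler_wpM2r ?exprn_ge0 ?(ltW x0)// lerD2r; apply: aC.
  by rewrite -[leLHS]invr1 lef_pV2 ?posrE.
rewrite big_ord_recl big1 ?addr0 ?expr0 ?mulr1// => i _.
have h : (m - i.+1 < m)%N by rewrite ltn_subrL (leq_ltn_trans _ (ltn_ord i)).
by have := a0 _ h; rewrite subKn ?ltn_ord// => ->; rewrite mul0r.
Qed.

Variables f1 f2 : R[i] -> R[i].
Hypothesis hol1 : forall delta B, 0 < delta -> hol (half_disc delta B) f1.
Hypothesis hol2 : forall delta B, 0 < delta -> hol (half_disc delta B) f2.
Hypothesis growth1 : forall delta : R, 0 < delta ->
  poly_growth [set z | delta <= complex.Re z] f1.
Hypothesis growth2 : forall delta : R, 0 < delta ->
  poly_growth [set z | delta <= complex.Re z] f2.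
Hypothesis f12 : forall x : R, 0 < x < 1 -> f1 x%:C = f2 (1 - x)%:C.

(** March along the vertical line through t, upwards and downwards, by overlapping
    discs, starting from the disc centred on the real axis, where f12 applies; the
    identity theorem carries the equality from each disc to the next. *)
Lemma half_planes_agree (t : R) : 0 < t <= 1 / 2 ->
  forall z, `|complex.Re z - t| <= t / 8 -> f1 z = f2 (1 - z).
Proof.
move=> /andP[t0 t2].
pose ce (s : R) (k : nat) : R[i] := t +i* (s * k%:R * (t / 8)).
have hg s k : hol (fun z => cnorm (z - ce s k) <= t / 2) (fun z => f1 z - f2 (1 - z)).
  have h (z : R[i]) : cnorm (z - ce s k) <= t / 2 ->
      `|complex.Re z - t| <= t / 2 /\ cnorm z <= cnorm (ce s k) + t / 2.
    move=> hz; split.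
      by have := le_trans (Re_le_cnorm _) hz; rewrite ReD ReN.
    have -> : z = ce s k + (z - ce s k) by ring.
    by rewrite (le_trans (cnormD _ _))// lerD2l.
  apply: holB.
    apply: (holS _ (@hol1 (t / 2) (cnorm (ce s k) + t / 2) _)) => [z /h[h1 h2]|].
      by split => //; move: h1; rewrite ler_norml; lra.
    by rewrite divr_gt0.
  apply: (hol_comp (@hol2 (1 / 4) (1 + (cnorm (ce s k) + t / 2)) _)).
  - lra.
  - apply: holB; first exact: hol_cst.
    by apply: (@hol_id _ _ (cnorm (ce s k) + t / 2)) => z /h[].
  - move=> z /h[h1 h2]; split.
      by move: h1; rewrite ReD ReN /= ler_norml; lra.
    by rewrite (le_trans (cnormB _ _))// cnorm1 lerD2l.
have H s k : s = 1 \/ s = -1 ->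
    forall z, cnorm (z - ce s k) <= t / 4 -> f1 z - f2 (1 - z) = 0.
  move=> s1; elim: k => [|k IH] z zt.
    apply: (@hol_eq0_disc _ (fun z => f1 z - f2 (1 - z)) (ce s 0%N) 1 (t / 2) (t / 2)) => //.
    - by rewrite divr_gt0.
    - by rewrite divr_gt0.
    - move=> x /andP[x0 xt].
      have -> : ce s 0%N + x%:C * 1 = (t + x)%:C.
        by rewrite /ce mulr0 mul0r mulr1 /=; simpc.
      rewrite f12; last lra.
      by rewrite rmorphB rmorph1 subrr.
    - lra.
  apply: (@hol_eq0_disc _ (fun z => f1 z - f2 (1 - z)) (ce s k.+1) (- s%:C * 'i%C)
    (t / 2) (t / 8)) => //.
  - by rewrite divr_gt0.
  - by rewrite divr_gt0.
  - by apply/eqP => /(congr1 cnorm); rewrite cnormM cnormN cnormi cnormR cnorm0;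
      case: s1 => -> /eqP; rewrite ?normrN normr1 mulr1 oner_eq0.
  - move=> x /andP[x0 xt]; apply: IH.
    have -> : ce s k.+1 + x%:C * (- s%:C * 'i%C) - ce s k = (s * (t / 8 - x))%:C * 'i%C.
      by rewrite /ce -natr1; simpc; congr (_ +i* _); ring.
    rewrite cnormM cnormi mulr1 cnormR normrM.
    have -> : `|s| = 1 by case: s1 => ->; rewrite ?normrN normr1.
    by rewrite mul1r ger0_norm; lra.
  - lra.
move=> z zt; apply/eqP; rewrite -subr_eq0; apply/eqP.
pose s : R := if 0 <= complex.Im z then 1 else -1.
have s1 : s = 1 \/ s = -1 by rewrite /s; case: ifP; [left|right].
have sI : complex.Im z = s * `|complex.Im z|.
  rewrite /s; case: ifPn => [h|]; first by rewrite mul1r ger0_norm.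
  by rewrite -ltNge => h; rewrite mulN1r ltr0_norm ?opprK.
have ex : exists n : nat, `|complex.Im z| <= n%:R * (t / 8).
  exists (Num.bound (`|complex.Im z| / (t / 8))).
  have t8 : 0 < t / 8 by rewrite divr_gt0.
  by rewrite -ler_pdivrMr// ltW// archi_boundP// divr_ge0// ltW.
have [n hn nmin] := ex_minnP ex.
apply: (H s n s1).
apply: (le_trans (cnorm_le_ReIm _)).
have -> : complex.Re (z - ce s n) = complex.Re z - t by rewrite ReD ReN.
have -> : complex.Im (z - ce s n) = s * (`|complex.Im z| - n%:R * (t / 8)).
  by rewrite ImD ImN [in LHS]sI /=; ring.
rewrite normrM (_ : `|s| = 1) ?mul1r; last by case: s1 => ->; rewrite ?normrN normr1.
suff : `| `|complex.Im z| - n%:R * (t / 8) | <= t / 8 by lra.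
rewrite ler0_norm ?subr_le0// opprB.
case: n hn nmin => [|n] hn nmin.
  by rewrite mul0r sub0r; have := normr_ge0 (complex.Im z); lra.
have : n%:R * (t / 8) < `|complex.Im z|.
  by rewrite ltNge; apply/negP => /nmin; rewrite ltnn.
by rewrite -natr1; lra.
Qed.

(** Agreeing on a strip, the two functions patch together to an entire function of
    polynomial growth, hence a polynomial; a bound on a real half-line makes it
    constant. *)
Theorem half_planes_liouville (C : R) :
  (forall x : R, 1 <= x -> cnorm (f1 x%:C) <= C) ->
  forall z, 0 < complex.Re z -> f1 z = f2 1.
Proof.
move=> f1C z z0.
pose t := Num.min (complex.Re z) (1 / 2).
have t0 : 0 < t by rewrite lt_min z0 divr_gt0.
have t2 : t <= 1 / 2 by rewrite ge_min lexx orbT.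
have t01 : 0 < t <= 1 / 2 by rewrite t0.
(* each of the two formulas for E remains valid a little beyond the line Re w = t *)
pose E w := if t <= complex.Re w then f1 w else f2 (1 - w).
have E1 w : t - t / 8 <= complex.Re w -> f1 w = E w.
  move=> h; rewrite /E; case: ifPn => //; rewrite -ltNge => h'.
  by apply: (half_planes_agree t01); rewrite ler_norml; lra.
have E2 w : complex.Re w <= t + t / 8 -> f2 (1 - w) = E w.
  move=> h; rewrite /E; case: ifPn => // h'.
  by apply/esym/(half_planes_agree t01); rewrite ler_norml; lra.
have holE B : hol [set w | cnorm w <= B] E.
  apply: (@hol_glue _ _ (half_disc (t - t / 8) B)
    [set w | complex.Re w <= t + t / 8 /\ cnorm w <= B] _ (t / 8)).
  - by rewrite divr_gt0.
  - apply: (eq_hol _ (@hol1 (t - t / 8) B _)); first by move=> w [/E1].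
    lra.
  - apply: (@eq_hol _ _ (fun w => f2 (1 - w))); first by move=> w [/E2].
    apply: (hol_comp (@hol2 (1 / 4) (1 + B) _)).
    + lra.
    + by apply: holB; [exact: hol_cst|apply: (@hol_id _ _ B) => w []].
    + move=> w [w1 w2]; split; first by rewrite ReD ReN /=; lra.
      by rewrite (le_trans (cnormB _ _))// cnorm1 lerD2l.
  - move=> w /= wB; have [tw|tw] := leP t (complex.Re w); [left|right] => w' w'B d.
      have := le_lt_trans (Re_le_cnorm _) d; rewrite ReD ReN ltr_norml => ?.
      by split; split=> //; lra.
    have := le_lt_trans (Re_le_cnorm _) d; rewrite ReD ReN ltr_norml => ?.
    by split; split=> //; lra.
have growthE : poly_growth setT E.
  have [m1 [C1 C10 h1]] := growth1 t0.
  have q0 : 0 < 1 / 2 :> R by rewrite divr_gt0.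
  have [m2 [C2 C20 h2]] := growth2 q0.
  exists (m1 + m2)%N, (C1 + C2 * 2 ^+ m2) => [|w _].
    by rewrite addr_ge0// mulr_ge0// exprn_ge0.
  have w1 : 1 <= 1 + cnorm w by rewrite lerDl cnorm_ge0.
  have w0 : 0 <= 1 + cnorm w by rewrite (le_trans _ w1).
  have p1 : 0 <= C1 * (1 + cnorm w) ^+ (m1 + m2) by rewrite mulr_ge0 ?exprn_ge0.
  have p2 : 0 <= C2 * 2 ^+ m2 * (1 + cnorm w) ^+ (m1 + m2) by rewrite !mulr_ge0 ?exprn_ge0.
  rewrite mulrDl /E; case: ifPn => [|/negP] h.
    have := h1 w h; have : (1 + cnorm w) ^+ m1 <= (1 + cnorm w) ^+ (m1 + m2).
      by rewrite ler_weXn2l// leq_addr.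
    move=> /(ler_wpM2l C10); lra.
  have hw : 1 / 2 <= complex.Re (1 - w).
    by move/negP: h; rewrite -ltNge ReD ReN /=; lra.
  apply: (le_trans (h2 _ hw)).
  apply: (@le_trans _ _ (C2 * 2 ^+ m2 * (1 + cnorm w) ^+ (m1 + m2))); last by lra.
  rewrite -mulrA ler_wpM2l//.
  apply: (@le_trans _ _ ((2 * (1 + cnorm w)) ^+ m2)).
    rewrite lerXn2r ?nnegrE ?mulr_ge0 ?addr_ge0 ?cnorm_ge0//.
    by have := cnormB 1 w; rewrite cnorm1; have := cnorm_ge0 w; lra.
  by rewrite exprMn ler_wpM2l ?exprn_ge0// ler_weXn2l// leq_addl.
have [m [a aE]] := entire_poly_growth holE growthE.
have acst := @poly_bounded_cst a m C.
have Ecst w : E w = a 0%N.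
  rewrite aE acst// => x x1; rewrite -aE -E1; first exact: f1C.
  by rewrite /=; lra.
have -> : f1 z = E z by rewrite E1// (@le_trans _ _ t)//; [lra|rewrite ge_min lexx].
rewrite Ecst -(Ecst 0) -E2 ?subr0//=; lra.
Qed.

End half_planes.

(** * Laplace transforms *)

Section dominated.
Context d {T : measurableType d} {R : realType} (mu : {measure set T -> \bar R}).

Lemma integrable_dominated (f g : T -> R) : measurable_fun setT f ->
  mu.-integrable setT (EFin \o g) -> (forall x, `|f x| <= g x) ->
  mu.-integrable setT (EFin \o f).
Proof.
move=> mf ig fg; apply: le_integrable ig => //; first exact/measurable_EFinP.
by move=> x _ /=; rewrite lee_fin (le_trans (fg x))// ler_norm.
Qed.

Lemma integrable_scale (f : T -> R) (r : R) : mu.-integrable setT (EFin \o f) ->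
  mu.-integrable setT (EFin \o (fun x => r * f x)).
Proof.
by move=> fi; rewrite (_ : _ \o _ = (fun x => r%:E * (f x)%:E)%E)//; exact: integrableZl.
Qed.

Lemma measurable_cosT (f : T -> R) : measurable_fun setT f ->
  measurable_fun setT (fun x => cos (f x)).
Proof.
by move=> mf; apply: (measurableT_comp _ mf); apply: continuous_measurable_fun;
  exact: continuous_cos.
Qed.

Lemma measurable_sinT (f : T -> R) : measurable_fun setT f ->
  measurable_fun setT (fun x => sin (f x)).
Proof.
by move=> mf; apply: (measurableT_comp _ mf); apply: continuous_measurable_fun;
  exact: continuous_sin.
Qed.

Lemma measurable_expRT (f : T -> R) : measurable_fun setT f ->
  measurable_fun setT (fun x => expR (f x)).
Proof. by move=> mf; exact: (measurableT_comp (@measurable_expR R) mf). Qed.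

Lemma cos_normr_le1 (x : R) : `|cos x| <= 1.
Proof. by rewrite ler_norml cos_geN1 cos_le1. Qed.

Lemma sin_normr_le1 (x : R) : `|sin x| <= 1.
Proof. by rewrite ler_norml sin_geN1 sin_le1. Qed.

End dominated.

Section laplace.
Context d {T : measurableType d} {R : realType} (mu : {measure set T -> \bar R}).
Implicit Types (w tau D : T -> R) (p : R[i]).

Definition laplace w tau p : R[i] :=
  Cint mu setT (fun x => (w x)%:C * cexp (- p * (tau x)%:C)).

Let mulNRe (b : R) p : complex.Re (- p * b%:C) = - complex.Re p * b.
Proof. by rewrite !ReImE /=; ring. Qed.

Let mulNIm (b : R) p : complex.Im (- p * b%:C) = - (complex.Im p * b).
Proof. by rewrite !ReImE /=; ring. Qed.

Lemma Re_mul_cexp (a b : R) p : complex.Re (a%:C * cexp (- p * b%:C)) =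
  a * expR (- complex.Re p * b) * cos (complex.Im p * b).
Proof. by rewrite /cexp mulNRe mulNIm !ReImE /= cosN; ring. Qed.

Lemma Im_mul_cexp (a b : R) p : complex.Im (a%:C * cexp (- p * b%:C)) =
  - (a * expR (- complex.Re p * b) * sin (complex.Im p * b)).
Proof. by rewrite /cexp mulNRe mulNIm !ReImE /= sinN; ring. Qed.

Lemma Cintegrable_laplace w tau D p : measurable_fun setT w ->
  measurable_fun setT tau -> mu.-integrable setT (EFin \o D) ->
  (forall x, `|w x| * expR (- complex.Re p * tau x) <= D x) ->
  Cintegrable mu setT (fun x => (w x)%:C * cexp (- p * (tau x)%:C)).
Proof.
move=> mw mt iD wD; split.
  under eq_fun do rewrite Re_mul_cexp.
  apply: (integrable_dominated _ iD) => [|x].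
    apply: measurable_funM; last exact: measurable_cosT (measurable_funM _ _).
    by apply: measurable_funM => //; apply: measurable_expRT; exact: measurable_funM.
  apply: le_trans (wD x); rewrite !normrM (ger0_norm (expR_ge0 _)).
  by rewrite ler_piMr ?cos_normr_le1// mulr_ge0 ?expR_ge0.
under eq_fun do rewrite Im_mul_cexp.
apply: (integrable_dominated _ iD) => [|x].
  apply: measurableT_comp => //.
  apply: measurable_funM; last exact: measurable_sinT (measurable_funM _ _).
  by apply: measurable_funM => //; apply: measurable_expRT; exact: measurable_funM.
apply: le_trans (wD x); rewrite normrN !normrM (ger0_norm (expR_ge0 _)).
by rewrite ler_piMr ?sin_normr_le1// mulr_ge0 ?expR_ge0.
Qed.

Lemma Re_laplace w tau p : complex.Re (laplace w tau p) =
  \int[mu]_x (w x * expR (- complex.Re p * tau x) * cos (complex.Im p * tau x)).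
Proof. by apply: eq_Rintegral => x _; rewrite Re_mul_cexp. Qed.

Lemma Im_laplace w tau p : complex.Im (laplace w tau p) =
  \int[mu]_x (- (w x * expR (- complex.Re p * tau x) * sin (complex.Im p * tau x))).
Proof. by apply: eq_Rintegral => x _; rewrite Im_mul_cexp. Qed.

Lemma cnorm_mul_cexp (a b : R) p :
  cnorm (a%:C * cexp (- p * b%:C)) = `|a| * expR (- complex.Re p * b).
Proof.
rewrite cnormM cnormR cnorm_cexp !ReImE /=; congr (_ * expR _); ring.
Qed.

Lemma cnorm_laplace w tau D p : measurable_fun setT w ->
  measurable_fun setT tau -> mu.-integrable setT (EFin \o D) ->
  (forall x, `|w x| * expR (- complex.Re p * tau x) <= D x) ->
  cnorm (laplace w tau p) <= 2 * \int[mu]_x D x.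
Proof.
move=> mw mt iD wD; apply: le_cnorm_Cint => //; first exact: Cintegrable_laplace wD.
by move=> x _; rewrite cnorm_mul_cexp.
Qed.

(** Differentiation under the integral sign; the factor tau^2 in the domination
    hypothesis pays for the second-order remainder of the exponential. *)
Lemma hol_laplace (K : set R[i]) w tau D : measurable_fun setT w ->
  measurable_fun setT tau -> mu.-integrable setT (EFin \o D) ->
  (forall p x, K p ->
     `|w x| * (1 + tau x ^+ 2) * expR (- complex.Re p * tau x) <= D x) ->
  hol K (laplace w tau).
Proof.
move=> mw mt iD wD.
have mwt : measurable_fun setT (fun x => - (w x * tau x)).
  by apply: measurableT_comp => //; exact: measurable_funM.
have D1 p : K p -> forall x, `|w x| * expR (- complex.Re p * tau x) <= D x.
  move=> Kp x; apply: le_trans (wD p x Kp); rewrite ler_wpM2r ?expR_ge0//.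
  by rewrite ler_peMr// lerDl sqr_ge0.
have D2 p : K p -> forall x,
    `|- (w x * tau x)| * expR (- complex.Re p * tau x) <= D x.
  move=> Kp x; apply: le_trans (wD p x Kp); rewrite ler_wpM2r ?expR_ge0//.
  rewrite normrN normrM ler_wpM2l// -(real_normK (num_real (tau x))).
  by have := sqr_ge0 (`|tau x| - 1); have := normr_ge0 (tau x); nra.
have D3 p : K p -> forall x,
    `|w x| * tau x ^+ 2 * expR (- complex.Re p * tau x) <= D x.
  move=> Kp x; apply: le_trans (wD p x Kp); rewrite ler_wpM2r ?expR_ge0//.
  by rewrite ler_wpM2l// lerDr.
have ID : 0 <= \int[mu]_x `|D x| by apply: Rintegral_ge0 => x _.
have DI : \int[mu]_x D x <= \int[mu]_x `|D x|.
  apply: le_Rintegral => //; first exact: (integrable_norm iD).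
  by move=> x _; exact: ler_norm.
exists (laplace (fun x => - (w x * tau x)) tau), (16 * \int[mu]_x `|D x|); split.
- lra.
- by move=> p Kp; have := cnorm_laplace mw mt iD (D1 p Kp); lra.
- by move=> p Kp; have := cnorm_laplace mwt mt iD (D2 p Kp); lra.
move=> p q Kp Kq.
have i1 := Cintegrable_laplace mw mt iD (D1 q Kq).
have i2 := Cintegrable_laplace mw mt iD (D1 p Kp).
have i3 := Cintegrable_laplace mwt mt iD (D2 p Kp).
rewrite /laplace mulrC -CintZ// -CintB// -CintB//; last 2 first.
- exact: CintegrableB.
- exact: CintegrableZ.
have iD8 : mu.-integrable setT (EFin \o (fun x => (8 * cnorm (q - p) ^+ 2) * D x)).
  exact: integrable_scale.
apply: (le_trans (le_cnorm_Cint _ _ iD8 _)) => //.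
- apply: CintegrableB => //; last exact: CintegrableZ.
  exact: CintegrableB.
- move=> x _.
  have -> : (w x)%:C * cexp (- q * (tau x)%:C) - (w x)%:C * cexp (- p * (tau x)%:C) -
     (q - p) * ((- (w x * tau x))%:C * cexp (- p * (tau x)%:C)) =
     (w x)%:C * cexp (- p * (tau x)%:C) *
       (cexp (- (q - p) * (tau x)%:C) - 1 - (- (q - p) * (tau x)%:C)).
    have -> : - q * (tau x)%:C = - p * (tau x)%:C + - (q - p) * (tau x)%:C by ring.
    by rewrite cexpD rmorphN rmorphM /=; ring.
  rewrite cnormM cnorm_mul_cexp.
  have := cnorm_cexp_sub (- (q - p) * (tau x)%:C).
  have -> : cnorm (- (q - p) * (tau x)%:C) ^+ 2 = cnorm (q - p) ^+ 2 * tau x ^+ 2.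
    by rewrite cnormM cnormN cnormR exprMn real_normK ?num_real.
  have -> : complex.Re (- (q - p) * (tau x)%:C) =
    - complex.Re q * tau x - - complex.Re p * tau x by rewrite !ReImE /=; ring.
  set y := cnorm (cexp _ - 1 - _) => hy.
  have E0 := expR_ge0 (- complex.Re p * tau x).
  have h1 : `|w x| * expR (- complex.Re p * tau x) * y <=
    `|w x| * expR (- complex.Re p * tau x) * (4 * (cnorm (q - p) ^+ 2 * tau x ^+ 2) *
      (1 + expR (- complex.Re q * tau x - - complex.Re p * tau x))).
    by rewrite ler_wpM2l// mulr_ge0.
  apply: (le_trans h1).
  have -> : `|w x| * expR (- complex.Re p * tau x) * (4 * (cnorm (q - p) ^+ 2 * tau x ^+ 2)
     * (1 + expR (- complex.Re q * tau x - - complex.Re p * tau x))) =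
    4 * cnorm (q - p) ^+ 2 * (`|w x| * tau x ^+ 2 * expR (- complex.Re p * tau x) +
      `|w x| * tau x ^+ 2 * expR (- complex.Re q * tau x)).
    have -> : expR (- complex.Re q * tau x) = expR (- complex.Re p * tau x) *
        expR (- complex.Re q * tau x - - complex.Re p * tau x).
      by rewrite -expRD; congr expR; ring.
    by ring.
  have := D3 p Kp x; have := D3 q Kq x => hq hp.
  have -> : 8 * cnorm (q - p) ^+ 2 * D x = 4 * cnorm (q - p) ^+ 2 * (D x + D x) by ring.
  have c4 : 0 <= 4 * cnorm (q - p) ^+ 2 by apply: mulr_ge0 => //; exact: sqr_ge0.
  by apply: (ler_wpM2l c4); exact: lerD.
rewrite RintegralZl//.
have c0 : 0 <= cnorm (q - p) ^+ 2 by exact: sqr_ge0.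
have := ler_wpM2l c0 DI; lra.
Qed.

End laplace.

Section gaussian_transform.
Context d {T : measurableType d} {R : realType} (mu : {measure set T -> \bar R}).
Variables w tau : T -> R.

(** Integrals of w against Gaussian-like weights, as a function of the inverse s
    of the spectral parameter; the square removes the square root which the
    Fourier transform of a Gaussian would otherwise introduce. *)
Definition gtransform (s : R[i]) : R[i] := s^-1 * laplace mu w tau s^-1 ^+ 2.

Hypotheses (mw : measurable_fun setT w) (mtau : measurable_fun setT tau).
Hypothesis tau0 : forall x, 0 <= tau x.
Variables (C : R) (m : nat).
Hypothesis wint : forall k : R, 0 < k <= 1 ->
  mu.-integrable setT (EFin \o (fun x => `|w x| * expR (- k * tau x))).
Hypothesis wbound : forall k : R, 0 < k <= 1 ->
  \int[mu]_x (`|w x| * expR (- k * tau x)) <= C / k ^+ m.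

Let le_weight (k : R) p x : k <= complex.Re p ->
  `|w x| * expR (- complex.Re p * tau x) <= `|w x| * expR (- k * tau x).
Proof. by move=> kp; rewrite ler_wpM2l// ler_expR ler_wpM2r// lerN2. Qed.

Lemma hol_laplace_halfplane (k : R) : 0 < k ->
  hol [set p | k <= complex.Re p] (laplace mu w tau).
Proof.
move=> k0; pose k1 := Num.min k 1.
have k10 : 0 < k1 by rewrite lt_min k0 ltr01.
have k11 : k1 <= 1 by rewrite ge_min lexx orbT.
have k1k : k1 <= k by rewrite ge_min lexx.
have h0 : 0 < k1 / 2 <= 1 by lra.
pose c := 1 + (4 / k1) ^+ 2.
apply: (@hol_laplace _ _ _ _ _ _ _ (fun x => c * (`|w x| * expR (- (k1 / 2) * tau x)))) => //.
  by apply: integrable_scale; exact: wint.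
move=> p x /= kp.
rewrite -mulrA [leRHS]mulrCA ler_wpM2l//.
have t0 := tau0 x.
have e1 : expR (- complex.Re p * tau x) <= expR (- (k1 / 2) * tau x) * expR (- (k1 / 2) * tau x).
  rewrite -expRD ler_expR; have : 0 <= (complex.Re p - k1) * tau x.
    by rewrite mulr_ge0// subr_ge0 (le_trans k1k).
  lra.
have e0 := expR_gt0 (- (k1 / 2) * tau x).
(* tau^2 is absorbed by half of the exponential decay *)
have e2 : (1 + tau x ^+ 2) * expR (- (k1 / 2) * tau x) <= c.
  rewrite mulrDl mul1r /c; apply: lerD.
    by rewrite -expR0 ler_expR mulNr oppr_le0 mulr_ge0// ltW// divr_gt0.
  pose y := k1 / 4 * tau x.
  have y0 : 0 <= y by rewrite mulr_ge0// ltW// divr_gt0.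
  have ye : y <= expR y by have := expR_ge1Dx y; lra.
  have -> : expR (- (k1 / 2) * tau x) = expR (- y) ^+ 2.
    by rewrite expr2 -expRD; congr expR; rewrite /y; field.
  have -> : tau x = 4 / k1 * y by rewrite /y; field; rewrite gt_eqF.
  have -> : (4 / k1 * y) ^+ 2 * expR (- y) ^+ 2 = (4 / k1) ^+ 2 * (y * expR (- y)) ^+ 2.
    by rewrite !exprMn; ring.
  have ye1 : y * expR (- y) <= 1.
    by apply: (le_trans (ler_wpM2r (expR_ge0 _) ye)); rewrite -expRD subrr expR0.
  by rewrite ler_piMr ?sqr_ge0// exprn_ile1// mulr_ge0// expR_ge0.
apply: (@le_trans _ _ ((1 + tau x ^+ 2) *
    (expR (- (k1 / 2) * tau x) * expR (- (k1 / 2) * tau x)))).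
  by rewrite ler_wpM2l// addr_ge0// sqr_ge0.
by rewrite mulrA ler_wpM2r// ltW.
Qed.

Lemma Re_inv (s : R[i]) : complex.Re s^-1 = complex.Re s / cnorm s ^+ 2.
Proof. by case: s => a b; rewrite cnorm_sqr. Qed.

Lemma cnorm_ge_Re (s : R[i]) : complex.Re s <= cnorm s.
Proof. exact: le_trans (ler_norm _) (Re_le_cnorm s). Qed.

Lemma hol_gtransform delta B : 0 < delta -> hol (half_disc delta B) gtransform.
Proof.
move=> d0.
have [B0|B0] := leP B 0.
  apply: (@holS _ _ set0); last by apply: (eq_hol _ (@hol_cst _ set0 0)).
  by move=> z [z1 z2] /=; have := cnorm_ge_Re z; lra.
have hV : hol (half_disc delta B) GRing.inv.
  by apply: (hol_inv d0) => z [z1 _]; exact: le_trans z1 (cnorm_ge_Re z).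
apply: holM => //.
apply: (@eq_hol _ _ (fun s => laplace mu w tau s^-1 * laplace mu w tau s^-1)).
  by move=> z _; rewrite expr2.
have k0 : 0 < delta / B ^+ 2 by rewrite divr_gt0// exprn_gt0.
have hL : hol (half_disc delta B) (fun s => laplace mu w tau s^-1).
  apply: (hol_comp (hol_laplace_halfplane k0)) => // z [z1 z2] /=.
  have zp : 0 < cnorm z by have := cnorm_ge_Re z; lra.
  rewrite Re_inv ler_pM ?(ltW d0) ?invr_ge0 ?exprn_ge0 ?(ltW B0)//.
  by rewrite lef_pV2 ?posrE ?exprn_gt0// lerXn2r ?nnegrE// ltW.
exact: holM.
Qed.

Lemma growth_gtransform delta : 0 < delta ->
  poly_growth [set z | delta <= complex.Re z] gtransform.
Proof.
move=> d0; pose d1 := Num.min delta 1.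
have d10 : 0 < d1 by rewrite lt_min d0 ltr01.
have d11 : d1 <= 1 by rewrite ge_min lexx orbT.
have d1d : d1 <= delta by rewrite ge_min lexx.
exists (4 * m)%N, (delta^-1 * (2 * (`|C| / d1 ^+ m)) ^+ 2) => [|z /= zd].
  by rewrite mulr_ge0 ?invr_ge0 ?(ltW d0)// sqr_ge0.
have zp : 0 < cnorm z by have := cnorm_ge_Re z; lra.
pose b := 1 + cnorm z.
have b1 : 1 <= b by rewrite lerDl ltW.
have b0 : 0 < b by lra.
pose k := d1 / b ^+ 2.
have b2 : 0 < b ^+ 2 by rewrite exprn_gt0.
have k01 : 0 < k <= 1.
  by rewrite divr_gt0//= ler_pdivrMr// mul1r (le_trans d11)// exprn_ege1.
have kz : k <= complex.Re z^-1.
  rewrite Re_inv ler_pM ?invr_ge0 ?(ltW d10) ?(ltW b2) ?(le_trans d1d)//.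
  by rewrite lef_pV2 ?posrE ?exprn_gt0// lerXn2r ?nnegrE ?(ltW zp) ?(ltW b0)// lerDr.
have h := cnorm_laplace mw mtau (wint k01) (fun x => le_weight x kz).
have h3 : cnorm (laplace mu w tau z^-1) <= 2 * (`|C| / d1 ^+ m) * b ^+ (2 * m).
  rewrite (le_trans h)// -mulrA ler_wpM2l//.
  have := wbound k01; move/le_trans; apply.
  have -> : C / k ^+ m = C * (b ^+ (2 * m) / d1 ^+ m).
    by rewrite /k expr_div_n exprM invf_div.
  rewrite mulrA -mulrAC ler_wpM2r ?exprn_ge0 ?(ltW b0)//.
  by rewrite ler_wpM2r ?ler_norm// invr_ge0 exprn_ge0// ltW.
rewrite cnormM cnormV cnormX -mulrA ler_pM ?invr_ge0 ?(ltW zp) ?exprn_ge0 ?cnorm_ge0//.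
  by rewrite lef_pV2 ?posrE// (le_trans zd)// cnorm_ge_Re.
have -> : (4 * m = 2 * m * 2)%N by rewrite mulnAC.
rewrite exprM -exprMn lerXn2r ?nnegrE ?cnorm_ge0//.
by rewrite !mulr_ge0 ?invr_ge0 ?exprn_ge0 ?(ltW d10) ?(ltW b0).
Qed.

Lemma laplace_real (k : R) :
  laplace mu w tau k%:C = (\int[mu]_x (w x * expR (- k * tau x)))%:C.
Proof.
rewrite /laplace /Cint; congr (_ +i* _).
  by apply: eq_Rintegral => x _; rewrite Re_mul_cexp /= mul0r cos0 mulr1.
rewrite (@eq_Rintegral _ _ _ _ _ (fun=> 0)); first by rewrite Rintegral_cst// mul0r.
by move=> x _; rewrite Im_mul_cexp /= mul0r sin0 mulr0 oppr0.
Qed.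

End gaussian_transform.

(** * Gaussian integrals on the line *)

Section gauss1D.
Context {R : realType}.
Local Notation mu := (@lebesgue_measure R).

Let normal_gaussE (l m : R) : 0 < l ->
  normal_pdf m (Num.sqrt (2 * l)^-1) =
  (fun y => (Num.sqrt (pi / l))^-1 * expR (- l * (y - m) ^+ 2)).
Proof.
move=> l0; have l20 : 0 < (2 * l)^-1 by rewrite invr_gt0 mulr_gt0.
rewrite normal_pdfE ?gt_eqF ?sqrtr_gt0//.
apply/funext => y; rewrite /normal_peak /normal_fun sqr_sqrtr ?(ltW l20)//.
by congr ((Num.sqrt _)^-1 * expR _); field; rewrite gt_eqF.
Qed.

Let sqrt_gt0 (l : R) : 0 < l -> 0 < Num.sqrt (pi / l).
Proof. by move=> l0; rewrite sqrtr_gt0 divr_gt0// pi_gt0. Qed.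

Lemma integrable_gauss (l m : R) : 0 < l ->
  mu.-integrable setT (EFin \o (fun y => expR (- l * (y - m) ^+ 2))).
Proof.
move=> l0; have := integrable_normal_pdf m (Num.sqrt (2 * l)^-1).
rewrite normal_gaussE// => h.
rewrite (_ : _ \o _ = (fun y => (Num.sqrt (pi / l))%:E *
  ((Num.sqrt (pi / l))^-1 * expR (- l * (y - m) ^+ 2))%:E)%E).
  exact: integrableZl.
by apply/funext => y /=; rewrite -EFinM mulVKf// gt_eqF// sqrt_gt0.
Qed.

Lemma integral_gauss (l m : R) : 0 < l ->
  \int[mu]_y expR (- l * (y - m) ^+ 2) = Num.sqrt (pi / l).
Proof.
move=> l0; have := integral_normal_pdf m (Num.sqrt (2 * l)^-1).
rewrite normal_gaussE// => /(congr1 fine) /=; rewrite -/(Rintegral _ _ _).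
rewrite RintegralZl//; last exact: integrable_gauss.
by move/(canRL (mulKf _)) => ->; rewrite ?mulr1 ?invrK// invr_eq0 gt_eqF// sqrt_gt0.
Qed.

Lemma integral_gauss_expR (l x : R) : 0 < l ->
  \int[mu]_y (expR (- l * y ^+ 2) * expR (- x * y)) =
  Num.sqrt (pi / l) * expR (x ^+ 2 / (4 * l)).
Proof.
move=> l0; rewrite -(@integral_gauss l (- x / (2 * l)))//.
rewrite mulrC -RintegralZl//; last exact: integrable_gauss.
apply: eq_Rintegral => y _; rewrite -!expRD; congr expR.
by field; rewrite gt_eqF.
Qed.

Lemma hol_laplace_gauss (l B : R) : 0 < l -> 0 <= B ->
  hol [set p | cnorm p <= B] (laplace mu (fun y => expR (- l * y ^+ 2)) id).
Proof.
move=> l0 B0; pose c := (1 + 4 / l) * expR (B ^+ 2 / l).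
apply: (@hol_laplace _ _ R mu _ _ _ (fun y => c * expR (- (l / 2) * (y - 0) ^+ 2))) => //.
- apply: measurable_expRT; apply: measurable_funM => //; exact: measurable_funX.
- by apply: integrable_scale; apply: integrable_gauss; rewrite divr_gt0.
move=> p y /= pB; rewrite subr0 ger0_norm ?expR_ge0//.
have q0 : 0 <= l / 4 * y ^+ 2 by rewrite mulr_ge0 ?sqr_ge0// divr_ge0// ltW.
have e1 : 1 + y ^+ 2 <= (1 + 4 / l) * expR (l / 4 * y ^+ 2).
  have h := expR_ge1Dx (l / 4 * y ^+ 2).
  have yq : y ^+ 2 = 4 / l * (l / 4 * y ^+ 2) by field; rewrite gt_eqF.
  move: q0 h yq; set q := l / 4 * y ^+ 2 => q0 h ->.
  have l4 : 0 <= 4 / l by rewrite divr_ge0// ltW.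
  have := ler_wpM2l l4 h; lra.
have e2 : expR (- complex.Re p * y) <= expR (l / 4 * y ^+ 2) * expR (B ^+ 2 / l).
  rewrite -expRD ler_expR.
  have h1 : - complex.Re p * y <= B * `|y|.
    rewrite (le_trans (ler_norm _))// normrM normrN ler_wpM2r//.
    exact: le_trans (Re_le_cnorm p) pB.
  apply: (le_trans h1); rewrite -(real_normK (num_real y)) -subr_ge0.
  have -> : l / 4 * `|y| ^+ 2 + B ^+ 2 / l - B * `|y| = l^-1 * (l / 2 * `|y| - B) ^+ 2.
    by field; rewrite gt_eqF.
  by rewrite mulr_ge0 ?invr_ge0 ?(ltW l0)// sqr_ge0.
have -> : c * expR (- (l / 2) * y ^+ 2) = expR (- l * y ^+ 2) *
   ((1 + 4 / l) * expR (l / 4 * y ^+ 2)) * (expR (l / 4 * y ^+ 2) * expR (B ^+ 2 / l)).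
  have -> : expR (- (l / 2) * y ^+ 2) = expR (- l * y ^+ 2) * expR (l / 4 * y ^+ 2)
      * expR (l / 4 * y ^+ 2) by rewrite -!expRD; congr expR; field.
  by rewrite /c; ring.
rewrite ler_pM ?expR_ge0 ?mulr_ge0 ?expR_ge0 ?addr_ge0 ?sqr_ge0//.
by rewrite ler_wpM2l ?expR_ge0.
Qed.

(** Both sides extend to holomorphic functions of the Laplace variable, which agree at
    real points, by completing the square, hence also at imaginary points. *)
Lemma laplace_gauss_imag (l t : R) : 0 < l ->
  laplace mu (fun y => expR (- l * y ^+ 2)) id ('i%C * t%:C) =
  (Num.sqrt (pi / l) * expR (- (t ^+ 2 / (4 * l))))%:C.
Proof.
move=> l0.
pose L := laplace mu (fun y => expR (- l * y ^+ 2)) id.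
pose G (p : R[i]) := (Num.sqrt (pi / l))%:C * cexp (((4 * l)^-1)%:C * (p * p)).
pose r := 2 * `|t| + 2.
have r0 : 0 < r by rewrite ltr_wpDl// mulr_ge0.
have holG : hol [set p | cnorm p <= r] G.
  apply: holM; first exact: hol_cst.
  pose B : R := (4 * l)^-1 * (r * r).
  apply: (hol_comp (@hol_cexp _ [set z : R[i] | complex.Re z <= B] B _)) => //.
    apply: holM; first exact: hol_cst.
    by apply: holM; apply: (@hol_id _ _ r).
  move=> p /= pr; apply: le_trans (ler_norm _) _; apply: le_trans (Re_le_cnorm _) _.
  have l4 : 0 <= (4 * l)^-1 by rewrite invr_ge0 mulr_ge0// ltW.
  rewrite !cnormM cnormR ger0_norm// ler_wpM2l//.
  by rewrite ler_pM ?cnorm_ge0.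
have LG : forall p, cnorm (p - 0) <= r / 2 -> L p - G p = 0.
  apply: (@hol_eq0_disc R (fun p => L p - G p) 0 1 r 1) => //.
  - apply: (@holS _ _ [set p | cnorm p <= r]) => [z /=|]; first by rewrite subr0.
    by apply: holB => //; apply: hol_laplace_gauss; rewrite ?(ltW r0).
  move=> x _; rewrite add0r mulr1 /L laplace_real integral_gauss_expR//.
  suff -> : G x%:C = (Num.sqrt (pi / l) * expR (x ^+ 2 / (4 * l)))%:C by rewrite subrr.
  rewrite /G -(rmorphM _ x x) -(rmorphM _ (4 * l)^-1) cexpR -rmorphM.
  by rewrite expr2 [_ / (4 * l)]mulrC.
rewrite -[LHS]/(L ('i%C * t%:C)).
have -> : L ('i%C * t%:C) = G ('i%C * t%:C).
  apply/eqP; rewrite -subr_eq0; apply/eqP/LG.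
  by rewrite subr0 cnormM cnormi mul1r cnormR /r; have := normr_ge0 t; lra.
rewrite /G.
have -> : 'i%C * t%:C * ('i%C * t%:C) = (- t ^+ 2)%:C :> R[i].
  by rewrite mulrACA -rmorphM; simpc; rewrite expr2.
rewrite -(rmorphM _ (4 * l)^-1) cexpR -rmorphM.
by rewrite mulrN [_ / (4 * l)]mulrC.
Qed.

Lemma integrable_gauss_mul (l : R) (g : measurableTypeR R -> R) : 0 < l -> measurable_fun setT g ->
  (forall y, `|g y| <= 1) ->
  mu.-integrable setT (EFin \o (fun y => expR (- l * y ^+ 2) * g y)).
Proof.
move=> l0 mg g1; apply: (integrable_dominated _ (integrable_gauss 0 l0)) => [|y].
  apply: measurable_funM => //; apply: measurable_expRT.
  by apply: measurable_funM => //; exact: measurable_funX.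
by rewrite normrM ger0_norm ?expR_ge0// subr0 ler_piMr ?expR_ge0.
Qed.

Lemma fourier_gauss (l t theta : R) : 0 < l ->
  \int[mu]_y (expR (- l * y ^+ 2) * cos (theta + t * y)) =
  Num.sqrt (pi / l) * expR (- (t ^+ 2 / (4 * l))) * cos theta.
Proof.
move=> l0; have h := laplace_gauss_imag t l0.
have Re0 : complex.Re ('i%C * t%:C : R[i]) = 0 by rewrite !ReImE /=; ring.
have Im0 : complex.Im ('i%C * t%:C : R[i]) = t by rewrite !ReImE /=; ring.
have mty : measurable_fun setT (fun y : measurableTypeR R => t * y).
  exact: measurable_funM.
have ic := integrable_gauss_mul l0 (measurable_cosT mty) (fun y => cos_normr_le1 (t * y)).
have is' := integrable_gauss_mul l0 (measurable_sinT mty) (fun y => sin_normr_le1 (t * y)).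
have hc : \int[mu]_y (expR (- l * y ^+ 2) * cos (t * y)) =
    Num.sqrt (pi / l) * expR (- (t ^+ 2 / (4 * l))).
  have := congr1 (@complex.Re R) h; rewrite Re_laplace Re0 Im0 [RHS]/= => <-.
  by apply: eq_Rintegral => y _; rewrite oppr0 mul0r expR0 mulr1.
have hs : \int[mu]_y (expR (- l * y ^+ 2) * sin (t * y)) = 0.
  apply: oppr_inj; rewrite oppr0 -mulN1r -RintegralZl//.
  have := congr1 (@complex.Im R) h; rewrite Im_laplace Re0 Im0 [RHS]/= => <-.
  by apply: eq_Rintegral => y _; rewrite oppr0 mul0r expR0 mulr1 mulN1r.
rewrite (@eq_Rintegral _ _ _ mu _ (fun y =>
  cos theta * (expR (- l * y ^+ 2) * cos (t * y)) -
  sin theta * (expR (- l * y ^+ 2) * sin (t * y)))); last first.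
  by move=> y _; rewrite cosD; ring.
rewrite (RintegralB measurableT (integrable_scale _ ic) (integrable_scale _ is')) !RintegralZl//.
by rewrite hc hs mulr0 subr0 mulrC.
Qed.

End gauss1D.

(** * Uniqueness for Fourier transforms *)

Section smoothstep.
Context {R : realType}.

(** A polynomial map of the unit interval with attracting fixed points 0 and 1 and
    repelling fixed point 1/2: its iterates round u to the nearest integer. *)
Definition smoothstep (u : R) := u ^+ 2 * (3 - 2 * u).

Lemma smoothstep01 u : 0 <= u <= 1 -> 0 <= smoothstep u <= 1.
Proof.
move=> /andP[u0 u1]; rewrite /smoothstep mulr_ge0 ?sqr_ge0 //=; try lra.
have : 0 <= (1 - u) ^+ 2 * (1 + 2 * u) by rewrite mulr_ge0 ?sqr_ge0//; lra.
lra.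
Qed.

Lemma iter_smoothstep01 k u : 0 <= u <= 1 -> 0 <= iter k smoothstep u <= 1.
Proof. by move=> u01; elim: k => //= k; exact: smoothstep01. Qed.

Lemma iter_smoothstepC k u : iter k smoothstep (1 - u) = 1 - iter k smoothstep u.
Proof. by elim: k => //= k ->; rewrite /smoothstep; ring. Qed.

Lemma iter_smoothstep_half k : iter k smoothstep (1 / 2) = 1 / 2.
Proof. by elim: k => //= k ->; rewrite /smoothstep; field. Qed.

Lemma cvg_iter_smoothstep0 u : 0 <= u < 1 / 2 ->
  iter k smoothstep u @[k --> \oo] --> (0 : R).
Proof.
move=> /andP[u0 u2]; pose c := u * (3 - 2 * u).
have c0 : 0 <= c by rewrite /c mulr_ge0//; lra.
have c1 : c < 1.
  have : 0 < (1 - 2 * u) * (1 - u) by rewrite mulr_gt0//; lra.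
  rewrite /c; lra.
have u01 : 0 <= u <= 1 by lra.
have H k : iter k smoothstep u <= u * c ^+ k.
  elim: k => [|k IH] /=; first by rewrite expr0 mulr1.
  have /andP[] := iter_smoothstep01 k u01.
  set x := iter k _ u in IH * => x0 x1.
  have ck : c ^+ k <= 1 by rewrite exprn_ile1// ltW.
  have xu : x <= u by rewrite (le_trans IH)// ler_piMr.
  have xc : x * (3 - 2 * x) <= c.
    have : 0 <= (u - x) * (3 - 2 * (u + x)) by rewrite mulr_ge0//; lra.
    rewrite /c; lra.
  have -> : smoothstep x = x * (x * (3 - 2 * x)) by rewrite /smoothstep; ring.
  by rewrite exprSr [leRHS]mulrA ler_pM// mulr_ge0//; lra.
apply: (@squeeze_cvgr _ _ _ _ (fun=> 0) (fun k => u * c ^+ k)).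
- by near=> k; rewrite H andbT; have /andP[] := iter_smoothstep01 k u01.
- exact: cvg_cst.
- rewrite -[X in _ --> X](mulr0 u); apply: cvgMr; apply: cvg_expr.
  by rewrite ger0_norm.
Unshelve. all: by end_near. Qed.

End smoothstep.

Section cos_dyadic.
Context {R : realType}.

Lemma cos_lt0_pi (z : R) : pi / 2 < z <= pi -> cos z < 0.
Proof.
move=> /andP[z1 z2].
have -> : z = pi - (pi - z) by ring.
rewrite cosB cospi sinpi mul0r addr0 mulN1r oppr_lt0.
by apply: cos_gt0_pihalf; have := pi_gt0 R; lra.
Qed.

(** If |x| > pi/2, halving |x| until it is at most pi brings it into the interval
    from pi/2 to pi, where the cosine is negative. *)
Lemma cos_dyadic_ge0 (x : R) :
  (forall k : nat, 0 <= cos (2^-1 ^+ k * x)) <-> `|x| <= pi / 2.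
Proof.
have p0 := pi_gt0 R.
split => [H|xp k]; last first.
  have : `|2^-1 ^+ k * x| <= pi / 2.
    rewrite normrM ger0_norm ?exprn_ge0 ?invr_ge0// (le_trans _ xp)//.
    by rewrite ler_piMl// exprn_ile1// ?invr_ge0// invf_le1// ler1n.
  rewrite ler_norml => h; apply: cos_ge0_pihalf; lra.
rewrite leNgt; apply/negP => xp.
have cosN k : cos (2^-1 ^+ k * x) = cos (2^-1 ^+ k * `|x|).
  by case: (ger0P x) => // _; rewrite mulrN cosN.
have ex : exists k : nat, 2^-1 ^+ k * `|x| <= pi.
  exists (Num.bound (`|x| / pi)).
  rewrite exprVn ler_pdivrMl ?exprn_gt0// -ler_pdivrMr//.
  apply: le_trans (natr_le_expr2 _); apply/ltW/archi_boundP.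
  by rewrite divr_ge0// ltW.
have [k kP kmin] := ex_minnP ex.
have := H k; rewrite cosN leNgt => /negP; apply.
apply: cos_lt0_pi; rewrite kP andbT.
case: k kP kmin => [|k] kP kmin; first by rewrite expr0 mul1r.
have : pi < 2^-1 ^+ k * `|x| by rewrite ltNge; apply/negP => /kmin; rewrite ltnn.
by rewrite exprS -mulrA; lra.
Qed.

End cos_dyadic.

Section fourier_uniqueness.
Context d {T : measurableType d} {R : realType} (mu : {measure set T -> \bar R}).
Variables (n : nat) (tau : 'I_n -> T -> R) (H : T -> R).
Hypothesis mtau : forall j, measurable_fun setT (tau j).
Hypothesis iH : mu.-integrable setT (EFin \o H).

Let phase (c : 'I_n -> R) x := \sum_(j < n) c j * tau j x.

Definition trig_null (W : T -> R) := [/\ measurable_fun setT W,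
  exists M, forall x, `|W x| <= M &
  forall theta c, \int[mu]_x (H x * W x * cos (theta + phase c x)) = 0].

(** Bounded functions which preserve the vanishing of all trigonometric
    integrals.  They form an algebra closed under bounded pointwise limits, so
    the sets whose indicator is a multiplier form a sigma-algebra. *)
Definition multiplier (phi : T -> R) :=
  forall W, trig_null W -> trig_null (fun x => W x * phi x).

Let mphase c : measurable_fun setT (phase c).
Proof.
by apply: measurable_sum => j; exact: measurable_funM.
Qed.

Let mH : measurable_fun setT H.
Proof. by apply/measurable_EFinP; case/integrableP: iH. Qed.

Let integrable_mul (g : T -> R) (M : R) : measurable_fun setT g ->
  (forall x, `|g x| <= M) -> mu.-integrable setT (EFin \o (fun x => H x * g x)).
Proof.
move=> mg gM; apply: (@integrable_dominated _ _ _ _ _ (fun x => M * `|H x|)).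
- exact: measurable_funM.
- apply: integrable_scale.
  exact: (integrable_norm iH).
- by move=> x; rewrite normrM mulrC ler_wpM2r.
Qed.

Let integrable_trig (W : T -> R) (M theta : R) (c : 'I_n -> R) : measurable_fun setT W ->
  (forall x, `|W x| <= M) ->
  mu.-integrable setT (EFin \o (fun x => H x * W x * cos (theta + phase c x))).
Proof.
move=> mW WM.
have -> : (fun x => H x * W x * cos (theta + phase c x)) =
  (fun x => H x * (W x * cos (theta + phase c x))) by apply/funext => x; rewrite mulrA.
apply: (@integrable_mul _ M).
  apply: measurable_funM => //; apply: measurable_cosT.
  exact: measurable_funD.
move=> x; rewrite normrM (le_trans _ (WM x))// ler_piMr//; exact: cos_normr_le1.
Qed.

Lemma trig_nullD W V : trig_null W -> trig_null V -> trig_null (fun x => W x + V x).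
Proof.
move=> [mW [M WM] W0] [mV [N VN] V0]; split; first exact: measurable_funD.
  by exists (M + N) => x; rewrite (le_trans (ler_normD _ _))// lerD.
move=> theta c.
rewrite (@eq_Rintegral _ _ _ mu _ (fun x => H x * W x * cos (theta + phase c x) +
  H x * V x * cos (theta + phase c x))); last by move=> x _; ring.
by rewrite RintegralD// ?W0 ?V0 ?addr0//; exact: integrable_trig.
Qed.

Lemma trig_nullZ a W : trig_null W -> trig_null (fun x => a * W x).
Proof.
move=> [mW [M WM] W0]; split; first exact: measurable_funM.
  by exists (`|a| * M) => x; rewrite normrM ler_wpM2l.
move=> theta c.
rewrite (@eq_Rintegral _ _ _ mu _ (fun x => a * (H x * W x * cos (theta + phase c x))));
  last by move=> x _; ring.
by rewrite RintegralZl// ?W0 ?mulr0//; exact: integrable_trig.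
Qed.

Lemma multiplier_cst a : multiplier (fun=> a).
Proof. by move=> W /(@trig_nullZ a); under eq_fun do rewrite mulrC. Qed.

Lemma multiplierM phi psi : multiplier phi -> multiplier psi ->
  multiplier (fun x => phi x * psi x).
Proof. by move=> hp hq W /hp/hq; under eq_fun do rewrite -mulrA. Qed.

Lemma multiplierD phi psi : multiplier phi -> multiplier psi ->
  multiplier (fun x => phi x + psi x).
Proof.
move=> hp hq W W0; under eq_fun do rewrite mulrDr.
by apply: trig_nullD; [exact: hp|exact: hq].
Qed.

Lemma multiplierX phi k : multiplier phi -> multiplier (fun x => phi x ^+ k).
Proof.
move=> hp; elim: k => [|k IH]; first exact: (multiplier_cst 1).
by under eq_fun do rewrite exprS; exact: multiplierM.
Qed.

Lemma multiplierC phi : multiplier phi -> multiplier (fun x => 1 - phi x).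
Proof.
move=> hp; have -> : (fun x => 1 - phi x) = (fun x => 1 + (-1) * phi x).
  by apply/funext => x; rewrite mulN1r.
apply: multiplierD; first exact: multiplier_cst.
by apply: multiplierM => //; exact: multiplier_cst.
Qed.

(** Dominated convergence, with a multiple of |H| as dominating function. *)
Lemma multiplier_cvg (phi_ : nat -> T -> R) (phi : T -> R) : (forall k, multiplier (phi_ k)) ->
  (forall k x, `|phi_ k x| <= 1) -> (forall x, phi_ ^~ x @ \oo --> phi x) ->
  multiplier phi.
Proof.
move=> hp p1 cp W [mW [M WM] W0].
have hW k := hp k W (And3 mW (ex_intro _ M WM) W0).
have mWk k : measurable_fun setT (fun x => W x * phi_ k x) by case: (hW k).
have cW x : (W x * phi_ k x) @[k --> \oo] --> W x * phi x.
  by apply: cvgMr; exact: cp.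
have mWp : measurable_fun setT (fun x => W x * phi x).
  by apply: (measurable_fun_cvg mWk) => x _; exact: cW.
have Wk k x : `|W x * phi_ k x| <= M.
  by rewrite normrM (le_trans _ (WM x))// ler_piMr.
split => //.
  exists M => x; apply: (cvgr_to_le (cvg_norm (cW x))).
  by near=> k; exact: Wk.
move=> theta c.
have iWk k := integrable_trig theta c (mWk k) (Wk k).
have e k : (\int[mu]_x (H x * (W x * phi_ k x) * cos (theta + phase c x))%:E = 0)%E.
  have [_ _ /(_ theta c) W0k] := hW k; rewrite -[LHS]fineK; first exact: congr1 W0k.
  exact: integrable_fin_num (iWk k).
have mf (V : T -> R) : measurable_fun setT V ->
    measurable_fun setT (fun x => (H x * V x * cos (theta + phase c x))%:E).
  move=> mV; apply/measurable_EFinP; apply: measurable_funM; first exact: measurable_funM.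
  by apply: measurable_cosT; exact: measurable_funD.
have iM : mu.-integrable setT (fun x => (M * `|H x|)%:E).
  under eq_fun do rewrite EFinM; apply: integrableZl => //.
  exact: (integrable_norm iH).
pose F (V : T -> R) (x : T) := (H x * V x * cos (theta + phase c x))%:E.
have FF : {ae mu, forall x, setT x ->
    (fun k => F (fun x => W x * phi_ k x) x) @ \oo --> F (fun x => W x * phi x) x}.
  apply: aeW => x _; apply: cvg_EFin; first by near=> k.
  by apply: cvgMl; apply: cvgMr; exact: cW.
have FM : {ae mu, forall (x : T) (k : nat), setT x ->
    (`|F (fun x => (W x * phi_ k x)%R) x| <= (M * `|H x|)%:E)%E}.
  apply: aeW => x k _; rewrite lee_fin -mulrA normrM mulrC ler_wpM2r//.
  by rewrite normrM (le_trans _ (Wk k x))// ler_piMr//; exact: cos_normr_le1.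
have [_ _] := dominated_convergence measurableT (fun k => mf _ (mWk k)) (mf _ mWp)
  FF iM FM.
move=> DC; suff : (\int[mu]_x F (fun x => (W x * phi x)%R) x = 0)%E.
  by rewrite /Rintegral => ->.
apply: (cvg_unique (@ereal_hausdorff R) DC).
rewrite (_ : [sequence _]_n = cst 0%E); first exact: cvg_cst.
by apply/funext => k; exact: e.
Unshelve. all: by end_near. Qed.

Lemma integral_multiplier phi : trig_null (fun=> 1) -> multiplier phi ->
  \int[mu]_x (H x * phi x) = 0.
Proof.
move=> h1 /(_ _ h1) [_ _ /(_ 0 (fun=> 0))] <-; apply: eq_Rintegral => x _.
by rewrite mul1r add0r /phase big1 ?cos0 ?mulr1// => j _; rewrite mul0r.
Qed.

Definition multset (A : set T) := multiplier (fun x => \1_A x).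

Lemma multset0 : multset set0.
Proof. by rewrite /multset; under eq_fun do rewrite indic0; exact: multiplier_cst. Qed.

Lemma multsetC A : multset A -> multset (~` A).
Proof.
move=> /multiplierC; rewrite /multset; congr multiplier; apply/funext => x.
by rewrite !indicE in_setC; case: (x \in A); rewrite ?subrr ?subr0.
Qed.

Lemma multset_bigcap (A : nat -> set T) : (forall k, multset (A k)) ->
  multset (\bigcap_k A k).
Proof.
move=> mA; apply: (@multiplier_cvg (fun k x => \prod_(i < k) \1_(A i) x)).
- move=> k; elim: k => [|k IH].
    by under eq_fun do rewrite big_ord0; exact: multiplier_cst.
  by under eq_fun do rewrite big_ord_recr; exact: (multiplierM IH (mA k)).
- move=> k x; rewrite normr_prod; apply: prodr_ile1 => i _; rewrite normr_ge0 indicE /=.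
  by case: (x \in _); rewrite ?normr1 ?normr0.
move=> x; have [xA|] := pselect ((\bigcap_k A k) x).
  rewrite indicE mem_set// (_ : (fun k => _) = cst 1); first exact: cvg_cst.
  apply/funext => k; rewrite /= big1// => i _.
  by rewrite indicE mem_set//; exact: xA.
move=> nxA; have [k nk] : exists k, ~ A k x.
  by apply: contrapT => h; apply: nxA => k _; apply: contrapT => nk; apply: h; exists k.
rewrite indicE memNset//.
apply: cvg_near_cst.
exists k.+1 => // j /= kj.
by rewrite (bigD1 (Ordinal kj))//= indicE memNset// mul0r.
Qed.

Lemma multset_bigcup (A : nat -> set T) : (forall k, multset (A k)) ->
  multset (\bigcup_k A k).
Proof.
move=> mA; rewrite -[X in multset X]setCK; apply: multsetC.
by rewrite setC_bigcup; apply: multset_bigcap => k; exact: multsetC.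
Qed.

Lemma multset_sigma_algebra : sigma_algebra setT multset.
Proof.
split; [exact: multset0|by move=> A /multsetC; rewrite setTD|exact: multset_bigcup].
Qed.

(** The iterates of smoothstep on g converge to the indicator of the set, except for
    the value 1/2 where g is 1/2, which taking powers removes. *)
Lemma multset_gt_half (g : T -> R) : (forall x, 0 <= g x <= 1) -> multiplier g ->
  multset [set x | 1 / 2 < g x].
Proof.
move=> g01 mg.
pose L x : R := if g x < 1 / 2 then 0 else if g x == 1 / 2 then 1 / 2 else 1.
have mL : multiplier L.
  apply: (@multiplier_cvg (fun k x => iter k smoothstep (g x))).
  - elim=> [//|k IH]; rewrite /= /smoothstep; apply: multiplierM.
      exact: (@multiplierX _ 2).
    have -> : (fun x => 3 - 2 * iter k smoothstep (g x)) =
      (fun x => 3 + (-2) * iter k smoothstep (g x)).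
      by apply/funext => x; rewrite mulNr.
    apply: multiplierD; first exact: multiplier_cst.
    by apply: multiplierM => //; exact: multiplier_cst.
  - move=> k x; have /andP[h0 h1] := iter_smoothstep01 k (g01 x).
    by rewrite ger0_norm.
  - move=> x; rewrite /L; have /andP[g0 g1] := g01 x.
    have [h|h|->] := ltgtP (g x) (1 / 2).
    + by apply: cvg_iter_smoothstep0; rewrite g0.
    + have -> : (fun k => iter k smoothstep (g x)) =
          (fun k => 1 - iter k smoothstep (1 - g x)).
        by apply/funext => k; rewrite iter_smoothstepC; ring.
      rewrite -[X in _ --> X]subr0; apply: cvgB; first exact: cvg_cst.
      by apply: cvg_iter_smoothstep0; lra.
    + by under eq_fun do rewrite iter_smoothstep_half; exact: cvg_cst.
apply: (@multiplier_cvg (fun k x => L x ^+ k.+1)).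
- by move=> k; exact: multiplierX.
- move=> k x; rewrite normrX exprn_ile1// /L.
  by case: ifP => _; rewrite ?normr0//; case: ifP => _; rewrite ?normr1// ger0_norm; lra.
move=> x; rewrite /L indicE; case: (ltgtP (g x) (1 / 2)) => h.
- rewrite memNset; last by move=> /=; lra.
  by under eq_fun do rewrite expr0n; exact: cvg_cst.
- by rewrite mem_set//; under eq_fun do rewrite expr1n; exact: cvg_cst.
- rewrite memNset; last by move=> /=; rewrite h ltxx.
  have /cvg_expr : `|1 / 2 : R| < 1 by rewrite ger0_norm; lra.
  by rewrite -(cvg_shiftS (fun k => (1 / 2 : R) ^+ k)).
Qed.

(** Product-to-sum formula: multiplication by a cosine splits a trigonometric integral
    into two others. *)
Lemma multiplier_cos theta (c : 'I_n -> R) : multiplier (fun x => cos (theta + phase c x)).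
Proof.
move=> W [mW [M WM] W0].
have mc : measurable_fun setT (fun x => cos (theta + phase c x)).
  by apply: measurable_cosT; exact: measurable_funD.
have WcM x : `|W x * cos (theta + phase c x)| <= M.
  by rewrite normrM (le_trans _ (WM x))// ler_piMr//; exact: cos_normr_le1.
split; [exact: measurable_funM|by exists M|] => theta' c'.
have phD a b x : phase (fun j => a j + b j) x = phase a x + phase b x.
  by rewrite /phase -big_split; apply: eq_bigr => j _; rewrite mulrDl.
have phB a b x : phase (fun j => a j - b j) x = phase a x - phase b x.
  by rewrite /phase -sumrB; apply: eq_bigr => j _; rewrite mulrBl.
rewrite (@eq_Rintegral _ _ _ mu _ (fun x => 2^-1 *
  (H x * W x * cos ((theta' + theta) + phase (fun j => c' j + c j) x) +
   H x * W x * cos ((theta' - theta) + phase (fun j => c' j - c j) x)))).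
  have i1 := integrable_trig (theta' + theta) (fun j => c' j + c j) mW WM.
  have i2 := integrable_trig (theta' - theta) (fun j => c' j - c j) mW WM.
  rewrite RintegralZl//; first by rewrite RintegralD// !W0 addr0 mulr0.
  rewrite (_ : _ \o _ = (fun x =>
    (H x * W x * cos ((theta' + theta) + phase (fun j => c' j + c j) x))%:E +
    (H x * W x * cos ((theta' - theta) + phase (fun j => c' j - c j) x))%:E)%E)//.
  exact: integrableD.
move=> x _; rewrite phD phB.
have -> : theta' + theta + (phase c' x + phase c x) =
  (theta' + phase c' x) + (theta + phase c x) by ring.
have -> : theta' - theta + (phase c' x - phase c x) =
  (theta' + phase c' x) - (theta + phase c x) by ring.
move: (theta' + phase c' x) (theta + phase c x) => a b.
by rewrite cosD cosB; field.
Qed.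

(** The interval is cut out by the nonnegativity of a cosine at all dyadic scales, and
    multset_gt_half applies to the sets where one of these cosines is negative. *)
Lemma multset_ball j (y r : R) : 0 < r -> multset [set x | `|tau j x - y| <= r].
Proof.
move=> r0; pose eta := pi / (2 * r).
have p0 := pi_gt0 R.
have e0 : 0 < eta by rewrite divr_gt0// mulr_gt0.
have -> : [set x | `|tau j x - y| <= r] =
  \bigcap_k ~` [set x | 1 / 2 < (1 - cos (2^-1 ^+ k * (eta * (tau j x - y)))) / 2].
  apply/seteqP; split => x /=.
    move=> xr k _ /=; apply/negP; rewrite -leNgt.
    suff : 0 <= cos (2^-1 ^+ k * (eta * (tau j x - y))) by lra.
    apply: (cos_dyadic_ge0 _).2; rewrite normrM gtr0_norm//.
    have -> : pi / 2 = eta * r by rewrite /eta; field; rewrite gt_eqF.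
    by rewrite ler_pM2l.
  move=> h; suff : `|eta * (tau j x - y)| <= pi / 2.
    have -> : pi / 2 = eta * r by rewrite /eta; field; rewrite gt_eqF.
    by rewrite normrM gtr0_norm// ler_pM2l.
  apply: (cos_dyadic_ge0 _).1 => k.
  by have /negP := h k I; rewrite -leNgt; lra.
apply: multset_bigcap => k; apply: multsetC; apply: multset_gt_half.
  by move=> x; have := cos_le1 (2^-1 ^+ k * (eta * (tau j x - y)));
    have := cos_geN1 (2^-1 ^+ k * (eta * (tau j x - y))); lra.
have -> : (fun x => (1 - cos (2^-1 ^+ k * (eta * (tau j x - y)))) / 2) =
  (fun x => (1 - cos (- (2^-1 ^+ k * eta * y) +
     phase (fun i => if i == j then 2^-1 ^+ k * eta else 0) x)) * 2^-1).
  apply/funext => x; congr ((1 - cos _) * _).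
  rewrite /phase (bigD1 j)//= eqxx big1; first by ring.
  by move=> i /negbTE ->; rewrite mul0r.
apply: multiplierM; last exact: multiplier_cst.
by apply: multiplierC; exact: multiplier_cos.
Qed.

Lemma multset_preimage j (B : set (measurableTypeR R)) : measurable B ->
  multset (tau j @^-1` B).
Proof.
rewrite [measurable]RGenOInfty.measurableE.
apply: (@smallest_sub _ _ _ (fun B => multset (tau j @^-1` B))).
  split.
  - by rewrite preimage_set0; exact: multset0.
  - by move=> A hA; rewrite setTD preimage_setC; exact: multsetC.
  - by move=> A hA; rewrite preimage_bigcup; exact: multset_bigcup.
move=> _ [a ->].
(* a half-line is a countable union of compact intervals *)
have -> : tau j @^-1` `]a, +oo[ = \bigcup_k
    [set x | `|tau j x - (a + k.+1%:R^-1 + k.+1%:R)| <= k.+1%:R].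
  apply/seteqP; split => x /=.
    rewrite in_itv /= andbT -subr_gt0 => z0.
    exists (Num.bound ((tau j x - a)^-1 + (tau j x - a))) => //=.
    have : (tau j x - a)^-1 + (tau j x - a) <
        (Num.bound ((tau j x - a)^-1 + (tau j x - a)))%:R.
      by apply: archi_boundP; rewrite addr_ge0 ?invr_ge0 ?ltW.
    move: (Num.bound _) => k hk.
    have zi : 0 < (tau j x - a)^-1 by rewrite invr_gt0.
    have k1 : k%:R <= k.+1%:R :> R by rewrite ler_nat.
    have k0 : 0 < k.+1%:R :> R by rewrite ltr0n.
    have k2 : k.+1%:R^-1 <= tau j x - a by rewrite invf_ple ?posrE//; lra.
    have k3 : 0 < k.+1%:R^-1 :> R by rewrite invr_gt0.
    rewrite ler_norml; move: k3 k2 k0 k1 hk zi z0.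
    move: (k.+1%:R^-1 : R) => K'; move: (k.+1%:R : R) => K; move: (k%:R : R) => k'.
    by move: (tau j x - a)^-1 => vi *; lra.
  move=> [k _ /=]; rewrite ler_norml in_itv /= andbT => h.
  have : 0 < k.+1%:R^-1 :> R by rewrite invr_gt0 ltr0n.
  move: h; move: (k.+1%:R^-1 : R) => K'; move: (k.+1%:R : R) => K h k0.
  lra.
by apply: multset_bigcup => k; apply: multset_ball; rewrite ltr0n.
Qed.

End fourier_uniqueness.

(** The sets whose indicator is a multiplier form a sigma-algebra containing the
    generators of the Borel sets, so H has integral 0 over every Borel set. *)
Theorem fourier_injective {R : realType} n (H : Rspace R n -> R) :
  (lebesgue n).-integrable setT (EFin \o H) ->
  (forall theta (c : 'I_n -> R),
    \int[lebesgue n]_x (H x * cos (theta + \sum_(j < n) c j * tnth x j)) = 0) ->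
  ae_eq (lebesgue n) setT H (cst 0).
Proof.
move=> iH H0.
have m1 : trig_null (lebesgue n) (fun j x => tnth x j) H (fun=> 1).
  split => //; first by exists 1 => x; rewrite normr1.
  by move=> theta c; rewrite -[RHS](H0 theta c); apply: eq_Rintegral => x _; rewrite mulr1.
have mset A : measurable A -> multset (lebesgue n) (fun j x => tnth x j) H A.
  apply: (@smallest_sub _ _ _ (multset (lebesgue n) (fun j x => tnth x j) H)).
    by apply: multset_sigma_algebra => // j; exact: measurable_tnth.
  elim/big_ind: _ => [_ []|A1 A2 h1 h2 B [/h1|/h2]//|j _ _ [B mB <-]].
  by rewrite setTI; apply: multset_preimage => // i; exact: measurable_tnth.
have : ae_eq (lebesgue n) setT (EFin \o H) (cst 0%E).
  apply: integral_ae_eq => // A _ mA.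
  have := integral_multiplier m1 (mset A mA).
  rewrite (@eq_Rintegral _ _ _ _ _ (H \_ A)); last first.
    move=> x _; rewrite indicE patchE; case: ifPn => _; by rewrite ?mulr1 ?mulr0.
  rewrite -Rintegral_mkcond integral0 => e.
  rewrite -[LHS]fineK; first exact: congr1 e.
  by apply: integrable_fin_num => //; exact: integrableS iH.
by apply: filterS => x /= h _; have := h I => -[].
Qed.

(** * Hardy's theorem along a line *)

Section real_fubini.
Context d1 d2 (T1 : measurableType d1) (T2 : measurableType d2) (R : realType).
Variable m1 : {sigma_finite_measure set T1 -> \bar R}.
Variable m2 : {sigma_finite_measure set T2 -> \bar R}.

Lemma integrable_tensor (u : T1 -> R) (v : T2 -> R) :
  m1.-integrable setT (EFin \o u) -> m2.-integrable setT (EFin \o v) ->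
  (m1 \x m2)%E.-integrable setT (EFin \o (fun z => u z.1 * v z.2)).
Proof.
move=> iu iv.
have mu : measurable_fun setT u by apply/measurable_EFinP; case/integrableP: iu.
have mv : measurable_fun setT v by apply/measurable_EFinP; case/integrableP: iv.
apply/integrable12ltyP.
  apply/measurable_EFinP; apply: measurable_funM.
    exact: (measurableT_comp mu measurable_fst).
  exact: (measurableT_comp mv measurable_snd).
pose V := (\int[m2]_y `|(v y)%:E|)%E.
have Vy : (V < +oo)%E by case/integrableP: iv.
have V0 : (0 <= V)%E by exact: integral_ge0.
have mav : measurable_fun setT (fun y => `|(v y)%:E|%E).
  by apply: measurableT_comp => //; exact/measurable_EFinP.
have mau : measurable_fun setT (fun x => `|(u x)%:E|%E).
  by apply: measurableT_comp => //; exact/measurable_EFinP.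
rewrite (@eq_integral _ _ _ _ _ (fun x => `|(u x)%:E| * V)%E).
  rewrite ge0_integralZr// lte_mul_pinfty//.
  - exact: integral_ge0.
  - by rewrite ge0_fin_numE; [case/integrableP: iu|exact: integral_ge0].
move=> x _; rewrite -ge0_integralZl//.
by apply: eq_integral => y _; rewrite /= normrM EFinM.
Qed.

(** Fubini's theorem for real-valued integrals, for functions dominated by a
    tensor product, so that every section is integrable. *)
Lemma Rintegral_fubini (f : T1 * T2 -> R) (u : T1 -> R) (v : T2 -> R) :
  measurable_fun setT f ->
  m1.-integrable setT (EFin \o u) -> m2.-integrable setT (EFin \o v) ->
  (forall x y, `|f (x, y)| <= u x * v y) ->
  [/\ (m1 \x m2)%E.-integrable setT (EFin \o f),
   \int[m1]_x \int[m2]_y f (x, y) = \int[(m1 \x m2)%E]_z f z &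
   \int[m2]_y \int[m1]_x f (x, y) = \int[(m1 \x m2)%E]_z f z].
Proof.
move=> mf iu iv fuv.
have iF : (m1 \x m2)%E.-integrable setT (EFin \o f).
  by apply: (integrable_dominated mf (integrable_tensor iu iv)) => -[x y]; exact: fuv.
have s1 x : m2.-integrable setT (EFin \o (fun y => f (x, y))).
  apply: (@integrable_dominated _ _ _ _ _ (fun y => u x * v y)) => //.
    exact: (measurableT_comp mf (measurable_pair1 x)).
  exact: integrable_scale.
have s2 y : m1.-integrable setT (EFin \o (fun x => f (x, y))).
  apply: (@integrable_dominated _ _ _ _ _ (fun x => v y * u x)) => //.
  - exact: (measurableT_comp mf (measurable_pair2 y)).
  - exact: integrable_scale.
  - by move=> x; rewrite mulrC.
split => //; rewrite /Rintegral; congr fine.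
  rewrite -(integral12_prod_meas1 iF); apply: eq_integral => x _.
  by rewrite fineK//; exact: (integrable_fin_num measurableT (s1 x)).
rewrite -(integral21_prod_meas1 iF); apply: eq_integral => y _.
by rewrite fineK//; exact: (integrable_fin_num measurableT (s2 y)).
Qed.

End real_fubini.

Lemma cos_lipschitz {R : realType} (a b : R) : `|cos a - cos b| <= 3 * `|a - b|.
Proof.
have e : expi a - expi b = expi b * (expi (a - b) - 1).
  by rewrite mulrBr mulr1 -expiD; congr (expi _ - _); ring.
have -> : cos a - cos b = complex.Re (expi a - expi b) by rewrite !ReImE.
by rewrite (le_trans (Re_le_cnorm _))// e cnormM cnorm_expi mul1r cnorm_expi_sub1.
Qed.

Lemma continuous_ae0 {R : realType} (f : R -> R) : continuous f ->
  ae_eq (@lebesgue_measure R) setT f (cst 0) -> forall y, f y = 0.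
Proof.
move=> cf [N [mN N0 fN]] y; apply: contrapT => fy.
have fy0 : 0 < `|f y| by rewrite normr_gt0; exact/eqP.
have /nbhs_ballP[e /= e0 eN] : nbhs y [set z | `|f z| > 0].
  exact: (cvgr_gt _ (cvg_norm (cf y)) _ fy0).
have sub : `]y - e, y + e[ `<=` N.
  move=> z; rewrite /= in_itv /= => ze; apply: fN => /= /(_ I) fz.
  have : ball y e z by rewrite /ball /= ltr_distlC.
  by move=> /eN /=; rewrite fz normr0 ltxx.
have mI : measurable (`]y - e, y + e[%classic : set (measurableTypeR R)).
  exact: measurable_itv.
have : @lebesgue_measure R `]y - e, y + e[%classic = 0%E.
  exact: subset_measure0 mI mN sub N0.
rewrite lebesgue_measure_itv /= lte_fin ifT; last by lra.
by rewrite -EFinD => -[]; lra.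
Qed.

Section hardy_line.
Context d {T : measurableType d} {R : realType}.
Variable mu : {sigma_finite_measure set T -> \bar R}.
Variables H t : T -> R.
Hypotheses (mH : measurable_fun setT H) (mt : measurable_fun setT t).
Variables (C : R) (m : nat).
Hypothesis Hint : forall k : R, 0 < k <= 1 ->
  mu.-integrable setT (EFin \o (fun x => `|H x| * expR ((1 - k) * (t x ^+ 2 / 4)))).
Hypothesis Hbound : forall k : R, 0 < k <= 1 ->
  \int[mu]_x (`|H x| * expR ((1 - k) * (t x ^+ 2 / 4))) <= C / k ^+ m.

Definition cos_transform (y : R) := \int[mu]_x (H x * cos (y * t x)).
Local Notation psi := cos_transform.

Variable C' : R.
Hypothesis psi_le : forall y, `|psi y| <= C' * expR (- y ^+ 2).
Hypothesis H0 : \int[mu]_x H x = 0.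

Local Notation leb := (@lebesgue_measure R).

Let iabsH : mu.-integrable setT (EFin \o (fun x => `|H x|)).
Proof.
have := @Hint 1; rewrite ltr01 lexx => /(_ isT).
by under eq_fun do rewrite subrr mul0r expR0 mulr1.
Qed.

Let iH : mu.-integrable setT (EFin \o H).
Proof. exact: (integrable_dominated mH iabsH). Qed.

Let mcos y : measurable_fun setT (fun x => cos (y * t x)).
Proof. by apply: measurable_cosT; exact: measurable_funM. Qed.

Let iHcos y : mu.-integrable setT (EFin \o (fun x => H x * cos (y * t x))).
Proof.
apply: (integrable_dominated _ iabsH) => [|x]; first exact: measurable_funM.
by rewrite normrM ler_piMr// cos_normr_le1.
Qed.

Let iHt : mu.-integrable setT (EFin \o (fun x => `|H x| * `|t x|)).
Proof.
have k2 : 0 < (1 / 2 : R) <= 1 by lra.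
apply: (@integrable_dominated _ _ _ _ _
  (fun x => 8 * (`|H x| * expR ((1 - 1 / 2) * (t x ^+ 2 / 4))))).
- by apply: measurable_funM; exact: measurableT_comp.
- by apply: integrable_scale; exact: Hint.
move=> x; rewrite normrM !normr_id mulrCA ler_wpM2l//.
have := expR_ge1Dx ((1 - 1 / 2) * (t x ^+ 2 / 4)).
rewrite -(real_normK (num_real (t x))).
have := sqr_ge0 (`|t x| - 1); have := normr_ge0 (t x); nra.
Qed.

Lemma continuous_cos_transform : continuous psi.
Proof.
pose L := 3 * \int[mu]_x (`|H x| * `|t x|).
have L0 : 0 <= L by rewrite mulr_ge0// Rintegral_ge0// => x _; rewrite mulr_ge0.
apply: (lipschitz_continuous L0) => y z.
rewrite /cos_transform -RintegralB//.
have iB : mu.-integrable setT (EFin \o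
    (fun x => H x * cos (y * t x) - H x * cos (z * t x))).
  rewrite (_ : _ \o _ = (fun x => (H x * cos (y * t x))%:E - (H x * cos (z * t x))%:E)%E)//.
  by apply: (integrableB _ (iHcos y) (iHcos z)).
apply: (le_trans (le_normr_Rintegral measurableT iB)).
have -> : L * `|y - z| = \int[mu]_x ((3 * `|y - z|) * (`|H x| * `|t x|)).
  by rewrite RintegralZl// /L; ring.
apply: le_Rintegral => //.
- exact: (integrable_norm iB).
- exact: integrable_scale.
move=> x _; rewrite -mulrBr normrM.
have := cos_lipschitz (y * t x) (z * t x).
rewrite -mulrBl normrM => /(ler_wpM2l (normr_ge0 (H x))); lra.
Qed.

Let mpsi : measurable_fun (setT : set (measurableTypeR R)) psi.
Proof. by apply: continuous_measurable_fun; exact: continuous_cos_transform. Qed.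

Let C'0 : 0 <= C'.
Proof.
have := le_trans (normr_ge0 _) (psi_le 0).
by rewrite expr0n /= oppr0 expR0 mulr1.
Qed.

(** The data of f1 live on the Fourier side and those of f2 on the physical side; the
    factors e^{y^2} and e^{t^2/4} cancel the Gaussian weights at s = 1. *)
Let w1 (y : measurableTypeR R) : R := psi y * expR (y ^+ 2).
Let w2 x := H x * expR (t x ^+ 2 / 4).
Let tau2 x := t x ^+ 2 / 4.
Let sq (y : measurableTypeR R) : R := y ^+ 2.
Let f1 := gtransform leb w1 sq.
Let f2 s := pi%:C * gtransform mu w2 tau2 s.

Let msq : measurable_fun setT sq.
Proof. exact: measurable_funX. Qed.

Let mw1 : measurable_fun setT w1.
Proof. by apply: measurable_funM => //; apply: measurable_expRT; exact: msq. Qed.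

Let mtau2 : measurable_fun setT tau2.
Proof. by apply: measurable_funM => //; exact: measurable_funX. Qed.

Let mw2 : measurable_fun setT w2.
Proof. by apply: measurable_funM => //; exact: measurable_expRT. Qed.

Let w1_le y : `|w1 y| <= C'.
Proof.
rewrite /w1 normrM (ger0_norm (expR_ge0 _)).
apply: (le_trans (ler_wpM2r (expR_ge0 _) (psi_le y))).
by rewrite -mulrA -expRD addNr expR0 mulr1.
Qed.

Let w1int_all (k : R) : 0 < k ->
  leb.-integrable setT (EFin \o (fun y => `|w1 y| * expR (- k * sq y))) /\
  \int[leb]_y (`|w1 y| * expR (- k * sq y)) <= C' * Num.sqrt (pi / k).
Proof.
move=> k0.
have ig : leb.-integrable setT (EFin \o (fun y => C' * expR (- k * (y - 0) ^+ 2))).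
  by apply: integrable_scale; exact: integrable_gauss.
have i1 : leb.-integrable setT (EFin \o (fun y => `|w1 y| * expR (- k * sq y))).
  apply: (integrable_dominated _ ig).
    apply: measurable_funM; first exact: measurableT_comp.
    by apply: measurable_expRT; exact: measurable_funM.
  move=> y; rewrite normrM normr_id (ger0_norm (expR_ge0 _)) subr0.
  by rewrite ler_wpM2r ?expR_ge0.
split => //.
rewrite -(@integral_gauss _ k 0)// -RintegralZl//; last exact: integrable_gauss.
by apply: le_Rintegral => // y _; rewrite subr0 ler_wpM2r ?expR_ge0.
Qed.

Let w1bound (k : R) : 0 < k <= 1 ->
  \int[leb]_y (`|w1 y| * expR (- k * sq y)) <= (C' * pi) / k ^+ 1.
Proof.
move=> /andP[k0 k1]; apply: (le_trans (w1int_all k0).2).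
rewrite expr1 -mulrA ler_wpM2l//.
have p1 : 1 <= pi / k.
  by rewrite ler_pdivlMr// mul1r (le_trans k1)//; have := pi_ge2 R; lra.
have p0 : 0 <= pi / k by lra.
have h : pi / k <= (pi / k) ^+ 2 by rewrite expr2 ler_peMl.
by apply: (le_trans (ler_wsqrtr h)); rewrite sqrtr_sqr ger0_norm.
Qed.

Let w2E (k : R) x : `|w2 x| * expR (- k * tau2 x) =
  `|H x| * expR ((1 - k) * (t x ^+ 2 / 4)).
Proof.
rewrite /w2 normrM (ger0_norm (expR_ge0 _)) -mulrA -expRD /tau2.
by congr (_ * expR _); ring.
Qed.

Let w1int (k : R) : 0 < k <= 1 ->
  leb.-integrable setT (EFin \o (fun y => `|w1 y| * expR (- k * sq y))).
Proof. by case/andP => k0 _; exact: (w1int_all k0).1. Qed.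

Let w2int (k : R) : 0 < k <= 1 ->
  mu.-integrable setT (EFin \o (fun x => `|w2 x| * expR (- k * tau2 x))).
Proof. by move=> k01; under eq_fun do rewrite w2E; exact: Hint. Qed.

Let w2bound (k : R) : 0 < k <= 1 ->
  \int[mu]_x (`|w2 x| * expR (- k * tau2 x)) <= C / k ^+ m.
Proof. by move=> k01; under eq_Rintegral do rewrite w2E; exact: Hbound. Qed.

Let sq_ge0 y : 0 <= sq y. Proof. exact: sqr_ge0. Qed.

Let tau2_ge0 x : 0 <= tau2 x. Proof. by rewrite divr_ge0// sqr_ge0. Qed.

(** Fubini's theorem, with the Fourier transform of the Gaussian as inner integral. *)
Let parseval (l : R) : 0 < l ->
  \int[leb]_y (psi y * expR (- l * y ^+ 2)) =
  Num.sqrt (pi / l) * \int[mu]_x (H x * expR (- (t x ^+ 2 / (4 * l)))).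
Proof.
move=> l0.
pose f (z : T * measurableTypeR R) := H z.1 * cos (z.2 * t z.1) * expR (- l * z.2 ^+ 2).
have mf : measurable_fun setT f.
  have m1 : measurable_fun setT (fun z : T * measurableTypeR R => z.2) := measurable_snd.
  apply: measurable_funM; first apply: measurable_funM.
  - exact: (measurableT_comp mH measurable_fst).
  - apply: measurable_cosT; apply: measurable_funM => //.
    exact: (measurableT_comp mt measurable_fst).
  - apply: measurable_expRT; apply: measurable_funM => //; exact: measurable_funX.
have fle x y : `|f (x, y)| <= `|H x| * expR (- l * (y - 0) ^+ 2).
  rewrite /f !normrM (ger0_norm (expR_ge0 _)) subr0 ler_wpM2r ?expR_ge0//.
  by rewrite ler_piMr// cos_normr_le1.
have [_ e1 e2] := Rintegral_fubini mf iabsH (integrable_gauss 0 l0) fle.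
transitivity (\int[leb]_y \int[mu]_x f (x, y)).
  by apply: eq_Rintegral => y _; rewrite /f /= RintegralZr.
rewrite e2 -e1 mulrC -RintegralZr; last 2 first.
- by [].
- apply: (integrable_dominated _ iabsH) => [|x].
    apply: measurable_funM => //; apply: measurable_expRT.
    by apply: measurableT_comp => //; apply: measurable_funM => //; exact: measurable_funX.
  rewrite normrM (ger0_norm (expR_ge0 _)) ler_piMr// expR_le1 oppr_le0.
  by rewrite divr_ge0 ?sqr_ge0// mulr_ge0// ltW.
apply: eq_Rintegral => x _; rewrite /f /=.
have -> : (fun y => H x * cos (y * t x) * expR (- l * y ^+ 2)) =
    (fun y => H x * (expR (- l * y ^+ 2) * cos (0 + t x * y))).
  by apply/funext => y; rewrite add0r (mulrC y); ring.
rewrite RintegralZl//; last first.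
  apply: integrable_gauss_mul => // [|y]; last exact: cos_normr_le1.
  by apply: measurable_cosT; apply: measurable_funD => //; exact: measurable_funM.
by rewrite fourier_gauss// cos0; ring.
Qed.

(** With l = 1/x - 1 in Parseval's formula, y^2 - y^2/x = - l y^2 and
    t^2/4 - t^2/(4(1 - x)) = - t^2/(4l). *)
Let transforms_match (x : R) : 0 < x < 1 -> f1 x%:C = f2 (1 - x)%:C.
Proof.
move=> /andP[x0 x1].
have x10 : 0 < 1 - x by rewrite subr_gt0.
have l0 : 0 < x^-1 - 1 by rewrite subr_gt0 invf_gt1.
rewrite /f1 /f2 /gtransform -!fmorphV !laplace_real -!rmorphXn -!rmorphM.
congr (_%:C).
have -> : \int[leb]_y (w1 y * expR (- x^-1 * sq y)) =
    \int[leb]_y (psi y * expR (- (x^-1 - 1) * y ^+ 2)).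
  apply: eq_Rintegral => y _; rewrite /w1 /sq -mulrA -expRD.
  by congr (_ * expR _); ring.
have -> : \int[mu]_y (w2 y * expR (- (1 - x)^-1 * tau2 y)) =
    \int[mu]_y (H y * expR (- (t y ^+ 2 / (4 * (x^-1 - 1))))).
  apply: eq_Rintegral => y _; rewrite /w2 /tau2 -mulrA -expRD.
  congr (_ * expR _); field.
  by rewrite !gt_eqF //; lra.
rewrite parseval// exprMn sqr_sqrtr; last by rewrite divr_ge0 ?pi_ge0// ltW.
by field; rewrite !gt_eqF.
Qed.

Let hol_f1 delta B : 0 < delta -> hol (half_disc delta B) f1.
Proof. exact: (hol_gtransform mw1 msq sq_ge0 w1int). Qed.

Let hol_f2 delta B : 0 < delta -> hol (half_disc delta B) f2.
Proof.
move=> d0; apply: holM; first exact: hol_cst.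
exact: (hol_gtransform mw2 mtau2 tau2_ge0 w2int).
Qed.

Let growth_f1 delta : 0 < delta -> poly_growth [set z | delta <= complex.Re z] f1.
Proof. exact: (growth_gtransform mw1 msq sq_ge0 w1int w1bound). Qed.

Let growth_f2 delta : 0 < delta -> poly_growth [set z | delta <= complex.Re z] f2.
Proof.
move=> d0; have [k [B B0 h]] := growth_gtransform mw2 mtau2 tau2_ge0 w2int w2bound d0.
exists k, (pi * B) => [|z zd]; first by rewrite mulr_ge0// pi_ge0.
by rewrite /f2 cnormM cnormR ger0_norm ?pi_ge0// -mulrA ler_wpM2l ?pi_ge0// h.
Qed.

(** As w1 is bounded, the square of its Gaussian integral is O(x), which the factor
    1/x compensates. *)
Let f1_bounded (x : R) : 1 <= x -> cnorm (f1 x%:C) <= C' ^+ 2 * pi.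
Proof.
move=> x1; have x0 : 0 < x by lra.
rewrite /f1 /gtransform -fmorphV laplace_real -rmorphXn -rmorphM cnormR.
have xi0 : 0 < x^-1 by rewrite invr_gt0.
have [i1 b1] := w1int_all xi0.
have h : `|\int[leb]_y (w1 y * expR (- x^-1 * sq y))| <= C' * Num.sqrt (pi / x^-1).
  have iw : leb.-integrable setT (EFin \o (fun y => w1 y * expR (- x^-1 * sq y))).
    apply: (integrable_dominated _ i1) => [|y].
      apply: measurable_funM => //; apply: measurable_expRT.
      exact: measurable_funM.
    by rewrite normrM (ger0_norm (expR_ge0 _)).
  apply: (le_trans (le_normr_Rintegral measurableT iw)).
  apply: le_trans b1; rewrite le_eqVlt; apply/orP; left; apply/eqP.
  by apply: eq_Rintegral => y _; rewrite normrM (ger0_norm (expR_ge0 _)).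
rewrite normrM normrX (gtr0_norm xi0).
have := lerXn2r 2 (normr_ge0 _) _ h.
move/(_ (le_trans (normr_ge0 _) h)) => {}h.
apply: (le_trans (ler_wpM2l (ltW xi0) h)).
rewrite exprMn sqr_sqrtr; last by rewrite divr_ge0 ?pi_ge0// ltW.
by rewrite le_eqVlt; apply/orP; left; apply/eqP; field; rewrite gt_eqF.
Qed.

Let f2_1 : f2 1 = 0.
Proof.
rewrite /f2 /gtransform -[1]/(1%:C) -fmorphV laplace_real.
have -> : \int[mu]_x (w2 x * expR (- 1^-1 * tau2 x)) = \int[mu]_x H x.
  apply: eq_Rintegral => x _; rewrite /w2 /tau2 -mulrA -expRD.
  by rewrite invr1 mulN1r subrr expR0 mulr1.
by rewrite H0 rmorph0 expr0n /= !mulr0.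
Qed.

Let laplace_psi0 p : 0 < complex.Re p -> laplace leb w1 sq p = 0.
Proof.
move=> p0; have pn0 : p != 0 by apply: contraTneq p0 => ->; rewrite ltxx.
have sp : 0 < complex.Re p^-1.
  by rewrite Re_inv divr_gt0// exprn_gt0// cnorm_gt0.
have := half_planes_liouville hol_f1 hol_f2 growth_f1 growth_f2
  transforms_match f1_bounded sp.
rewrite f2_1 /f1 /gtransform invrK => /eqP; rewrite mulf_eq0 (negbTE pn0) /=.
by rewrite expf_eq0 /= => /eqP.
Qed.

Let ipsi : leb.-integrable setT (EFin \o psi).
Proof.
have ig : leb.-integrable setT (EFin \o (fun y => C' * expR (- 1 * (y - 0) ^+ 2))).
  by apply: integrable_scale; exact: integrable_gauss.
by apply: (integrable_dominated mpsi ig) => y; rewrite subr0 mulN1r.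
Qed.

(** At p = 1 + i a, the vanishing of the Laplace transform is that of the integrals of
    psi against cos (a y^2) and sin (a y^2). *)
Let trig_null_psi : trig_null leb (fun _ : 'I_1 => sq) psi (fun=> 1).
Proof.
split => //; first by exists 1 => x; rewrite normr1.
move=> theta c; set a := c ord0.
have /laplace_psi0 h : 0 < complex.Re (1 +i* a : R[i]) by rewrite /= ltr01.
have e y : w1 y * expR (- 1 * sq y) = psi y.
  by rewrite /w1 /sq -mulrA -expRD mulN1r subrr expR0 mulr1.
have hc : \int[leb]_y (psi y * cos (a * sq y)) = 0.
  have := congr1 (@complex.Re R) h; rewrite Re_laplace [RHS]/= => <-.
  by apply: eq_Rintegral => y _; rewrite e.
have hs : \int[leb]_y (- (psi y * sin (a * sq y))) = 0.
  have := congr1 (@complex.Im R) h; rewrite Im_laplace [RHS]/= => <-.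
  by apply: eq_Rintegral => y _; rewrite e.
have masq : measurable_fun setT (fun y => a * sq y) by exact: measurable_funM.
have ic : leb.-integrable setT (EFin \o (fun y => psi y * cos (a * sq y))).
  apply: (integrable_dominated _ (integrable_norm ipsi)) => [|y].
    by apply: measurable_funM => //; exact: measurable_cosT.
  by rewrite normrM ler_piMr// cos_normr_le1.
have is' : leb.-integrable setT (EFin \o (fun y => - (psi y * sin (a * sq y)))).
  apply: (integrable_dominated _ (integrable_norm ipsi)) => [|y].
    apply: measurableT_comp => //.
    by apply: measurable_funM => //; exact: measurable_sinT.
  by rewrite normrN normrM ler_piMr// sin_normr_le1.
rewrite (@eq_Rintegral _ _ _ leb _ (fun y => cos theta * (psi y * cos (a * sq y)) +
    sin theta * (- (psi y * sin (a * sq y))))); last first.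
  by move=> y _; rewrite big_ord1 -/a cosD; ring.
rewrite (RintegralD measurableT (integrable_scale _ ic) (integrable_scale _ is')) !RintegralZl//.
by rewrite hc hs !mulr0 addr0.
Qed.

Let psi_even y : psi (Num.sqrt (sq y)) = psi y.
Proof.
rewrite /sq sqrtr_sqr; case: (ger0P y) => // _.
by apply: eq_Rintegral => x _; rewrite mulNr cosN.
Qed.

Let integral_psi_set (B : set (measurableTypeR R)) : measurable B ->
  \int[leb]_y (psi y * \1_([set y | B (psi y)]) y) = 0.
Proof.
move=> mB; apply: (integral_multiplier trig_null_psi).
have -> : [set y | B (psi y)] = sq @^-1` [set s | B (psi (Num.sqrt s))].
  by apply/seteqP; split => y /=; rewrite psi_even.
apply: (@multset_preimage _ _ _ _ _ (fun=> sq) _ _ ipsi ord0) => //.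
have ms : measurable_fun (setT : set (measurableTypeR R)) (fun s => psi (Num.sqrt s)).
  apply: continuous_measurable_fun => s; apply: continuous_comp; first exact: sqrt_continuous.
  exact: continuous_cos_transform.
by rewrite -[X in measurable X]setTI; exact: ms.
Qed.

(** Being even, psi is a function of y^2, and so are the indicators of the sets where
    it is positive and where it is negative; since psi is orthogonal to bounded
    Borel functions of y^2, its absolute value has integral 0. *)
Theorem hardy_line y : psi y = 0.
Proof.
apply: continuous_ae0; first exact: continuous_cos_transform.
have h : \int[leb]_y `|psi y| = 0.
  have m1 : measurable (`]0, +oo[%classic : set (measurableTypeR R)) by exact: measurable_itv.
  have m2 : measurable (`]-oo, 0[%classic : set (measurableTypeR R)) by exact: measurable_itv.
  have i0 (B : set (measurableTypeR R)) : measurable B -> leb.-integrable setT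
      (EFin \o (fun y => psi y * \1_([set y | B (psi y)]) y)).
    move=> mB; apply: (integrable_dominated _ (integrable_norm ipsi)) => [|x].
      apply: measurable_funM => //; apply: measurable_indic.
      by rewrite -[X in measurable X]setTI; exact: mpsi.
    rewrite normrM indicE /=; case: (x \in _); rewrite ?mulr1n ?mulr0n ?normr1 ?normr0;
      by rewrite ?mulr1 ?mulr0 ?lexx ?normr_ge0.
  rewrite (@eq_Rintegral _ _ _ leb _ (fun y =>
      psi y * \1_([set y | (`]0, +oo[%classic : set R) (psi y)]) y -
      psi y * \1_([set y | (`]-oo, 0[%classic : set R) (psi y)]) y)).
    by rewrite RintegralB ?integral_psi_set ?subrr//; exact: i0.
  move=> x _; rewrite !indicE.
  have -> : (x \in [set y | (`]0, +oo[%classic : set R) (psi y)]) = (0 < psi x).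
    by apply/idP/idP; rewrite inE /= in_itv /= andbT.
  have -> : (x \in [set y | (`]-oo, 0[%classic : set R) (psi y)]) = (psi x < 0).
    by apply/idP/idP; rewrite inE /= in_itv.
  case: (ltgtP (psi x) 0) => p0.
  - by rewrite ltr0_norm// mulr0 mulr1 sub0r.
  - by rewrite gtr0_norm// mulr0 mulr1 subr0.
  - by rewrite p0 normr0 !mul0r subrr.
have : (\int[leb]_y `|(EFin \o psi) y| = 0)%E.
  rewrite -[LHS]fineK; first exact: congr1 h.
  by apply: integrable_fin_num => //; exact: (integrable_norm ipsi).
have mp : measurable_fun (setT : set (measurableTypeR R)) (EFin \o psi).
  exact/measurable_EFinP.
move/(ae_eq_integral_abs leb measurableT mp).1.
by apply: filterS => x /= hx _; have := hx I => -[].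
Qed.

End hardy_line.

(** * Gaussians on the Euclidean space *)

Section gauss_space.
Context {R : realType}.

Lemma measurable_tnth_sum n (c : 'I_n -> R) :
  measurable_fun setT (fun x : Rspace R n => \sum_(j < n) c j * tnth x j).
Proof.
by apply: measurable_sum => j; apply: measurable_funM => //; exact: measurable_tnth.
Qed.

Lemma measurable_dot n : measurable_fun setT (fun x : Rspace R n => dot x x).
Proof.
by apply: measurable_sum => j; apply: measurable_funM; exact: measurable_tnth.
Qed.

Lemma dot_ge0 n (x : Rspace R n) : 0 <= dot x x.
Proof. by apply: sumr_ge0 => j _; rewrite -expr2 sqr_ge0. Qed.

Lemma lebesgueS_integral n (f : Rspace R n.+1 -> R) : measurable_fun setT f ->
  (lebesgue_measure \x lebesgue n)%E.-integrable setT (EFin \o (f \o @Rcons R n)) ->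
  (lebesgue n.+1).-integrable setT (EFin \o f) /\
  \int[lebesgue n.+1]_x f x =
  \int[(@lebesgue_measure R \x lebesgue n)%E]_z f (Rcons z).
Proof.
move=> mf iF; have mR := @measurable_Rcons R n.
have mEf : measurable_fun setT (EFin \o f) by exact/measurable_EFinP.
split.
  have := integrable_pushforward mR mEf iF measurableT.
  by move=> /integrableP h; apply/integrableP.
by rewrite /Rintegral; congr fine; exact: (integral_pushforward mR mEf iF measurableT).
Qed.

Lemma dot_Rcons n (z : measurableTypeR R * Rspace R n) :
  dot (Rcons z) (Rcons z) = z.1 ^+ 2 + dot z.2 z.2.
Proof.
by rewrite /dot big_ord_recl /= expr2; congr (_ + _); apply: eq_bigr => i _; rewrite !tnthS.
Qed.

(** Induction on the dimension by Fubini's theorem, whose use requires integrability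
    to be proved along with the formula. *)
Lemma gauss_space n (k : R) : 0 < k ->
  (lebesgue n).-integrable setT (EFin \o (fun x : Rspace R n => expR (- k * dot x x))) /\
  forall theta (c : 'I_n -> R),
  \int[lebesgue n]_x (expR (- k * dot x x) * cos (theta + \sum_(j < n) c j * tnth x j)) =
  Num.sqrt (pi / k) ^+ n * expR (- (\sum_(j < n) c j ^+ 2) / (4 * k)) * cos theta.
Proof.
move=> k0.
have mE m : measurable_fun setT (fun x : Rspace R m => expR (- k * dot x x)).
  by apply: measurable_expRT; apply: measurable_funM => //; exact: measurable_dot.
have mf m theta (c : 'I_m -> R) : measurable_fun setT (fun x : Rspace R m =>
    expR (- k * dot x x) * cos (theta + \sum_(j < m) c j * tnth x j)).
  apply: measurable_funM; first exact: mE.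
  apply: measurable_cosT.
  by apply: measurable_funD => //; exact: measurable_tnth_sum.
elim: n => [|n [IH1 IH2]].
  split.
    apply/integrableP; split; first by apply/measurable_EFinP; exact: mE.
    rewrite /= integral_dirac//=; first by rewrite diracT mul1e ltry.
    apply/measurable_EFinP; apply: measurableT_comp; [exact: normr_measurable|exact: mE].
  move=> theta c; rewrite /Rintegral /= integral_dirac//=; last first.
    by apply/measurable_EFinP; exact: mf.
  rewrite indicT mul1r /dot !big_ord0 mulr0 expR0 mul1r addr0.
  by rewrite expr0 oppr0 mul0r expR0 !mul1r.
have ig := integrable_gauss (0 : R) k0.
split.
  apply: (lebesgueS_integral _ _).1 => //.
  apply: (integrable_dominated _ (integrable_tensor ig IH1)) => [|z].
    exact: (measurableT_comp (mE _) (@measurable_Rcons R n)).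
  by rewrite /= dot_Rcons subr0 mulrDr expRD ger0_norm// mulr_ge0 ?expR_ge0.
move=> theta c.
pose f (x : Rspace R n.+1) := expR (- k * dot x x) *
  cos (theta + \sum_(j < n.+1) c j * tnth x j).
have fE a (x : Rspace R n) : f (Rcons (a, x)) = expR (- k * a ^+ 2) *
   (expR (- k * dot x x) * cos (theta + c ord0 * a +
     \sum_(j < n) c (lift ord0 j) * tnth x j)).
  rewrite /f dot_Rcons mulrDr expRD -mulrA big_ord_recl addrA; congr (_ * (_ * cos (_ + _))).
  by apply: eq_bigr => i _; rewrite tnthS.
have mfR : measurable_fun setT (f \o @Rcons R n).
  exact: (measurableT_comp (mf _ _ _) (@measurable_Rcons R n)).
have fle a x : `|(f \o @Rcons R n) (a, x)| <= expR (- k * (a - 0) ^+ 2) * expR (- k * dot x x).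
  rewrite /= fE subr0 normrM (ger0_norm (expR_ge0 _)) ler_wpM2l ?expR_ge0//.
  by rewrite normrM (ger0_norm (expR_ge0 _)) ler_piMr ?expR_ge0// cos_normr_le1.
have [iF e12 _] := Rintegral_fubini mfR ig IH1 fle.
rewrite (lebesgueS_integral (mf _ _ _) iF).2 -e12.
transitivity (\int[lebesgue_measure]_a (expR (- k * a ^+ 2) * cos (theta + c ord0 * a)) *
  (Num.sqrt (pi / k) ^+ n * expR (- (\sum_(j < n) c (lift ord0 j) ^+ 2) / (4 * k)))).
  rewrite -RintegralZr//; last first.
    apply: integrable_gauss_mul => // [|y]; last exact: cos_normr_le1.
    by apply: measurable_cosT; apply: measurable_funD => //; exact: measurable_funM.
  apply: eq_Rintegral => a _; rewrite /=.
  under eq_Rintegral do rewrite fE.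
  rewrite RintegralZl// ?IH2; first by ring.
  apply: (integrable_dominated _ IH1) => [|x]; first exact: mf.
  by rewrite normrM (ger0_norm (expR_ge0 _)) ler_piMr ?expR_ge0// cos_normr_le1.
rewrite fourier_gauss// (exprS _ n) big_ord_recl /=.
set X := \sum_(i < n) _.
have -> : expR (- (c ord0 ^+ 2 + X) / (4 * k)) =
  expR (- (c ord0 ^+ 2 / (4 * k))) * expR (- X / (4 * k)).
  by rewrite -expRD; congr expR; ring.
by ring.
Qed.

Lemma integrable_gauss_space n (k : R) : 0 < k ->
  (lebesgue n).-integrable setT (EFin \o (fun x : Rspace R n => expR (- k * dot x x))).
Proof. by move=> k0; exact: (gauss_space n k0).1. Qed.

Lemma fourier_gauss_space n (k theta : R) (c : 'I_n -> R) : 0 < k ->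
  \int[lebesgue n]_x (expR (- k * dot x x) * cos (theta + \sum_(j < n) c j * tnth x j)) =
  Num.sqrt (pi / k) ^+ n * expR (- (\sum_(j < n) c j ^+ 2) / (4 * k)) * cos theta.
Proof. by move=> k0; exact: (gauss_space n k0).2. Qed.

Lemma integral_gauss_space n (k : R) : 0 < k ->
  \int[lebesgue n]_x expR (- k * dot x x) = Num.sqrt (pi / k) ^+ n.
Proof.
move=> k0; have := @fourier_gauss_space n k 0 (fun=> 0) k0.
rewrite cos0 mulr1 big1 => [|j _]; last by rewrite expr0n.
rewrite oppr0 mul0r expR0 mulr1 => <-; apply: eq_Rintegral => x _.
by rewrite big1 ?addr0 ?cos0 ?mulr1// => j _; rewrite mul0r.
Qed.

End gauss_space.

(** * The critical case for Borel functions *)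

Section product_sigma_finite.
Context d1 d2 (T1 : measurableType d1) (T2 : measurableType d2) (R : realType).
Variables (m1 : {sigma_finite_measure set T1 -> \bar R})
  (m2 : {sigma_finite_measure set T2 -> \bar R}).

Lemma product_sigma_finite : sigma_finite setT (m1 \x m2)%E.
Proof.
have /sigma_finiteP[A [AT Amono Afin]] := sigma_finiteT m1.
have /sigma_finiteP[B [BT Bmono Bfin]] := sigma_finiteT m2.
exists (fun k => A k `*` B k) => [|k].
  apply/esym; rewrite -subTset => -[x y] _.
  have [i _ Ai] : (\bigcup_k A k) x by rewrite -AT.
  have [j _ Bj] : (\bigcup_k B k) y by rewrite -BT.
  exists (maxn i j) => //; split => /=.
    by move: Ai; exact/subsetPset/Amono/leq_maxl.
  by move: Bj; exact/subsetPset/Bmono/leq_maxr.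
have [mA Aoo] := Afin k; have [mB Boo] := Bfin k.
split; first exact: measurableX.
by rewrite product_measure1E// lte_mul_pinfty// ge0_fin_numE.
Qed.

Definition sigma_finite_product : {sigma_finite_measure set (T1 * T2)%type -> \bar R} :=
  HB.pack (m1 \x m2)%E
    (Measure_isSigmaFinite.Build _ _ _ (m1 \x m2)%E product_sigma_finite).

End product_sigma_finite.

Section hardy_critical.
Context {R : realType} {n : nat}.
Implicit Types (h : Rspace R n -> R) (c : 'I_n -> R).

Definition lin c (x : Rspace R n) : R := \sum_(j < n) c j * tnth x j.

Lemma linZ (s : R) c x : lin (fun j => s * c j) x = s * lin c x.
Proof. by rewrite /lin mulr_sumr; apply: eq_bigr => j _; rewrite mulrA. Qed.

Lemma measurable_lin c : measurable_fun setT (lin c).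
Proof. exact: measurable_tnth_sum. Qed.

(** Cauchy-Schwarz: expand the sum of the squares of |c|^2 x_j - (c.x) c_j. *)
Lemma lin_sqr_le c x : lin c x ^+ 2 <= (\sum_(j < n) c j ^+ 2) * dot x x.
Proof.
set S := \sum_(j < n) c j ^+ 2; set P := lin c x; set Z := dot x x.
have S0 : 0 <= S by apply: sumr_ge0 => j _; exact: sqr_ge0.
have : 0 <= \sum_(j < n) (S * tnth x j - P * c j) ^+ 2.
  by apply: sumr_ge0 => j _; exact: sqr_ge0.
have -> : \sum_(j < n) (S * tnth x j - P * c j) ^+ 2 = S * (S * Z - P ^+ 2).
  have -> : S * (S * Z - P ^+ 2) = S ^+ 2 * Z - 2 * S * P * P + P ^+ 2 * S by ring.
  have e1 : S ^+ 2 * Z = \sum_(j < n) S ^+ 2 * (tnth x j * tnth x j).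
    by rewrite -mulr_sumr.
  have e2 : 2 * S * P * P = \sum_(j < n) 2 * S * P * (c j * tnth x j).
    by rewrite -mulr_sumr.
  have e3 : P ^+ 2 * S = \sum_(j < n) P ^+ 2 * c j ^+ 2 by rewrite -mulr_sumr.
  rewrite e1 e2 e3 -sumrB -big_split /=.
  by apply: eq_bigr => j _; ring.
have [S00|Sn0] := eqVneq S 0; last first.
  by rewrite pmulr_rge0 ?lt_def ?Sn0// subr_ge0.
move=> _; have c0 j : c j = 0.
  have /eqP := S00; rewrite psumr_eq0 => [/allP h|i _]; last exact: sqr_ge0.
  by have := h j (mem_index_enum _); rewrite /= sqrf_eq0 => /eqP.
by rewrite /P /lin big1 => [|j _]; rewrite ?c0 ?mul0r// expr0n /= S00 mul0r.
Qed.

Section mean_zero.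
Variables (h : Rspace R n -> R) (a C : R).
Hypotheses (a0 : 0 < a) (mh : measurable_fun setT h).
Hypothesis h_le : forall x, `|h x| <= C * expR (- a * dot x x).

Let Fc c := \int[lebesgue n]_x (h x * cos (lin c x)).
Let Fs c := \int[lebesgue n]_x (h x * sin (lin c x)).

Hypothesis Fc_le : forall c, `|Fc c| <= C * expR (- (\sum_(j < n) c j ^+ 2) / (4 * a)).
Hypothesis Fs_le : forall c, `|Fs c| <= C * expR (- (\sum_(j < n) c j ^+ 2) / (4 * a)).
Hypothesis h_mean : \int[lebesgue n]_x h x = 0.

Let gaussC (k : R) : 0 < k ->
  (lebesgue n).-integrable setT (EFin \o (fun x : Rspace R n => C * expR (- k * dot x x))).
Proof.
by move=> k0; apply: integrable_scale; exact: integrable_gauss_space.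
Qed.

Let ih : (lebesgue n).-integrable setT (EFin \o h).
Proof. exact: (integrable_dominated mh (gaussC a0) h_le). Qed.

Let ihg (g : Rspace R n -> R) : measurable_fun setT g -> (forall x, `|g x| <= 1) ->
  (lebesgue n).-integrable setT (EFin \o (fun x => h x * g x)).
Proof.
move=> mg g1; apply: (integrable_dominated _ (integrable_norm ih)) => [|x].
  exact: measurable_funM.
by rewrite /= normrM ler_piMr.
Qed.

Let mcl c : measurable_fun setT (fun x => cos (lin c x)).
Proof. by apply: measurable_cosT; exact: measurable_lin. Qed.
Let msl c : measurable_fun setT (fun x => sin (lin c x)).
Proof. by apply: measurable_sinT; exact: measurable_lin. Qed.

Let C0 : 0 <= C.
Proof.
have := le_trans (normr_ge0 _) (Fc_le (fun=> 0)).
by rewrite pmulr_lge0// expR_gt0.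
Qed.

Local Notation mu2 := (@lebesgue R n \x @lebesgue R n)%E.
Let H (z : Rspace R n * Rspace R n) : R := h z.1 * h z.2.

Let mH : measurable_fun setT H.
Proof.
apply: measurable_funM; first exact: (measurableT_comp mh measurable_fst).
exact: (measurableT_comp mh measurable_snd).
Qed.

(** Tensoring h with itself turns its complex-valued Fourier transform into a single
    cosine transform, namely the squared modulus. *)
Let cos_transform_tensor c : \int[mu2]_z (H z * cos (lin c z.1 - lin c z.2)) =
  Fc c ^+ 2 + Fs c ^+ 2.
Proof.
pose f (z : Rspace R n * Rspace R n) : R := H z * cos (lin c z.1 - lin c z.2).
have mf : measurable_fun setT f.
  apply: measurable_funM; first exact: mH.
  apply: measurable_cosT; apply: measurable_funB.
    exact: (measurableT_comp (measurable_lin c) measurable_fst).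
  exact: (measurableT_comp (measurable_lin c) measurable_snd).
have fle x y : `|f (x, y)| <= `|h x| * `|h y|.
  by rewrite /f /H /= !normrM ler_piMr ?mulr_ge0// cos_normr_le1.
have [_ <- _] := Rintegral_fubini mf (integrable_norm ih) (integrable_norm ih) fle.
have ic := ihg (mcl c) (fun x => cos_normr_le1 (lin c x)).
have is' := ihg (msl c) (fun x => sin_normr_le1 (lin c x)).
transitivity (\int[lebesgue n]_x (Fc c * (h x * cos (lin c x)) +
    Fs c * (h x * sin (lin c x)))).
  apply: eq_Rintegral => x _.
  rewrite (@eq_Rintegral _ _ _ (lebesgue n) _ (fun y =>
    (h x * cos (lin c x)) * (h y * cos (lin c y)) +
    (h x * sin (lin c x)) * (h y * sin (lin c y)))); last first.
    by move=> y _; rewrite /f /H /= cosB; ring.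
  by rewrite (RintegralD measurableT (integrable_scale _ ic) (integrable_scale _ is')) !RintegralZl// mulrC
    [_ * Fs c]mulrC.
by rewrite (RintegralD measurableT (integrable_scale _ ic) (integrable_scale _ is')) !RintegralZl// !expr2.
Qed.

(** The scaling of c is the critical one: as t^2/4 <= a (|x|^2 + |x'|^2), the weight
    e^{t^2/4} exactly compensates the Gaussian decay of H, while the bound on the
    transform of h makes psi a O(e^{-y^2}). *)
Let fourier0_scaled c : \sum_(j < n) c j ^+ 2 = 2 * a ->
  forall y, Fc (fun j => y * c j) = 0 /\ Fs (fun j => y * c j) = 0.
Proof.
move=> c2 y.
pose t (z : Rspace R n * Rspace R n) : R := lin c z.1 - lin c z.2.
have mt : measurable_fun setT t.
  apply: measurable_funB.
    exact: (measurableT_comp (measurable_lin c) measurable_fst).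
  exact: (measurableT_comp (measurable_lin c) measurable_snd).
have t_le z : t z ^+ 2 / 4 <= a * (dot z.1 z.1 + dot z.2 z.2).
  have h1 := lin_sqr_le c z.1; have h2 := lin_sqr_le c z.2; rewrite c2 in h1 h2.
  have := sqr_ge0 (lin c z.1 + lin c z.2); rewrite /t; lra.
have H_le z (k : R) : 0 < k <= 1 -> `|H z| * expR ((1 - k) * (t z ^+ 2 / 4)) <=
    (C * expR (- (k * a) * dot z.1 z.1)) * (C * expR (- (k * a) * dot z.2 z.2)).
  move=> /andP[k0 k1].
  have h1 : `|H z| <= C * expR (- a * dot z.1 z.1) * (C * expR (- a * dot z.2 z.2)).
    by rewrite /H normrM ler_pM.
  have h2 : expR ((1 - k) * (t z ^+ 2 / 4)) <=
      expR ((1 - k) * (a * (dot z.1 z.1 + dot z.2 z.2))).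
    by rewrite ler_expR ler_wpM2l ?subr_ge0.
  apply: (le_trans (ler_pM (normr_ge0 _) (expR_ge0 _) h1 h2)).
  rewrite le_eqVlt; apply/orP; left; apply/eqP.
  have -> : C * expR (- a * dot z.1 z.1) * (C * expR (- a * dot z.2 z.2)) *
      expR ((1 - k) * (a * (dot z.1 z.1 + dot z.2 z.2))) =
    C * C * (expR (- a * dot z.1 z.1) * expR (- a * dot z.2 z.2) *
      expR ((1 - k) * (a * (dot z.1 z.1 + dot z.2 z.2)))) by ring.
  have -> : (C * expR (- (k * a) * dot z.1 z.1)) * (C * expR (- (k * a) * dot z.2 z.2)) =
    C * C * (expR (- (k * a) * dot z.1 z.1) * expR (- (k * a) * dot z.2 z.2)) by ring.
  by rewrite -!expRD; congr (_ * expR _); ring.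
have gk (k : R) : 0 < k <= 1 ->
    mu2.-integrable setT (EFin \o (fun z => (C * expR (- (k * a) * dot z.1 z.1)) *
      (C * expR (- (k * a) * dot z.2 z.2)))).
  move=> /andP[k0 _]; have ka : 0 < k * a by rewrite mulr_gt0.
  exact: (integrable_tensor (gaussC ka) (gaussC ka)).
have Hint (k : R) : 0 < k <= 1 ->
    mu2.-integrable setT (EFin \o (fun z => `|H z| * expR ((1 - k) * (t z ^+ 2 / 4)))).
  move=> k01; apply: (integrable_dominated _ (gk k k01)) => [|z].
    apply: measurable_funM; first exact: measurableT_comp.
    apply: measurable_expRT; apply: measurable_funM => //; apply: measurable_funM => //.
    exact: measurable_funX.
  by rewrite ger0_norm ?mulr_ge0 ?expR_ge0// H_le.
have Hbound (k : R) : 0 < k <= 1 ->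
    \int[mu2]_z (`|H z| * expR ((1 - k) * (t z ^+ 2 / 4))) <=
    (C ^+ 2 * (pi / a) ^+ n) / k ^+ n.
  move=> k01; have /andP[k0 k1] := k01.
  have ka : 0 < k * a by rewrite mulr_gt0.
  apply: (@le_trans _ _ (\int[mu2]_z ((C * expR (- (k * a) * dot z.1 z.1)) *
      (C * expR (- (k * a) * dot z.2 z.2))))).
    by apply: le_Rintegral => // [||z _]; [exact: Hint|exact: gk|exact: H_le].
  pose g (x : Rspace R n) := C * expR (- (k * a) * dot x x).
  have mg : measurable_fun setT (fun z : Rspace R n * Rspace R n => g z.1 * g z.2).
    by have /integrableP[/measurable_EFinP] := gk k k01.
  have gle x y' : `|(fun z : Rspace R n * Rspace R n => g z.1 * g z.2) (x, y')| <= g x * g y'.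
    by rewrite /= ger0_norm// /g !mulr_ge0 ?expR_ge0.
  have [_ <- _] := Rintegral_fubini mg (gaussC ka) (gaussC ka) gle.
  have ig : \int[lebesgue n]_x g x = C * Num.sqrt (pi / (k * a)) ^+ n.
    by rewrite /g RintegralZl ?integral_gauss_space//; exact: integrable_gauss_space.
  have -> : \int[lebesgue n]_x \int[lebesgue n]_x0 (g (x, x0).1 * g (x, x0).2) =
      \int[lebesgue n]_x (g x * (C * Num.sqrt (pi / (k * a)) ^+ n)).
    by apply: eq_Rintegral => x _ /=; rewrite RintegralZl ?ig//; exact: gaussC.
  rewrite RintegralZr ?ig//; last exact: gaussC.
  have p0 : 0 <= pi / (k * a) by rewrite divr_ge0 ?pi_ge0// ltW.
  have -> : C * Num.sqrt (pi / (k * a)) ^+ n * (C * Num.sqrt (pi / (k * a)) ^+ n) =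
    C ^+ 2 * (Num.sqrt (pi / (k * a)) ^+ 2) ^+ n by rewrite exprAC; ring.
  rewrite sqr_sqrtr// -mulrA; apply: ler_wpM2l; first exact: sqr_ge0.
  by rewrite -exprVn -exprMn invfM mulrA mulrAC.
pose nu := sigma_finite_product (@lebesgue R n) (@lebesgue R n).
have psiE s : cos_transform nu H t s = Fc (fun j => s * c j) ^+ 2 + Fs (fun j => s * c j) ^+ 2.
  rewrite -cos_transform_tensor; apply: eq_Rintegral => z _.
  by rewrite /t !linZ mulrBr.
have psi_le s : `|cos_transform nu H t s| <= (2 * C ^+ 2) * expR (- s ^+ 2).
  rewrite psiE ger0_norm ?addr_ge0 ?sqr_ge0//.
  have hE : expR (- (\sum_(j < n) (s * c j) ^+ 2) / (4 * a)) ^+ 2 = expR (- s ^+ 2).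
    under eq_bigr do rewrite exprMn; rewrite -mulr_sumr c2 expr2 -expRD.
    by congr expR; field; rewrite gt_eqF.
  have := lerXn2r 2 (normr_ge0 _) _ (Fc_le (fun j => s * c j)).
  have := lerXn2r 2 (normr_ge0 _) _ (Fs_le (fun j => s * c j)).
  rewrite !nnegrE ?mulr_ge0 ?expR_ge0// => /(_ isT) h1 /(_ isT) h2.
  move: h1 h2; rewrite !exprMn hE !real_normK ?num_real//; lra.
have H0 : \int[mu2]_z H z = 0.
  have hc0 : Fc (fun=> 0) = 0.
    rewrite -[RHS]h_mean; apply: eq_Rintegral => x _.
    by rewrite /lin big1 ?cos0 ?mulr1// => j _; rewrite mul0r.
  have hs0 : Fs (fun=> 0) = 0.
    rewrite /Fs (@eq_Rintegral _ _ _ _ _ (fun=> 0)) ?Rintegral_cst ?mul0r//.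
    by move=> x _; rewrite /lin big1 ?sin0 ?mulr0// => j _; rewrite mul0r.
  have := cos_transform_tensor (fun=> 0); rewrite hc0 hs0 !expr2 !mul0r addr0.
  apply: etrans.
  apply: eq_Rintegral => z _.
  by rewrite /lin !big1 ?subrr ?cos0 ?mulr1// => j _; rewrite mul0r.
have := @hardy_line _ _ _ nu H t mH mt _ _ Hint Hbound _ psi_le H0 y.
rewrite psiE => /eqP; rewrite paddr_eq0 ?sqr_ge0// !sqrf_eq0.
by move=> /andP[/eqP -> /eqP ->].
Qed.

(** Every nonzero frequency is proportional to one scaled as in fourier0_scaled. *)
Lemma hardy_mean_zero : ae_eq (lebesgue n) setT h (cst 0).
Proof.
have F0 c : Fc c = 0 /\ Fs c = 0.
  have [c0|cn0] := eqVneq (\sum_(j < n) c j ^+ 2) 0.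
    have cj j : c j = 0.
      have /eqP := c0; rewrite psumr_eq0 => [/allP hj|i _]; last exact: sqr_ge0.
      by have := hj j (mem_index_enum _); rewrite /= sqrf_eq0 => /eqP.
    have lin0 x : lin c x = 0 by rewrite /lin big1// => j _; rewrite cj mul0r.
    split.
      rewrite -[RHS]h_mean; apply: eq_Rintegral => x _.
      by rewrite lin0 cos0 mulr1.
    rewrite /Fs (@eq_Rintegral _ _ _ _ _ (fun=> 0)) ?Rintegral_cst ?mul0r//.
    by move=> x _; rewrite lin0 sin0 mulr0.
  have cp : 0 < \sum_(j < n) c j ^+ 2.
    by rewrite lt_def cn0 sumr_ge0// => j _; exact: sqr_ge0.
  pose s := Num.sqrt (2 * a / \sum_(j < n) c j ^+ 2).
  have s0 : 0 < s by rewrite sqrtr_gt0 divr_gt0// mulr_gt0.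
  have sc : \sum_(j < n) (s * c j) ^+ 2 = 2 * a.
    under eq_bigr do rewrite exprMn.
    rewrite -mulr_sumr sqr_sqrtr ?divr_ge0 ?mulr_ge0 ?(ltW a0) ?(ltW cp)//.
    by rewrite mulfVK.
  have := fourier0_scaled sc s^-1.
  have -> : (fun j => s^-1 * (s * c j)) = c; last by [].
  by apply/funext => j; rewrite mulKf// gt_eqF.
apply: fourier_injective => // theta c.
have [c1 s1] := F0 c.
have ic := ihg (mcl c) (fun x => cos_normr_le1 (lin c x)).
have is' := ihg (msl c) (fun x => sin_normr_le1 (lin c x)).
rewrite (@eq_Rintegral _ _ _ (lebesgue n) _ (fun x =>
  cos theta * (h x * cos (lin c x)) - sin theta * (h x * sin (lin c x)))); last first.
  by move=> x _; rewrite cosD -/(lin c x); ring.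
rewrite (RintegralB measurableT (integrable_scale _ ic) (integrable_scale _ is')) !RintegralZl//.
by rewrite -/(Fc c) -/(Fs c) c1 s1 !mulr0 subr0.
Qed.

End mean_zero.

(** Subtracting the multiple of the Gaussian with the same integral reduces to
    the mean zero case, since the Gaussian satisfies both bounds itself. *)
Theorem hardy_critical h (a C : R) : 0 < a -> measurable_fun setT h ->
  (forall x, `|h x| <= C * expR (- a * dot x x)) ->
  (forall c, `|\int[lebesgue n]_x (h x * cos (lin c x))| <=
    C * expR (- (\sum_(j < n) c j ^+ 2) / (4 * a))) ->
  (forall c, `|\int[lebesgue n]_x (h x * sin (lin c x))| <=
    C * expR (- (\sum_(j < n) c j ^+ 2) / (4 * a))) ->
  exists b : R, ae_eq (lebesgue n) setT h (fun x => b * expR (- a * dot x x)).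
Proof.
move=> a0 mh h_le Fc_le Fs_le.
pose g (x : Rspace R n) := expR (- a * dot x x).
have ig : (lebesgue n).-integrable setT (EFin \o g) by exact: integrable_gauss_space.
have ih : (lebesgue n).-integrable setT (EFin \o h).
  apply: (integrable_dominated mh _ h_le).
  exact: integrable_scale.
have mg : measurable_fun setT g by have /integrableP[/measurable_EFinP] := ig.
set G := Num.sqrt (pi / a) ^+ n.
have G0 : 0 < G by rewrite exprn_gt0// sqrtr_gt0 divr_gt0// pi_gt0.
pose c0 : R := (\int[lebesgue n]_x h x) / G; exists c0.
have gcos c : \int[lebesgue n]_x (g x * cos (lin c x)) =
    G * expR (- (\sum_(j < n) c j ^+ 2) / (4 * a)).
  have := @fourier_gauss_space R n a 0 c a0; rewrite cos0 mulr1 => <-.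
  by apply: eq_Rintegral => x _; rewrite add0r.
have gsin c : \int[lebesgue n]_x (g x * sin (lin c x)) = 0.
  have := @fourier_gauss_space R n a (- (pi / 2)) c a0.
  rewrite cosN cos_pihalf mulr0 => <-.
  by apply: eq_Rintegral => x _; rewrite addrC cosBpihalf.
have trig (f u : Rspace R n -> R) : (lebesgue n).-integrable setT (EFin \o f) ->
    measurable_fun setT u -> (forall x, `|u x| <= 1) ->
    (lebesgue n).-integrable setT (EFin \o (fun x => f x * u x)).
  move=> jf mu u1; apply: (integrable_dominated _ (integrable_norm jf)) => [|x].
    by apply: measurable_funM => //; have /integrableP[/measurable_EFinP] := jf.
  by rewrite /= normrM ler_piMr.
have sub (u : Rspace R n -> R) : measurable_fun setT u -> (forall x, `|u x| <= 1) ->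
    \int[lebesgue n]_x ((h x - c0 * g x) * u x) =
    \int[lebesgue n]_x (h x * u x) - c0 * \int[lebesgue n]_x (g x * u x).
  move=> mu u1.
  have igu := trig _ _ ig mu u1.
  have igz : (lebesgue n).-integrable setT (EFin \o (fun x => c0 * (g x * u x))).
    exact: integrable_scale.
  rewrite -(RintegralZl c0 measurableT igu) -(RintegralB measurableT (trig _ _ ih mu u1) igz).
  by apply: eq_Rintegral => x _; ring.
have mcos c : measurable_fun setT (fun x : Rspace R n => cos (lin c x)).
  by apply: measurable_cosT; exact: measurable_lin.
have msin c : measurable_fun setT (fun x : Rspace R n => sin (lin c x)).
  by apply: measurable_sinT; exact: measurable_lin.
pose D := C + `|c0| * (1 + G).
have c00 : 0 <= `|c0| := normr_ge0 c0.
have h0 : ae_eq (lebesgue n) setT (fun x => h x - c0 * g x) (cst 0).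
  apply: (@hardy_mean_zero _ a D) => //.
  - by apply: measurable_funB => //; exact: measurable_funM.
  - move=> x; apply: (le_trans (ler_normB _ _)).
    have e0 : 0 < g x by exact: expR_gt0.
    rewrite normrM (gtr0_norm e0) -/(g x) /D mulrDl lerD// ler_wpM2r ?(ltW e0)//.
    by rewrite ler_peMr// lerDl ltW.
  - move=> c; rewrite sub//; last by move=> x; exact: cos_normr_le1.
    apply: (le_trans (ler_normB _ _)); rewrite gcos.
    move: (Fc_le c) (expR_gt0 (- (\sum_(j < n) c j ^+ 2) / (4 * a))).
    move: (expR _) => E hE e0; rewrite /D mulrDl lerD// normrM.
    rewrite [X in _ * X]gtr0_norm ?mulr_gt0// mulrA ler_wpM2r ?(ltW e0)//.
    by rewrite ler_wpM2l// lerDr.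
  - move=> c; rewrite sub//; last by move=> x; exact: sin_normr_le1.
    rewrite gsin mulr0 subr0; apply: (le_trans (Fs_le c)).
    by rewrite ler_wpM2r ?expR_ge0// /D lerDl mulr_ge0// addr_ge0// ltW.
  rewrite (@eq_Rintegral _ _ _ (lebesgue n) _ (fun x => (h x - c0 * g x) * 1)); last first.
    by move=> x _; rewrite mulr1.
  rewrite (sub (fun=> 1))//; last by move=> _; rewrite normr1.
  rewrite (@eq_Rintegral _ _ _ (lebesgue n) _ h); last by move=> x _; rewrite mulr1.
  rewrite [X in _ - _ * X](@eq_Rintegral _ _ _ (lebesgue n) _ g); last first.
    by move=> x _; rewrite mulr1.
  by rewrite integral_gauss_space// /c0 -/G mulfVK ?subrr// gt_eqF.
by apply: filterS h0 => x + xT => /(_ xT) /eqP; rewrite subr_eq0 => /eqP.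
Qed.

End hardy_critical.

(** * Lebesgue measurability *)

Section null_modification.
Context d (T : measurableType d) (R : realType) (mu : {measure set T -> \bar R}).
Import HBNNSimple.

Let ge0_le_integral_null (N : set T) (f g : T -> \bar R) :
  measurable N -> mu N = 0%E ->
  (forall x, 0 <= f x)%E -> (forall x, 0 <= g x)%E ->
  (forall x, ~ N x -> f x = g x) ->
  (\int[mu]_x f x <= \int[mu]_x g x)%E.
Proof.
move=> mN N0 f0 g0 fg; rewrite !ge0_integralTE//.
apply: ge_ereal_sup => _ [s sf <-].
have mNC := measurableC mN.
pose s' := proj_nnsfun s mNC.
have s'E x : s' x = s x * \1_(~` N) x by [].
have -> : sintegral mu s = sintegral mu s'.
  have ms (u : {nnsfun T >-> R}) : measurable_fun setT (EFin \o u).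
    by exact/measurable_EFinP.
  have u0 (u : {nnsfun T >-> R}) x : setT x -> (0 <= (EFin \o u) x)%E.
    by move=> _; rewrite /= lee_fin.
  rewrite -!integralT_nnsfun.
  rewrite (ge0_negligible_integral mN measurableT (ms s) (@u0 s) N0).
  rewrite [RHS](ge0_negligible_integral mN measurableT (ms s') (@u0 s') N0).
  apply: eq_integral => x; rewrite inE => -[_ Nx].
  by rewrite -[RHS]/((s' x)%:E) s'E indicE mem_set// mulr1.
apply: ereal_sup_ubound; exists s' => // x.
rewrite s'E indicE; have [Nx|Nx] := pselect (N x).
  by rewrite memNset ?mulr0//= => /(_ Nx).
by rewrite mem_set// mulr1 -fg.
Qed.

(** The integral is defined for all functions, as a supremum over simple
    functions; a null set does not affect it even without measurability, since
    each simple function can be cut off there. *)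
Lemma integral_null (N : set T) (f g : T -> \bar R) :
  measurable N -> mu N = 0%E -> (forall x, ~ N x -> f x = g x) ->
  (\int[mu]_x f x = \int[mu]_x g x)%E.
Proof.
move=> mN N0 fg; rewrite integralE [RHS]integralE.
by congr (_ - _)%E; apply/eqP; rewrite eq_le; apply/andP; split;
  apply: (ge0_le_integral_null mN N0) => // x Nx; rewrite ?funeposE ?funenegE fg.
Qed.

End null_modification.

Section reductions.
Context {R : realType} {n : nat}.
Implicit Types (h : Rspace R n -> R) (P : set (Rspace R n)).

Lemma ae_null_set P : (\forall x \ae lebesgue n, P x) ->
  exists N, [/\ measurable N, lebesgue n N = 0%E & forall x, ~ N x -> P x].
Proof.
move=> [N [mN N0 PN]]; exists N; split => // x Nx.
by apply: contrapT => Px; apply: Nx; exact: PN.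
Qed.

(** Countably many thresholds suffice for measurability, so the null sets that
    correct the level sets of h add up to a null set. *)
Lemma borel_modification h : lebesgue_measurable_fun h ->
  exists N, [/\ measurable N, lebesgue n N = 0%E & measurable_fun (~` N) h].
Proof.
move=> mh; pose e k : rat := odflt 0 (unpickle k).
have /choice[B hB] k : exists B, measurable B /\ (lebesgue n).-negligible
    ((h @^-1` `]ratr (e k), +oo[ `\` B) `|` (B `\` h @^-1` `]ratr (e k), +oo[)).
  have [B mB NB] := mh `]ratr (e k), +oo[%classic (measurable_itv _).
  by exists B.
have [N [mN N0 BN]] := negligible_bigcup (fun k => (hB k).2).
exists N; split => // mNC.
apply: (measurability _ (RGenOInfty.measurableE R)) => // _ [_ [r ->] <-].
rewrite (_ : _ `&` _ = \bigcup_(k in [set k | r < ratr (e k)]) (~` N `&` B k)).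
  by apply: bigcup_measurable => k _; apply: measurableI;
    [exact: measurableC|exact: (hB k).1].
apply/seteqP; split => x /=.
  move=> [Nx]; rewrite in_itv /= andbT => /rat_in_itvoo[q].
  rewrite in_itv /= => /andP[rq qh].
  have eq : e (pickle q) = q by rewrite /e pickleK.
  exists (pickle q); rewrite /= ?eq//; split => //.
  apply: contrapT => Bx; apply: Nx; apply: BN; exists (pickle q) => //.
  by left; split => //=; rewrite eq in_itv /= qh.
move=> [k /= rk [Nx Bx]]; split => //; rewrite in_itv /= andbT.
apply: (lt_trans rk); apply: contrapT => hx; apply: Nx; apply: BN.
by exists k => //; right; split => //=; rewrite in_itv /= andbT.
Qed.

Definition cube (c : 'I_n -> R) (delta : R) : set (Rspace R n) :=
  [set x | forall i, c i <= tnth x i <= c i + delta].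

Lemma measurable_cube c delta : measurable (cube c delta).
Proof.
rewrite (_ : cube _ _ = \bigcap_(i in [set: 'I_n]) ((@tnth n _)^~ i @^-1`
    (`[c i, c i + delta]%classic : set (measurableTypeR R)))).
  apply: fin_bigcap_measurable => // i _; rewrite -[X in measurable X]setTI.
  by apply: measurable_tnth => //; exact: measurable_itv.
apply/seteqP; split => x /= hx i => [_|]; first by rewrite /= in_itv /= hx.
by have := hx i I; rewrite /= in_itv.
Qed.

Lemma lebesgue_cube_gt0 c delta : 0 < delta -> (0 < lebesgue n (cube c delta))%E.
Proof.
move=> d0; pose A i : set (measurableTypeR R) := `[c i, c i + delta]%classic.
have -> : cube c delta = [set x | forall i, A i (tnth x i)].
  by apply/seteqP; split => x /= hx i; have := hx i; rewrite /A /= in_itv.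
rewrite lebesgue_box => [|i]; last exact: measurable_itv.
rewrite (eq_bigr (fun=> delta%:E)) => [|i _]; last first.
  rewrite /A lebesgue_measure_itv /= lte_fin ltrDl d0.
  by rewrite -EFinB addrAC subrr add0r.
by rewrite prodEFin lte_fin prodr_gt0.
Qed.

Lemma ae_cube P c delta : 0 < delta -> (\forall x \ae lebesgue n, P x) ->
  exists x, P x /\ cube c delta x.
Proof.
move=> d0 /ae_null_set[N [mN N0 PN]]; apply: contrapT => no.
have := lebesgue_cube_gt0 c d0; rewrite (subset_measure0 (measurable_cube c delta) mN _ N0) ?ltxx//.
by move=> x cx; apply: contrapT => Nx; apply: no; exists x; split => //; exact: PN.
Qed.

Lemma Linfty_norm_lty (f : Rspace R n -> R[i]) : (Linfty_norm f < +oo)%E ->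
  exists M, \forall x \ae lebesgue n, cnorm (f x) <= M.
Proof.
rewrite /Linfty_norm unlock ifT; last first.
  apply: (lt_le_trans (@lebesgue_cube_gt0 (fun=> 0) 1 ltr01)).
  by apply: le_measure; rewrite ?inE//; exact: measurable_cube.
set g := (_ \o _); move=> goo.
have := @ess_sup_ge _ _ _ (lebesgue n) g.
move: goo; case: (ess_sup _ _) => [M|//|] _ hM; [exists M|exists 0].
  by apply: filterS hM => x; rewrite /g /= lee_fin; apply: le_trans; rewrite ler_norm.
by apply: filterS hM => x; rewrite /g /=.
Qed.

Section continuity.
Variables (h : Rspace R n -> R) (a C : R).
Hypotheses (a0 : 0 < a) (mh : measurable_fun setT h).
Hypothesis h_le : forall x, `|h x| <= C * expR (- a * dot x x).

Let F (theta : R) (c : 'I_n -> R) := \int[lebesgue n]_x (h x * cos (theta + lin c x)).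

Let gaussC (K k : R) : 0 < k ->
  (lebesgue n).-integrable setT (EFin \o (fun x : Rspace R n => K * expR (- k * dot x x))).
Proof.
by move=> k0; apply: integrable_scale; exact: integrable_gauss_space.
Qed.

Let iF theta c : (lebesgue n).-integrable setT
  (EFin \o (fun x => h x * cos (theta + lin c x))).
Proof.
apply: (integrable_dominated _ (gaussC C a0)) => [|x].
  apply: measurable_funM => //; apply: measurable_cosT.
  by apply: measurable_funD => //; exact: measurable_lin.
by rewrite (le_trans _ (h_le x))// normrM ler_piMr// cos_normr_le1.
Qed.

Let S (x : Rspace R n) : R := \sum_(j < n) `|tnth x j|.

Let iS : (lebesgue n).-integrable setT (EFin \o (fun x => `|h x| * S x)).
Proof.
have a2 : 0 < a / 2 by rewrite divr_gt0.
apply: (integrable_dominated _ (gaussC (C * (n%:R + 2 / a)) a2)) => [|x].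
  apply: measurable_funM; first exact: measurableT_comp.
  apply: measurable_sum => j; apply: measurableT_comp => //; exact: measurable_tnth.
have S0 : 0 <= S x by apply: sumr_ge0.
have C0 : 0 <= C.
  by have := le_trans (normr_ge0 _) (h_le x); rewrite pmulr_lge0// expR_gt0.
rewrite ger0_norm ?mulr_ge0//.
have SE : S x <= (n%:R + 2 / a) * expR (a / 2 * dot x x).
  have h1 : S x <= n%:R + dot x x.
    rewrite /S /dot -[X in X%:R]card_ord -sumr_const -big_split /=.
    apply: ler_sum => j _; rewrite -expr2 -(real_normK (num_real (tnth x j : R))).
    have := sqr_ge0 (`|tnth x j : R| - 1); have := normr_ge0 (tnth x j : R); nra.
  have h2 : 1 + a / 2 * dot x x <= expR (a / 2 * dot x x) := expR_ge1Dx _.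
  have h3 : 0 <= dot x x := dot_ge0 x.
  have h4 : dot x x <= 2 / a * expR (a / 2 * dot x x).
    rewrite -ler_pdivrMl ?divr_gt0// invf_div; lra.
  have h5 : n%:R <= n%:R * expR (a / 2 * dot x x).
    by rewrite ler_peMr// (le_trans _ h2)// lerDl mulr_ge0// ltW.
  rewrite mulrDl; apply: (le_trans h1); exact: lerD.
apply: (le_trans (ler_pM (normr_ge0 _) S0 (h_le x) SE)).
rewrite le_eqVlt; apply/orP; left; apply/eqP.
have -> : expR (- (a / 2) * dot x x) = expR (- a * dot x x) * expR (a / 2 * dot x x).
  by rewrite -expRD; congr expR; lra.
by ring.
Qed.

(** A change of frequency costs a factor |x|, which half of the Gaussian decay of h
    absorbs. *)
Let lipschitz_F theta : exists2 L, 0 <= L & forall c c' (delta : R),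
  (forall j, `|c j - c' j| <= delta) -> `|F theta c - F theta c'| <= L * delta.
Proof.
exists (3 * \int[lebesgue n]_x (`|h x| * S x)) => [|c c' delta cc'].
  by rewrite mulr_ge0// Rintegral_ge0// => x _; rewrite mulr_ge0// sumr_ge0.
rewrite /F -RintegralB//; try exact: iF.
have iB : (lebesgue n).-integrable setT (EFin \o
    (fun x => h x * cos (theta + lin c x) - h x * cos (theta + lin c' x))).
  rewrite (_ : _ \o _ = (fun x => (h x * cos (theta + lin c x))%:E -
    (h x * cos (theta + lin c' x))%:E)%E)//.
  by apply: (integrableB _ (iF theta c) (iF theta c')).
apply: (le_trans (le_normr_Rintegral measurableT iB)).
have -> : 3 * \int[lebesgue n]_x (`|h x| * S x) * delta =
    \int[lebesgue n]_x ((3 * delta) * (`|h x| * S x)).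
  by rewrite RintegralZl//; ring.
apply: le_Rintegral => //.
- exact: (integrable_norm iB).
- exact: integrable_scale.
move=> x _; rewrite -mulrBr normrM.
have -> : 3 * delta * (`|h x| * S x) = `|h x| * (3 * (delta * S x)) by ring.
rewrite ler_wpM2l//; apply: (le_trans (cos_lipschitz _ _)); rewrite ler_wpM2l//.
have -> : theta + lin c x - (theta + lin c' x) = \sum_(j < n) (c j - c' j) * tnth x j.
  rewrite opprD addrACA subrr add0r /lin -sumrB.
  by apply: eq_bigr => j _; rewrite mulrBl.
apply: (le_trans (ler_norm_sum _ _ _)); rewrite /S mulr_sumr.
by apply: ler_sum => j _; rewrite normrM ler_wpM2r.
Qed.

(** Both sides are continuous in the frequency, and a set of full measure is
    dense. *)
Lemma trig_bound_everywhere (K b theta : R) :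
  (\forall xi \ae lebesgue n, `|F theta (tnth xi)| <= K * expR (- b * dot xi xi)) ->
  forall c, `|F theta c| <= K * expR (- b * \sum_(j < n) c j ^+ 2).
Proof.
move=> ae_le c; have [L L0 lip] := lipschitz_F theta.
have /choice[xi xiP] k := ae_cube c (@harmonic_gt0 R k) ae_le.
have near_c k j : `|c j - tnth (xi k) j| <= harmonic k.
  have /andP[h1 h2] := (xiP k).2 j.
  by rewrite distrC ger0_norm ?subr_ge0// lerBlDl.
have cvg_xi j : (fun k => tnth (xi k) j : R) @ \oo --> c j.
  apply: (@squeeze_cvgr _ _ _ _ (fun=> c j) (fun k => c j + harmonic k)).
  - by near=> k; exact: (xiP k).2.
  - exact: cvg_cst.
  - by rewrite -[X in _ --> X]addr0; apply: cvgD; [exact: cvg_cst|exact: cvg_harmonic].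
have cvg_dot : (fun k => dot (xi k) (xi k)) @ \oo --> \sum_(j < n) c j ^+ 2.
  rewrite /dot; apply: (@cvg_big R _ +%R 0 xpredT (@pseudometric_normed_Zmodule.add_continuous R R)).
  by move=> j _; rewrite expr2; apply: cvgM; exact: cvg_xi.
apply: (@cvgr_to_ge nat \oo _ R
  (fun k => K * expR (- b * dot (xi k) (xi k)) + L * harmonic k)); last first.
  near=> k; have := lip c (tnth (xi k)) _ (near_c k); have := (xiP k).1.
  have := ler_normD (F theta c - F theta (tnth (xi k))) (F theta (tnth (xi k))).
  by rewrite subrK => h1 h2 h3; rewrite (le_trans h1)// addrC lerD.
rewrite -[X in _ --> X]addr0; apply: cvgD; last first.
  by rewrite -[X in _ --> X](mulr0 L); apply: cvgM; [exact: cvg_cst|exact: cvg_harmonic].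
apply: cvgM; first exact: cvg_cst.
apply: (@cvg_comp _ _ _ _ expR); last exact: continuous_expR.
by apply: cvgM; [exact: cvg_cst|exact: cvg_dot].
Unshelve. all: by end_near. Qed.

End continuity.

End reductions.

(** * Hardy's theorem *)

Section hardy_borel.
Context {R : realType} {n : nat}.
Variables (h : Rspace R n -> R) (a b C K : R).
Hypotheses (a0 : 0 < a) (b0 : 0 < b) (ab : 1 <= 4 * a * b).
Hypothesis mh : measurable_fun setT h.
Hypothesis h_le : forall x, `|h x| <= C * expR (- a * dot x x).

Let F (theta : R) (xi : Rspace R n) :=
  \int[lebesgue n]_x (h x * cos (theta + lin (tnth xi) x)).

Hypothesis Fcos_le : \forall xi \ae lebesgue n, `|F 0 xi| <= K * expR (- b * dot xi xi).
Hypothesis Fsin_le : \forall xi \ae lebesgue n,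
  `|F (pi / 2) xi| <= K * expR (- b * dot xi xi).

(** As 1/(4b) <= a, the bound on h implies the one with exponent 1/(4b), for which
    the pair of bounds is critical. *)
Lemma hardy_borel : exists c : R,
  ae_eq (lebesgue n) setT h (fun x => c * expR (- (4 * b)^-1 * dot x x)).
Proof.
have b4 : 0 < (4 * b)^-1 by rewrite invr_gt0 mulr_gt0.
have ba : (4 * b)^-1 <= a.
  by rewrite -[(4 * b)^-1]mul1r ler_pdivrMr ?mulr_gt0// mulrCA mulrA.
have bE (s : R) : - s / (4 * (4 * b)^-1) = - b * s by field; rewrite gt_eqF.
have weaken (u v s : R) : u <= v -> u * expR s <= v * expR s.
  by move=> uv; rewrite ler_wpM2r// expR_ge0.
have CD : C <= Num.max C K by rewrite le_max lexx.
have KD : K <= Num.max C K by rewrite le_max lexx orbT.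
apply: (@hardy_critical _ _ h _ (Num.max C K) b4 mh) => [x|c|c].
- apply: (le_trans (h_le x)); apply: (le_trans (weaken _ _ _ CD)).
  apply: ler_wpM2l; last by rewrite ler_expR !mulNr lerN2 ler_wpM2r// dot_ge0.
  have := le_trans (normr_ge0 _) (h_le x).
  by rewrite pmulr_lge0 ?expR_gt0// => C0; exact: le_trans CD.
- rewrite bE; apply: le_trans (weaken _ _ _ KD).
  have := trig_bound_everywhere a0 mh h_le Fcos_le c.
  rewrite (@eq_Rintegral _ _ _ (lebesgue n) _ (fun x => h x * cos (lin c x)))//.
  by move=> x _; rewrite add0r.
- rewrite bE; apply: le_trans (weaken _ _ _ KD).
  have := trig_bound_everywhere a0 mh h_le Fsin_le (fun j => - 1 * c j).
  rewrite (eq_bigr (fun j => c j ^+ 2)) => [|j _]; last by rewrite mulN1r sqrrN.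
  rewrite (@eq_Rintegral _ _ _ (lebesgue n) _ (fun x => h x * sin (lin c x)))//.
  by move=> x _; rewrite linZ mulN1r addrC cosDpihalf sinN opprK.
Qed.

(** On cubes far away from the origin a nonzero multiple of e^{-|x|^2/(4b)} exceeds the
    bound on h, and such cubes have positive measure. *)
Lemma hardy_borel_supercritical : (0 < n)%N -> 1 < 4 * a * b ->
  ae_eq (lebesgue n) setT h (cst 0).
Proof.
move=> n0 ab1; have [c hc] := hardy_borel.
suff c0 : c = 0 by apply: filterS hc => x hx /hx ->; rewrite c0 mul0r.
pose e := a - (4 * b)^-1.
have e0 : 0 < e.
  by rewrite subr_gt0 -[(4 * b)^-1]mul1r ltr_pdivrMr ?mulr_gt0// mulrCA mulrA.
apply/normr0_eq0/eqP; rewrite eq_le normr_ge0 andbT.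
apply: (@le0_of_natmul_le _ _ (C / e)) => k.
have [x [hx /(_ (Ordinal n0))/andP[kx _]]] := ae_cube (fun=> k.+1%:R) (@ltr01 R) hc.
have k1 : 1 <= k.+1%:R :> R by rewrite ler1n.
have dk : k.+1%:R <= dot x x.
  rewrite /dot (bigD1 (Ordinal n0))//=.
  have : 0 <= \sum_(i < n | i != Ordinal n0) (tnth x i : R) * tnth x i.
    by apply: sumr_ge0 => i _; rewrite -expr2 sqr_ge0.
  have kx' : k.+1%:R <= tnth x (Ordinal n0) by [].
  nra.
have := h_le x; rewrite (hx I) normrM (ger0_norm (expR_ge0 _)).
have -> : expR (- (4 * b)^-1 * dot x x) = expR (- a * dot x x) * expR (e * dot x x).
  by rewrite -expRD /e; congr expR; ring.
rewrite [expR (- a * _) * _]mulrC mulrA ler_pM2r ?expR_gt0// => cC.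
have h1 : `|c| * (1 + e * dot x x) <= C.
  by apply: le_trans cC; rewrite ler_wpM2l// expR_ge1Dx.
have h2 : `|c| * (e * k.+1%:R) <= `|c| * (e * dot x x).
  by rewrite ler_wpM2l// ler_wpM2l// ltW.
rewrite ler_pdivlMr// -natr1 in h2 *.
have := normr_ge0 c; nra.
Qed.

End hardy_borel.

Lemma enorm_sqr (R : realType) n (x : Rspace R n) : enorm x ^+ 2 = dot x x.
Proof. by rewrite sqr_sqrtr// dot_ge0. Qed.

(** The representative g is cut off where measurability or the bound fails for h, so
    its Gaussian bound holds everywhere; the phases theta = 0 and theta = pi / 2 give
    the real and the imaginary part of the Fourier transform at xi. *)
Lemma borel_representative (R : realType) n (a b : R) (h : Rspace R n -> R) :
  lebesgue_measurable_fun h ->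
  (Linfty_norm (fun x => (expR (a * dot x x) * h x)%:C)%R < +oo)%E ->
  (Linfty_norm (fun xi => (expR (b * dot xi xi))%:C *
     fourier (fun x => (h x)%:C) xi)%R < +oo)%E ->
  exists g C K, [/\ measurable_fun setT g, ae_eq (lebesgue n) setT h g,
    forall x, `|g x| <= C * expR (- a * dot x x) &
    forall theta, theta = 0 \/ theta = pi / 2 -> \forall xi \ae lebesgue n,
      `|\int[lebesgue n]_x (g x * cos (theta + lin (tnth xi) x))| <=
      K * expR (- b * dot xi xi)].
Proof.
move=> mh /Linfty_norm_lty[C hC] /Linfty_norm_lty[K hK].
have [N1 [mN1 N10 mhN1]] := borel_modification mh.
have [N2 [mN2 N20 hCN2]] := ae_null_set hC.
pose N := N1 `|` N2; have mN : measurable N by exact: measurableU.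
have N0 : lebesgue n N = 0%E.
  by apply/negligibleP => //; apply: negligibleU; apply/negligibleP.
pose g := h \_ (~` N).
have gE x : ~ N x -> g x = h x by move=> Nx; rewrite /g patchE mem_set.
have g_le x : `|g x| <= `|C| * expR (- a * dot x x).
  have [Nx|Nx] := pselect (N x).
    by rewrite /g patchE memNset ?normr0 ?mulr_ge0 ?expR_ge0//= => /(_ Nx).
  have : cnorm (expR (a * dot x x) * h x)%:C <= C by apply: hCN2 => ?; apply: Nx; right.
  rewrite gE// cnormR normrM (ger0_norm (expR_ge0 _)) mulNr expRN -ler_pdivlMl ?expR_gt0//.
  move=> /le_trans; apply; rewrite mulrC ler_wpM2r ?invr_ge0 ?expR_ge0//.
  exact: ler_norm.
have mg : measurable_fun setT g.
  apply/(measurable_restrictT _ (measurableC mN)).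
  apply: (measurable_funS (measurableC mN1) _ mhN1) => x Nx N1x.
  by apply: Nx; left.
pose G theta xi := \int[lebesgue n]_x (g x * cos (theta + lin (tnth xi) x)).
have CintE xi : Cintegral (fun x => expi (- dot xi x) * (h x)%:C) =
    G 0 xi +i* G (pi / 2) xi.
  rewrite /Cintegral; congr (_ +i* _); congr fine; apply: (integral_null mN N0) => x Nx.
    by rewrite ReImE /= mulr0 subr0 -gE// cosN add0r mulrC.
  by rewrite ReImE /= mulr0 add0r -gE// [pi / 2 + _]addrC cosDpihalf sinN mulrC.
pose P : R := (2 * pi) `^ (- (n%:R / 2)).
have P0 : 0 < P by rewrite powR_gt0// mulr_gt0// pi_gt0.
have G_le xi theta : theta = 0 \/ theta = pi / 2 ->
    `|G theta xi| <= cnorm (G 0 xi +i* G (pi / 2) xi).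
  move=> [] ->; [exact: (Re_le_cnorm (_ +i* _))|].
  exact: (Im_le_cnorm (_ +i* _)).
exists g, `|C|, (K / P); split => //.
  exists N; split => // x /= hx; apply: contrapT => Nx; apply: hx => _.
  by rewrite gE.
move=> theta /G_le Gt; apply: filterS hK => xi.
rewrite !cnormM -/P !cnormR (ger0_norm (expR_ge0 _)) (gtr0_norm P0) CintE => hxi.
apply: (le_trans (Gt xi)); rewrite mulNr expRN mulrAC ler_pdivlMr// ler_pdivlMr ?expR_gt0//.
by move: hxi; congr (is_true (_ <= _)); ring.
Qed.

Theorem theorem2 (R : realType) (n : nat) (alpha beta : R)
    (h : Rspace R n -> R) :
  (1 <= n)%N -> 0 < alpha -> 0 < beta ->
  lebesgue_measurable_fun h ->
  (Linfty_norm (fun x => (expR (enorm x ^+ 2 / beta ^+ 2) * h x)%:C)%R +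
   Linfty_norm (fun xi => (expR (4 * enorm xi ^+ 2 / alpha ^+ 2))%:C *
                          fourier (fun x => (h x)%:C) xi)%R < +oo)%E ->
  (1 / (alpha * beta) > 1 / 4 -> \forall x \ae lebesgue n, h x = 0) /\
  (1 / (alpha * beta) = 1 / 4 ->
   exists c : R, \forall x \ae lebesgue n,
     h x = c * expR (- (enorm x ^+ 2 / beta ^+ 2))).
Proof.
move=> n0 al0 be0 mh norms.
pose a := (beta ^+ 2)^-1; pose b := 4 / alpha ^+ 2.
have a0 : 0 < a by rewrite invr_gt0 exprn_gt0.
have b0 : 0 < b by rewrite divr_gt0// exprn_gt0.
have [nx nxi] : (Linfty_norm (fun x => (expR (a * dot x x) * h x)%:C)%R < +oo)%E /\
    (Linfty_norm (fun xi => (expR (b * dot xi xi))%:C *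
      fourier (fun x => (h x)%:C) xi)%R < +oo)%E.
  split; apply: le_lt_trans norms.
    rewrite (_ : Linfty_norm (fun x => (expR (a * dot x x) * h x)%:C)%R =
      Linfty_norm (fun x => (expR (enorm x ^+ 2 / beta ^+ 2) * h x)%:C)%R).
      by apply: leeDl; exact: Lnorm_ge0.
    by congr Linfty_norm; apply/funext => x; rewrite enorm_sqr [a * _]mulrC.
  rewrite (_ : Linfty_norm (fun xi => (expR (b * dot xi xi))%:C * _)%R =
    Linfty_norm (fun xi => (expR (4 * enorm xi ^+ 2 / alpha ^+ 2))%:C *
      fourier (fun x => (h x)%:C) xi)%R).
    by apply: leeDr; exact: Lnorm_ge0.
  by congr Linfty_norm; apply/funext => xi; rewrite enorm_sqr mulrAC.
have [g [C [K [mg hg g_le G_le]]]] := borel_representative mh nx nxi.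
have G0 := G_le 0 (or_introl erefl).
have G1 := G_le (pi / 2) (or_intror erefl).
have abE : 4 * a * b = (4 * (1 / (alpha * beta))) ^+ 2.
  by rewrite /a /b; field; rewrite !gt_eqF.
split => [super|crit].
  have ab1 : 1 < 4 * a * b.
    by rewrite abE; move: super; move: (1 / (alpha * beta)) => s; nra.
  have := hardy_borel_supercritical a0 b0 (ltW ab1) mg g_le G0 G1 n0 ab1.
  by apply: filterS2 hg => x /(_ I) -> /(_ I).
have ab1 : 4 * a * b = 1.
  by rewrite abE crit; field.
have ab1' : 1 <= 4 * a * b by rewrite ab1.
have [c hc] := hardy_borel a0 b0 ab1' mg g_le G0 G1.
have b4 : 4 * b != 0 by rewrite mulf_neq0 ?gt_eqF.
have aE : (4 * b)^-1 = a by apply: (mulfI b4); rewrite mulfV//; apply: (etrans (esym ab1)); ring.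
exists c; apply: filterS2 hg hc => x /(_ I) -> /(_ I) ->.
by rewrite enorm_sqr aE mulNr [a * _]mulrC.
Qed.
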